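(* Let $M=M^m\times M^{n-m}$ be a product of smooth manifolds of dimensions $m$ and $n-m$, and consider the constrained second-order system $\ddot x^a=F^a(t,x^b,x^\beta,\dot x^b)$, $\dot x^\alpha=\Psi^\alpha(t,x^b,x^\beta,\dot x^b)$ ($a,b=1,\dots,m$; $\alpha,\beta=m+1,\dots,n$), with constraint submanifold $\tilde E$, field $\tilde\Gamma$ on $\tilde E$, tensors $S,Q$ and projectors $P_{\tilde\Gamma},N,P_V,P_H$ as in the context. Let $M^{n-m}$ be equipped with a linear connection (not necessarily symmetric) with coefficients $\Upsilon^\gamma_{\alpha\beta}$ in the basis $\{\partial/\partial x^\alpha\}$. Define submodule covariant derivatives on $\operatorname{im}(P_{\tilde\Gamma})$, $\operatorname{im}(N)$, $\operatorname{im}(P_H)$, $\operatorname{im}(P_V)$ respectively by $$\nabla^{\tilde\Gamma}_XY:=X(dt(Y))\tilde\Gamma,\quad \nabla^N_XY:=\bigl(X(Y^\gamma)+\Upsilon^\gamma_{\alpha\beta}X^\alpha Y^\beta\bigr)\frac{\partial}{\partial x^\gamma},\quad \nabla^{\tilde H}_XY:=Q([X,S(Y)]),\quad \nabla^{\tilde V}_XY:=S([X,Q(Y)]),$$ with extensions $\bar\nabla^{\tilde\Gamma},\bar\nabla^N,\bar\nabla^{\tilde H},\bar\nabla^{\tilde V}$. Then $$\tilde\nabla_XY:=\bar\nabla^{\tilde\Gamma}_X(P_{\tilde\Gamma}(Y))+\bar\nabla^N_X(N(Y))+\bar\nabla^{\tilde H}_X(P_H(Y))+\bar\nabla^{\tilde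 V}_X(P_V(Y)),\qquad X,Y\in\mathfrak X(\tilde E),$$ explicitly $$\begin{aligned}\tilde\nabla_XY=\ &X(dt(Y))\tilde\Gamma+\nabla^N_{N(X)}(N(Y))+Q([P_H(X),S(Y)])+S([P_V(X),Q(Y)])\\&+N([X-N(X),N(Y)])+P_H([X-P_H(X),P_H(Y)])+P_V([X-P_V(X),P_V(Y)]),\end{aligned}$$ is the unique linear connection on $\tilde E$ satisfying all of the following conditions, where $T$ and $R$ are the torsion and curvature of $\tilde\nabla$ and $X,Y$ are arbitrary vector fields on $\tilde E$: 1. $\tilde\nabla\tilde\Gamma=0$, $\tilde\nabla dt=0$, $\tilde\nabla S=0$, $\tilde\nabla Q=0$, $\tilde\nabla_{\tilde V_a}\tilde V_b=0$; 2. $P_H(X)=T(\tilde\Gamma,S(X))$ and $P_V(X)=S(T(\tilde\Gamma,X))$; 3. $R(\tilde\Gamma,\tilde V_a)=0$, $\tilde\nabla N=0$, $\tilde\nabla_{\frac{\partial}{\partial x^\alpha}}\frac{\partial}{\partial x^\beta}=\Upsilon^\gamma_{\alpha\beta}\frac{\partial}{\partial x^\gamma}$; 4. $(I-P_V)\bigl(T((I-N)(X),N(Y))\bigr)=0$.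
   Context: Indices: $a,b,c=1,\dots,m$ and $\alpha,\beta,\gamma=m+1,\dots,n$; summation over repeated indices is understood. $M^m$ has local coordinates $(x^a)$, $M^{n-m}$ has local coordinates $(x^\alpha)$, and only coordinate changes respecting the product structure of $M$ are allowed. The evolution space $E=\mathbb R\times TM\cong J^1(\mathbb R,M)$ has adapted coordinates $(t,x^a,x^\alpha,u^a,u^\alpha)$. The constraint submanifold is $\tilde E=\{p\in E: u^\alpha(p)=\Psi^\alpha(p)\}$, with local coordinates $(t,x^a,x^\alpha,u^a)$; $F^a$ and $\Psi^\alpha$ are smooth functions of these. The system is represented by the vector field on $\tilde E$ $$\tilde\Gamma=\frac{\partial}{\partial t}+u^a\frac{\partial}{\partial x^a}+\Psi^\beta\frac{\partial}{\partial x^\beta}+F^b\frac{\partial}{\partial u^b}.$$ Put $$\tilde\Gamma^b_a:=-\tfrac12\frac{\partial F^b}{\partial u^a},\quad \Psi^\beta_a:=-\frac{\partial\Psi^\beta}{\partial u^a},\quad \tilde V_a:=\frac{\partial}{\partial u^a},\quad \tilde H_a:=\frac{\partial}{\partial x^a}-\tilde\Gamma^b_a\frac{\partial}{\partial u^b}-\Psi^\beta_a\frac{\partial}{\partial x^\beta}.$$ Then $\{\tilde\Gamma,\partial/\partial x^\alpha,\tilde V_a,\tilde H_a\}$ is a local frame on $\tilde E$ with dual coframe $\{dt,\eta^\alpha,\tilde\psi^a,\theta^a\}$, where $$\theta^a=dx^a-u^adt,\quad \eta^\alpha=dx^\alpha-\Psi^\alpha dt+\Psi^\alpha_b\theta^b,\quad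 \tilde\psi^a=du^a-F^adt+\tilde\Gamma^a_b\theta^b.$$ The following $(1,1)$ tensors on $\tilde E$ are used, with $(\omega\otimes Z)(X)=\omega(X)Z$: $$P_{\tilde\Gamma}=dt\otimes\tilde\Gamma,\quad N=\eta^\alpha\otimes\frac{\partial}{\partial x^\alpha},\quad P_V=\tilde\psi^a\otimes\tilde V_a,\quad P_H=\theta^a\otimes\tilde H_a,\quad S=\theta^a\otimes\tilde V_a,\quad Q=\tilde\psi^a\otimes\tilde H_a.$$ The projectors $P_{\tilde\Gamma},N,P_V,P_H$ give a direct sum decomposition of $\mathfrak X(\tilde E)$. In the definition of $\nabla^N$, $X=X^\alpha\partial/\partial x^\alpha$ and $Y=Y^\alpha\partial/\partial x^\alpha$ are in $\operatorname{im}(N)$ with components smooth functions on $\tilde E$, and $\Upsilon^\gamma_{\alpha\beta}$ are functions on $M^{n-m}$ pulled back to $\tilde E$. Extension: for a projector $P$ and a submodule covariant derivative $\nabla^P$ on $\operatorname{im}(P)$ (a map defined on pairs from $\operatorname{im}(P)$ with the usual covariant derivative properties), $\bar\nabla^P_XY:=\nabla^P_{P(X)}Y+P([X-P(X),Y])$ for $X\in\mathfrak X(\tilde E)$, $Y\in\operatorname{im}(P)$. Torsion and curvature: $T(X,Y)=\tilde\nabla_XY-\tilde\nabla_YX-[X,Y]$, $R(X,Y)Z=\tilde\nabla_X\tilde\nabla_YZ-\tilde\nabla_Y\tilde\nabla_XZ-\tilde\nabla_{[X,Y]}Z$. For a $(1,1)$ tensor $B$, $(\tilde\nabla_XB)(Y)=\tilde\nabla_X(B(Y))-B(\tilde\nabla_XY)$.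 Conditions involving $\tilde V_a$ and $\partial/\partial x^\alpha$ are understood for all indices, in the adapted local coordinates. *)

(* Defs.v *)
From HB Require Import structures.
From mathcomp Require Import all_boot all_order all_algebra.
From mathcomp Require Import all_classical all_reals all_analysis.

Set Implicit Arguments.
Unset Strict Implicit.
Unset Printing Implicit Defensive.

Import Order.TTheory GRing.Theory Num.Theory.
Import numFieldNormedType.Exports.

Local Open Scope classical_set_scope.
Local Open Scope ring_scope.

(* C^n in the sense of Frechet differentiability together with C^(n-1)
   directional derivatives; it is only used for finite-dimensional V, W and
   open U, where it is the usual notion. *)
Fixpoint Cn (R : realType) (V W : normedModType R) (n : nat) (U : set V)
    (f : V -> W) : Prop :=
  match n with
  | 0 => forall x, U x -> {for x, continuous f}
  | n'.+1 => (forall x, U x -> differentiable f x) /\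
             (forall v : V, Cn n' U ('D_v f))
  end.

Definition smooth_on (R : realType) (V W : normedModType R) (U : set V)
    (f : V -> W) : Prop :=
  forall n, Cn n U f.

(** ** Smooth manifolds, given by an atlas on a set of points *)

Record charted (R : realType) (V : normedModType R) := Charted {
  pt : Type;
  chart : Type;
  dom : chart -> set pt;
  coord : chart -> pt -> V }.
Arguments dom {R V c} _ _.
Arguments coord {R V c} _ _.

Definition cod (R : realType) (V : normedModType R) (M : charted V)
    (c : chart M) : set V :=
  coord c @` dom c.

(* [lrep c f] is f \o (coord c)^-1 on [cod c]; it is 0 off [cod c]. *)
Definition lrep (R : realType) (V W : normedModType R) (M : charted V)
    (c : chart M) (f : pt M -> W) : V -> W :=
  fun z => xget 0 [set w | exists p, [/\ dom c p, coord c p = z & f p = w]].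

Definition trans (R : realType) (V : normedModType R) (M : charted V)
    (c c' : chart M) : V -> V :=
  lrep c (coord c').

Definition mopen (R : realType) (V : normedModType R) (M : charted V)
    (A : set (pt M)) : Prop :=
  forall c : chart M, open (coord c @` (A `&` dom c)).

Record smooth_manifold (R : realType) (V : normedModType R)
    (M : charted V) : Prop := SmoothManifold {
  coord_inj : forall (c : chart M) p q,
    dom c p -> dom c q -> coord c p = coord c q -> p = q;
  dom_cover : forall p : pt M, exists c : chart M, dom c p;
  overlap_open : forall c c' : chart M, open (coord c @` (dom c' `&` dom c));
  trans_smooth : forall c c' : chart M,
    smooth_on (coord c @` (dom c' `&` dom c)) (trans c c');
  mhausdorff : forall p q : pt M, p <> q ->
    exists A B : set (pt M),
      [/\ mopen A, mopen B, A p, B q & A `&` B = set0];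
  msecond_countable : exists B : nat -> set (pt M),
    (forall n, mopen (B n)) /\
    (forall A p, mopen A -> A p -> exists n, B n p /\ B n `<=` A) }.

Definition smooth_fun (R : realType) (V : normedModType R) (M : charted V)
    (f : pt M -> R^o) : Prop :=
  forall c : chart M, smooth_on (cod c) (lrep c f).

(* A field is a family of local representatives; its values off [cod c] are
   meaningless, so that fields are compared with [eqf] rather than [=]. *)
Definition field (R : realType) (V : normedModType R) (M : charted V) : Type :=
  chart M -> V -> V.

Definition eqf (R : realType) (V : normedModType R) (M : charted V)
    (X Y : field M) : Prop :=
  forall (c : chart M) z, cod c z -> X c z = Y c z.

Definition vector_field (R : realType) (V : normedModType R) (M : charted V)
    (X : field M) : Prop :=
  (forall c : chart M, smooth_on (cod c) (X c)) /\
  (forall (c c' : chart M) p, dom c p -> dom c' p ->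
     X c' (coord c' p) = 'D_(X c (coord c p)) (trans c c') (coord c p)).

Definition addf (R : realType) (V : normedModType R) (M : charted V)
    (X Y : field M) : field M := fun c z => X c z + Y c z.
Definition subf (R : realType) (V : normedModType R) (M : charted V)
    (X Y : field M) : field M := fun c z => X c z - Y c z.
Definition zerof (R : realType) (V : normedModType R) (M : charted V)
  : field M := fun _ _ => 0.
Arguments zerof {R V} M _ _.
Definition scalef (R : realType) (V : normedModType R) (M : charted V)
    (f : pt M -> R^o) (X : field M) : field M :=
  fun c z => lrep c f z *: X c z.

(* X(f) *: Y *)
Definition dscalef (R : realType) (V : normedModType R) (M : charted V)
    (X : field M) (f : pt M -> R^o) (Y : field M) : field M :=
  fun c z => 'D_(X c z) (lrep c f) z *: Y c z.

Definition bracket (R : realType) (V : normedModType R) (M : charted V)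
    (X Y : field M) : field M :=
  fun c z => 'D_(X c z) (Y c) z - 'D_(Y c z) (X c) z.

(** ** Linear connections *)

Record linear_connection (R : realType) (V : normedModType R) (M : charted V)
    (D : field M -> field M -> field M) : Prop := LinearConnection {
  conn_field : forall X Y, vector_field X -> vector_field Y ->
    vector_field (D X Y);
  conn_ext : forall X X' Y Y', vector_field X -> vector_field X' ->
    vector_field Y -> vector_field Y' -> eqf X X' -> eqf Y Y' ->
    eqf (D X Y) (D X' Y');
  conn_addl : forall X X' Y,
    vector_field X -> vector_field X' -> vector_field Y ->
    eqf (D (addf X X') Y) (addf (D X Y) (D X' Y));
  conn_scalel : forall f X Y,
    smooth_fun f -> vector_field X -> vector_field Y ->
    eqf (D (scalef f X) Y) (scalef f (D X Y));
  conn_addr : forall X Y Y',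
    vector_field X -> vector_field Y -> vector_field Y' ->
    eqf (D X (addf Y Y')) (addf (D X Y) (D X Y'));
  conn_leibniz : forall f X Y,
    smooth_fun f -> vector_field X -> vector_field Y ->
    eqf (D X (scalef f Y)) (addf (dscalef X f Y) (scalef f (D X Y))) }.

Definition torsion (R : realType) (V : normedModType R) (M : charted V)
    (D : field M -> field M -> field M) (X Y : field M) : field M :=
  subf (subf (D X Y) (D Y X)) (bracket X Y).

Definition curvature (R : realType) (V : normedModType R) (M : charted V)
    (D : field M -> field M -> field M) (X Y Z : field M) : field M :=
  subf (subf (D X (D Y Z)) (D Y (D X Z))) (D (bracket X Y) Z).

Definition cov_tensor (R : realType) (V : normedModType R) (M : charted V)
    (D : field M -> field M -> field M) (B : field M -> field M)
    (X Y : field M) : field M :=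
  subf (D X (B Y)) (B (D X Y)).

(* A statement about the value of an operator at a local field [Z], defined in
   the chart c only, is expressed through globally defined fields which agree
   with [Z] on an open subset of the chart. *)
Definition chart_open (R : realType) (V : normedModType R) (M : charted V)
    (c : chart M) (A : set (pt M)) : Prop :=
  mopen A /\ A `<=` dom c.

Definition agree_on (R : realType) (V : normedModType R) (M : charted V)
    (c : chart M) (A : set (pt M)) (X : field M) (Z : V -> V) : Prop :=
  forall p, A p -> X c (coord c p) = Z (coord c p).

(* Ups c i j l is the l-th component of D_(d/dx^i) (d/dx^j) in the chart c. *)
Definition has_coefficients (R : realType) (k : nat)
    (M : charted 'rV[R]_k) (D : field M -> field M -> field M)
    (Ups : chart M -> 'I_k -> 'I_k -> 'I_k -> 'rV[R]_k -> R) : Prop :=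
  forall (c : chart M) (A : set (pt M)) (i j : 'I_k) (X Y : field M),
    chart_open c A -> vector_field X -> vector_field Y ->
    agree_on c A X (fun=> delta_mx 0 i) -> agree_on c A Y (fun=> delta_mx 0 j) ->
    agree_on c A (D X Y)
      (fun z => \sum_(l < k) Ups c i j l z *: delta_mx 0 l).

(** ** Product manifold, tangent vectors and E = R x TM *)

Definition prod_charted (R : realType) (V1 V2 : normedModType R)
    (M1 : charted V1) (M2 : charted V2) : charted (V1 * V2)%type :=
  @Charted R (V1 * V2)%type (pt M1 * pt M2)%type (chart M1 * chart M2)%type
    (fun c => dom c.1 `*` dom c.2)
    (fun c p => (coord c.1 p.1, coord c.2 p.2)).

(* [tvec_junk] makes two tangent vectors with the same components equal. *)
Record tangent (R : realType) (V : normedModType R) (M : charted V)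
    (p : pt M) := Tangent {
  tvec : chart M -> V;
  tvec_trans : forall c c' : chart M, dom c p -> dom c' p ->
    tvec c' = 'D_(tvec c) (trans c c') (coord c p);
  tvec_junk : forall c : chart M, ~ dom c p -> tvec c = 0 }.

Record jet (R : realType) (V : normedModType R) (M : charted V) := Jet {
  jtime : R;
  jbase : pt M;
  jvel : tangent jbase }.

(* coordinates (t, x^a, x^alpha, u^a) *)
Notation VE R m k := (R^o * 'rV[R]_m * 'rV[R]_k * 'rV[R]_m)%type.

Definition ct (R : realType) (m k : nat) (z : VE R m k) : R^o := z.1.1.1.
Definition cx (R : realType) (m k : nat) (z : VE R m k) : 'rV[R]_m := z.1.1.2.
Definition cy (R : realType) (m k : nat) (z : VE R m k) : 'rV[R]_k := z.1.2.
Definition cu (R : realType) (m k : nat) (z : VE R m k) : 'rV[R]_m := z.2.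

Definition e_x (R : realType) (m k : nat) (a : 'I_m) : VE R m k :=
  (0, delta_mx 0 a, 0, 0).
Definition e_y (R : realType) (m k : nat) (i : 'I_k) : VE R m k :=
  (0, 0, delta_mx 0 i, 0).
Definition e_u (R : realType) (m k : nat) (a : 'I_m) : VE R m k :=
  (0, 0, 0, delta_mx 0 a).
Arguments e_x {R m k} a.
Arguments e_y {R m k} i.
Arguments e_u {R m k} a.

(** ** The constrained system *)

Record csys (R : realType) (m k : nat) (M1 : charted 'rV[R]_m)
    (M2 : charted 'rV[R]_k) := CSys {
  cF : chart M1 * chart M2 -> VE R m k -> 'rV[R]_m;
  cPsi : chart M1 * chart M2 -> VE R m k -> 'rV[R]_k }.

Section System.

Context (R : realType) (m k : nat).
Context (M1 : charted 'rV[R]_m) (M2 : charted 'rV[R]_k) (s : csys M1 M2).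

Local Notation M := (prod_charted M1 M2).

Definition jcoord (c : chart M) (j : jet M) : VE R m k :=
  (jtime j, (coord c (jbase j)).1, (coord c (jbase j)).2, (tvec (jvel j) c).1).

(* u^alpha = Psi^alpha, read in the chart c *)
Definition constraint (c : chart M) (j : jet M) : Prop :=
  (tvec (jvel j) c).2 = cPsi s c (jcoord c j).

Definition Etilde : charted (VE R m k) :=
  @Charted R (VE R m k)
    {j : jet M | forall c : chart M, dom c (jbase j) -> constraint c j}
    (chart M)
    (fun c j => dom c (jbase (sval j)))
    (fun c j => jcoord c (sval j)).

Definition tGamma : field Etilde :=
  fun c z => (1, cu z, cPsi s c z, cF s c z).

(* F and Psi are smooth; the constraint does not depend on the chart in which
   it is read; the local expressions of the system fit together into a vector
   field on Etilde. *)
Record constrained_system : Prop := ConstrainedSystem {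
  cF_smooth : forall c : chart M,
    smooth_on [set z | cod c.1 (cx z) /\ cod c.2 (cy z)] (cF s c);
  cPsi_smooth : forall c : chart M,
    smooth_on [set z | cod c.1 (cx z) /\ cod c.2 (cy z)] (cPsi s c);
  constraint_chart : forall (j : jet M) (c c' : chart M),
    dom c (jbase j) -> dom c' (jbase j) -> constraint c j -> constraint c' j;
  tGamma_field : vector_field tGamma }.

(** Frame and coframe in the chart c *)

(* tilde Gamma^b_a *)
Definition GamT (c : chart M) (a b : 'I_m) (z : VE R m k) : R :=
  - 2^-1 * 'D_(e_u a) (fun w : VE R m k => cF s c w 0 b : R^o) z.

(* Psi^i_a *)
Definition PsiT (c : chart M) (a : 'I_m) (i : 'I_k) (z : VE R m k) : R :=
  - 'D_(e_u a) (fun w : VE R m k => cPsi s c w 0 i : R^o) z.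

Definition Vfr (a : 'I_m) (z : VE R m k) : VE R m k := e_u a.

Definition Yfr (i : 'I_k) (z : VE R m k) : VE R m k := e_y i.

Definition Hfr (c : chart M) (a : 'I_m) (z : VE R m k) : VE R m k :=
  e_x a - \sum_(b < m) GamT c a b z *: e_u b
            - \sum_(i < k) PsiT c a i z *: e_y i.

(* The arguments are the base point z and the vector v at z. *)
Definition theta (a : 'I_m) (z v : VE R m k) : R :=
  cx v 0 a - cu z 0 a * ct v.

Definition eta (c : chart M) (i : 'I_k) (z v : VE R m k) : R :=
  cy v 0 i - cPsi s c z 0 i * ct v + \sum_(b < m) PsiT c b i z * theta b z v.

Definition psi (c : chart M) (a : 'I_m) (z v : VE R m k) : R :=
  cu v 0 a - cF s c z 0 a * ct v + \sum_(b < m) GamT c b a z * theta b z v.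

(** The (1,1) tensors *)

Definition PG (X : field Etilde) : field Etilde :=
  fun c z => ct (X c z) *: tGamma c z.
Definition PN (X : field Etilde) : field Etilde :=
  fun c z => \sum_(i < k) eta c i z (X c z) *: Yfr i z.
Definition PV (X : field Etilde) : field Etilde :=
  fun c z => \sum_(a < m) psi c a z (X c z) *: Vfr a z.
Definition PH (X : field Etilde) : field Etilde :=
  fun c z => \sum_(a < m) theta a z (X c z) *: Hfr c a z.
Definition tS (X : field Etilde) : field Etilde :=
  fun c z => \sum_(a < m) theta a z (X c z) *: Vfr a z.
Definition tQ (X : field Etilde) : field Etilde :=
  fun c z => \sum_(a < m) psi c a z (X c z) *: Hfr c a z.

(** Submodule covariant derivatives and their extensions *)

Context (Ups : chart M2 -> 'I_k -> 'I_k -> 'I_k -> 'rV[R]_k -> R).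

Definition nabG (X Y : field Etilde) : field Etilde :=
  fun c z => 'D_(X c z) (fun w => ct (Y c w)) z *: tGamma c z.

Definition nabN (X Y : field Etilde) : field Etilde :=
  fun c z => \sum_(l < k)
    ('D_(X c z) (fun w => cy (Y c w) 0 l : R^o) z +
     \sum_(i < k) \sum_(j < k)
       Ups c.2 i j l (cy z) * cy (X c z) 0 i * cy (Y c z) 0 j) *: Yfr l z.

Definition nabH (X Y : field Etilde) : field Etilde := tQ (bracket X (tS Y)).

Definition nabV (X Y : field Etilde) : field Etilde := tS (bracket X (tQ Y)).

Definition extend (P : field Etilde -> field Etilde)
    (nab : field Etilde -> field Etilde -> field Etilde)
    (X Y : field Etilde) : field Etilde :=
  addf (nab (P X) Y) (P (bracket (subf X (P X)) Y)).

Definition tnabla (X Y : field Etilde) : field Etilde :=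
  addf (addf (addf
    (extend PG nabG X (PG Y))
    (extend PN nabN X (PN Y)))
    (extend PH nabH X (PH Y)))
    (extend PV nabV X (PV Y)).

Definition tnabla_explicit (X Y : field Etilde) : field Etilde :=
  addf (addf (addf (addf (addf (addf
    (nabG X Y)
    (nabN (PN X) (PN Y)))
    (tQ (bracket (PH X) (tS Y))))
    (tS (bracket (PV X) (tQ Y))))
    (PN (bracket (subf X (PN X)) (PN Y))))
    (PH (bracket (subf X (PH X)) (PH Y))))
    (PV (bracket (subf X (PV X)) (PV Y))).

(** The characterizing conditions *)

Record adapted (D : field Etilde -> field Etilde -> field Etilde) : Prop :=
  Adapted {
  nabla_Gamma : forall X, vector_field X -> eqf (D X tGamma) (zerof Etilde);
  nabla_dt : forall X Y, vector_field X -> vector_field Y ->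
    forall (c : chart Etilde) z, cod c z ->
      'D_(X c z) (fun w => ct (Y c w)) z - ct (D X Y c z) = 0;
  nabla_S : forall X Y, vector_field X -> vector_field Y ->
    eqf (cov_tensor D tS X Y) (zerof Etilde);
  nabla_Q : forall X Y, vector_field X -> vector_field Y ->
    eqf (cov_tensor D tQ X Y) (zerof Etilde);
  nabla_VV : forall (c : chart Etilde) A (a b : 'I_m) X Y,
    chart_open c A -> vector_field X -> vector_field Y ->
    agree_on c A X (Vfr a) -> agree_on c A Y (Vfr b) ->
    agree_on c A (D X Y) (fun=> 0);
  torsion_PH : forall X, vector_field X ->
    eqf (PH X) (torsion D tGamma (tS X));
  torsion_PV : forall X, vector_field X ->
    eqf (PV X) (tS (torsion D tGamma X));
  curvature_GV : forall (c : chart Etilde) A (a : 'I_m) X Z,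
    chart_open c A -> vector_field X -> vector_field Z ->
    agree_on c A X (Vfr a) ->
    agree_on c A (curvature D tGamma X Z) (fun=> 0);
  nabla_N : forall X Y, vector_field X -> vector_field Y ->
    eqf (cov_tensor D PN X Y) (zerof Etilde);
  nabla_YY : forall (c : chart Etilde) A (i j : 'I_k) X Y,
    chart_open c A -> vector_field X -> vector_field Y ->
    agree_on c A X (Yfr i) -> agree_on c A Y (Yfr j) ->
    agree_on c A (D X Y)
      (fun z => \sum_(l < k) Ups c.2 i j l (cy z) *: Yfr l z);
  torsion_N : forall X Y, vector_field X -> vector_field Y ->
    let T := torsion D (subf X (PN X)) (PN Y) in
    eqf (subf T (PV T)) (zerof Etilde) }.

End System.

(* Main.v *)
(** In the frame (Gamma, d/dx^alpha, H_a, V_a) the connection matrix of the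
    proposed connection is block diagonal: 0 on Gamma, a block wN on the
    d/dx^alpha, and one and the same block wH on the H_a and on the V_a.  The
    characterizing conditions thereby become identities between frame components,
    all of which follow from the symmetry of second derivatives of F and Psi.

    The projectors do not depend on the chart because
    [Gamma, S X] - S [Gamma, X] = P_V X - P_H X and S is plainly invariant.

    Uniqueness.  Bump functions make a linear connection local, so the difference
    of two connections satisfying the conditions is at each point a bilinear map
    A.  Since Gamma, S, Q and N are parallel, A(X, .) kills Gamma and has a block
    on the d/dx^alpha and equal blocks on the H_a and the V_a.  The torsion
    conditions and the conditions on the derivatives of V_b along V_a and of
    d/dx^beta along d/dx^alpha give A(X, .) = 0 for X = Gamma, V_a, d/dx^alpha.
    So the two connections agree along Gamma and V_a, and R(Gamma, V_a) = 0 makes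
    them agree along [Gamma, V_a], which is -H_a plus a vertical vector. *)

Require Import Defs.
From HB Require Import structures.
From mathcomp Require Import all_boot all_order all_algebra.
From mathcomp Require Import all_classical all_reals all_analysis.
From mathcomp Require Import ring lra.

Import Order.TTheory GRing.Theory Num.Theory.
Import numFieldNormedType.Exports.
Import Defs.

Set Implicit Arguments.
Unset Strict Implicit.
Unset Printing Implicit Defensive.

Local Open Scope classical_set_scope.
Local Open Scope ring_scope.

(** * Directional derivatives *)

(** The coframe shapes the calculation. For dt, eta, theta and psi, Cartan's formula gives the
    component of a bracket as two directional derivatives minus an exterior derivative. In an
    extended submodule derivative the inner derivative differentiates a component along [P X] and
    the bracket along [X - P X]; together they give the derivative along [X], and the leftover
    exterior derivatives, with Upsilon added on im N, are the connection forms. That H_a and V_a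
    receive the same block rests on the factor 1/2 in [GamT]: in d psi the first derivatives of F
    have coefficients -1 and 1/2, whose sum reproduces tilde Gamma.

    Fields are global while the conditions are local, so local data are globalized with bump
    functions. These are built on the two factors, from compactness and the Hausdorff property, and
    multiplied on [Etilde].

    A derivative in a moving direction is expanded along a finite spanning family; this reduces the
    calculus to the fixed directions in which [Cn] is phrased. *)

Section Differential.
Context {R : realType}.
Implicit Types V W Z : normedModType R.

(** Differentiability is a condition on the first-order expansion near 0, which functions with the
    same germ share; uniqueness of the differential identifies ['d g x] with ['d f x]. *)
Lemma differentiable_near V W (f g : V -> W) x :
  (\near x, f x = g x) -> differentiable f x -> differentiable g x.
Proof.
move=> fg df.
have gx : g x = f x by rewrite (nbhs_singleton fg).
have E : g \o shift x = cst (g x) + 'd f x +o_ 0 id.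
  have /eqaddoP F := diff_locally df.
  apply/eqaddoP => e e0.
  have N : \forall h \near 0, f (h + x) = g (h + x).
    rewrite (near_shift x 0 (fun y => f (y + x) = g (y + x))) /=.
    by apply: filterS fg => y; rewrite sub0r /= subrK.
  apply: (@filterS _ (nbhs (0 : V)) _ _ _ _ (filterI N (F e e0))) => y /= [Hy].
  by rewrite !fctE gx /= Hy.
have dE : 'd g x = 'd f x :> (V -> W).
  by apply: diff_unique E; exact: diff_continuous.
by apply/diff_locallyP; rewrite dE; split=> //; exact: diff_continuous.
Qed.

Section Scale.
Context {V : normedModType R}.
(** Scaling is packaged as a continuous bilinear map on [R^o * V], so that the product rule is the
    differential of a bilinear map composed with a pair. *)
Definition scal (k : R^o) (w : V) : V := k *: w.
Lemma scal_is_bilinear :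
  bilinear_for
    (GRing.Scale.Law.clone _ _ *:%R _) (GRing.Scale.Law.clone _ _ *:%R _)
    scal.
Proof.
split=> [u'|u] a x y /=; rewrite /scal.
- by rewrite scalerDl scalerA.
- by rewrite scalerDr !scalerA mulrC.
Qed.
HB.instance Definition _ := bilinear_isBilinear.Build R R^o V V _ _ scal
  scal_is_bilinear.
Lemma scal_continuous : continuous (fun p : R^o * V => scal p.1 p.2).
Proof.
move=> [a w]; apply: cvgZ; [exact: cvg_fst|exact: cvg_snd].
Qed.
End Scale.

Lemma differentiable_scale V W (k : V -> R^o) (f : V -> W) x :
  differentiable k x -> differentiable f x ->
  differentiable (fun y => k y *: f y) x.
Proof.
move=> dk df.
have := differentiable_comp (differentiable_pair dk df)
  (differentiable_bilin (f := scal) _ (@scal_continuous W)).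
exact.
Qed.

Lemma derive_scale V W (k : V -> R^o) (f : V -> W) x v :
  differentiable k x -> differentiable f x ->
  'D_v (fun y => k y *: f y) x = 'D_v k x *: f x + k x *: 'D_v f x.
Proof.
move=> dk df.
rewrite !deriveE //; last exact: differentiable_scale.
have -> : (fun y => k y *: f y) =
  (fun p : R^o * W => scal p.1 p.2) \o (fun y => (k y, f y)) by [].
rewrite diff_comp //; last 2 first.
- exact: differentiable_pair.
- exact: (differentiable_bilin (f := scal) _ (@scal_continuous W)).
rewrite (diff_bilin (f := scal) _ (@scal_continuous W)) diff_pair //=.
by rewrite /scal addrC.
Qed.

Lemma derive_compE V W Z (f : V -> W) (g : W -> Z) x v :
  differentiable f x -> differentiable g (f x) ->
  'D_v (g \o f) x = 'D_('D_v f x) g (f x).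
Proof.
move=> df dg; rewrite !deriveE //; last exact: differentiable_comp.
by rewrite diff_comp.
Qed.

Lemma derive_lin V W (f : {linear V -> W}) x v :
  continuous f -> 'D_v f x = f v.
Proof.
move=> cf; rewrite deriveE; last exact: linear_differentiable.
by rewrite diff_lin.
Qed.

Lemma derive_lincomp V W Z (l : {linear W -> Z}) (f : V -> W) x v :
  continuous l -> differentiable f x ->
  'D_v (fun y => l (f y)) x = l ('D_v f x).
Proof.
move=> cl df; rewrite (derive_compE (g := l)) ?derive_lin //.
exact: linear_differentiable.
Qed.

Lemma derive_pair V W Z (f : V -> W) (g : V -> Z) x v :
  differentiable f x -> differentiable g x ->
  'D_v (fun y => (f y, g y)) x = ('D_v f x, 'D_v g x).
Proof.
move=> df dg; rewrite !deriveE //; last exact: differentiable_pair.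
by rewrite diff_pair.
Qed.

Lemma derive_dirD V W (f : V -> W) x u v : differentiable f x ->
  'D_(u + v) f x = 'D_u f x + 'D_v f x.
Proof. by move=> df; rewrite !deriveE // linearD. Qed.
Lemma derive_dirB V W (f : V -> W) x u v : differentiable f x ->
  'D_(u - v) f x = 'D_u f x - 'D_v f x.
Proof. by move=> df; rewrite !deriveE // linearB. Qed.
Lemma derive_dirN V W (f : V -> W) x v : differentiable f x ->
  'D_(- v) f x = - 'D_v f x.
Proof. by move=> df; rewrite !deriveE // linearN. Qed.
Lemma derive_dirZ V W (f : V -> W) x (a : R) v : differentiable f x ->
  'D_(a *: v) f x = a *: 'D_v f x.
Proof. by move=> df; rewrite !deriveE // linearZ. Qed.
Lemma derive_dir_sum V W (f : V -> W) x n (a : 'I_n -> R) (v : 'I_n -> V) :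
  differentiable f x ->
  'D_(\sum_i a i *: v i) f x = \sum_i a i *: 'D_(v i) f x.
Proof.
move=> df; rewrite deriveE // linear_sum; apply: eq_bigr => i _.
by rewrite linearZ deriveE.
Qed.

Lemma derive_addf V W (f g : V -> W) x v :
  differentiable f x -> differentiable g x ->
  'D_v (fun y => f y + g y) x = 'D_v f x + 'D_v g x.
Proof. by move=> df dg; rewrite -deriveD //; apply: diff_derivable. Qed.
Lemma derive_subf V W (f g : V -> W) x v :
  differentiable f x -> differentiable g x ->
  'D_v (fun y => f y - g y) x = 'D_v f x - 'D_v g x.
Proof. by move=> df dg; rewrite -deriveB //; apply: diff_derivable. Qed.
Lemma derive_sumf V W n (f : 'I_n -> V -> W) x v :
  (forall i, differentiable (f i) x) ->
  'D_v (fun y => \sum_i f i y) x = \sum_i 'D_v (f i) x.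
Proof.
move=> df; rewrite -derive_sum; last by move=> i; apply: diff_derivable.
by congr ('D_v _ _); apply/funext => y; rewrite fct_sumE.
Qed.

End Differential.

(* A finite spanning family with continuous coordinates; it need not be
   linearly independent. *)
Class findim (R : realType) (V : normedModType R) : Prop := Findim {
  findimP : exists n (e : 'I_n -> V) (l : 'I_n -> {linear V -> R^o}),
    (forall i, continuous (l i)) /\ forall v, v = \sum_i l i v *: e i }.

Section FindimInstances.
Context {R : realType}.

#[export] Instance findim_R : findim (R^o : normedModType R).
Proof.
split; exists 1, (fun _ => 1), (fun _ => idfun); split.
  by move=> i x; exact: cvg_id.
by move=> v; rewrite big_ord1 /= /GRing.scale /= mulr1.
Qed.

#[export] Instance findim_rV n : findim ('rV[R]_n : normedModType R).
Proof.
have lin (i : 'I_n) : linear (fun v : 'rV[R]_n => v 0 i : R^o).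
  by move=> a u v; rewrite !mxE.
pose l i : {linear 'rV[R]_n -> R^o} :=
  HB.pack (fun v : 'rV[R]_n => v 0 i : R^o) (GRing.isLinear.Build _ _ _ _ _ (lin i)).
split; exists n, (fun i => delta_mx 0 i), l; split.
  by move=> i; apply: coord_continuous.
by move=> v; exact: row_sum_delta.
Qed.

#[export] Instance findim_prod (V W : normedModType R) :
  findim V -> findim W -> findim (V * W : normedModType R)%type.
Proof.
move=> [[n [e [l [cl dl]]]]] [[n' [e' [l' [cl' dl']]]]].
pose lf i (p : V * W) : R^o :=
  match fintype.split (i : 'I_(n + n')) with inl j => l j p.1 | inr j => l' j p.2 end.
have lin i : linear (lf i).
  by rewrite /lf; case: fintype.split => j a u v; rewrite linearP.
pose L i : {linear (V * W)%type -> R^o} :=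
  HB.pack (lf i) (GRing.isLinear.Build _ _ _ _ _ (lin i)).
split; exists (n + n')%N, (fun i => match fintype.split i with inl j => (e j, 0) | inr j => (0, e' j) end), L.
split.
  move=> i; rewrite /L /= /lf; case: (fintype.split i) => j p.
    by apply: (@continuous_comp _ _ _ fst (l j)); [exact: cvg_fst|exact: cl].
  by apply: (@continuous_comp _ _ _ snd (l' j)); [exact: cvg_snd|exact: cl'].
move=> [v w]; rewrite big_split_ord /=.
under eq_bigr => i _ do rewrite /L /= /lf -[lshift _ _]/(unsplit (inl i)) unsplitK /=.
under [X in _ + X]eq_bigr => i _ do rewrite /L /= /lf -[rshift _ _]/(unsplit (inr i)) unsplitK /=.
rewrite {1}[v]dl {1}[w]dl'.
have F (I : finType) (a : I -> R) (f : I -> V) : \sum_i (a i *: (f i, 0 : W)) = (\sum_i a i *: f i, 0).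
  elim/big_ind2 : _ => // [x1 x2 y1 y2 -> ->|i _].
    by congr pair; rewrite /= addr0.
  by congr pair; rewrite /= scaler0.
have F' (I : finType) (a : I -> R) (f : I -> W) : \sum_i (a i *: (0 : V, f i)) = (0, \sum_i a i *: f i).
  elim/big_ind2 : _ => // [x1 x2 y1 y2 -> ->|i _].
    by congr pair; rewrite /= addr0.
  by congr pair; rewrite /= scaler0.
by rewrite F F'; congr pair; rewrite /= ?addr0 ?add0r.
Qed.

End FindimInstances.

(** * Smooth functions *)

Section CnCalculus.
Context {R : realType}.
Implicit Types V W Z : normedModType R.

(** Openness turns agreement on [U] into agreement near each of its points, which is all that
    derivatives see. The closure properties below compute a derivative on [U] and replace it through
    this lemma. *)
Lemma Cn_ext n V W (U : set V) (f g : V -> W) : open U ->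
  (forall x, U x -> f x = g x) -> Cn n U f -> Cn n U g.
Proof.
move=> oU; elim: n f g => [|n IH] f g fg /=.
  move=> cf x Ux.
  have nfg : \forall y \near x, f y = g y.
    by apply: filterS (open_nbhs_nbhs (conj oU Ux)) => y /fg.
  rewrite /prop_for /continuous_at -(fg x Ux).
  by apply: cvg_trans (cf x Ux); apply: near_eq_cvg; exact: nfg.
move=> [df cf]; split=> [x Ux|v].
  apply: differentiable_near (df x Ux).
  by apply: filterS (open_nbhs_nbhs (conj oU Ux)) => y /fg.
apply: IH (cf v) => x Ux; apply: near_eq_derive.
by apply: filterS (open_nbhs_nbhs (conj oU Ux)) => y /fg.
Qed.

Lemma Cn_sub n V W (U U' : set V) (f : V -> W) :
  U' `<=` U -> Cn n U f -> Cn n U' f.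
Proof.
move=> UU'; elim: n f => [|n IH] f /=; first by move=> H x /UU'; exact: H.
by move=> [df cf]; split=> [x /UU'|v]; [exact: df|exact: IH].
Qed.

Lemma Cn_local n V W (U : set V) (f : V -> W) :
  (forall x, U x -> exists2 U', U' x & Cn n U' f) -> Cn n U f.
Proof.
elim: n f => [|n IH] f H /=; first by move=> x /H[U' U'x]; exact.
split=> [x /H[U' U'x [df _]]|v]; first exact: df.
apply: IH => x Ux; have [U' U'x [_ c]] := H x Ux.
by exists U' => //; exact: c.
Qed.

Lemma CnS n V W (U : set V) (f : V -> W) : Cn n.+1 U f -> Cn n U f.
Proof.
elim: n f => [|n IH] f [df cf].
  by move=> x Ux; apply: differentiable_continuous; exact: df.
by split=> // v; apply: IH.
Qed.

Lemma Cn_cst n V W (U : set V) (w : W) : Cn n U (fun _ : V => w).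
Proof.
elim: n w => [|n IH] w /=; first by move=> x _; exact: cvg_cst.
split=> [x _|v]; first exact: differentiable_cst.
have -> : 'D_v (fun _ : V => w) = fun _ => 0 by apply/funext => x; exact: derive_cst.
exact: IH.
Qed.

Lemma Cn_lin n V W (U : set V) (l : {linear V -> W}) : continuous l -> Cn n U l.
Proof.
move=> cl; case: n => [|n] /=; first by move=> x _; exact: cl.
split=> [x _|v]; first exact: linear_differentiable.
have -> : 'D_v l = fun _ => l v by apply/funext => x; exact: derive_lin.
exact: Cn_cst.
Qed.

Section Open.
Variables (V : normedModType R) (U : set V).
Hypothesis oU : open U.

Lemma Cn_add n W (f g : V -> W) :
  Cn n U f -> Cn n U g -> Cn n U (fun x => f x + g x).
Proof.
elim: n f g => [|n IH] f g.
  by move=> cf cg x Ux; apply: cvgD; [exact: cf|exact: cg].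
move=> [df cf] [dg cg]; split=> [x Ux|v].
  by apply: differentiableD; [exact: df|exact: dg].
apply: Cn_ext (IH _ _ (cf v) (cg v)) => // x Ux.
by rewrite derive_addf //; [exact: df|exact: dg].
Qed.

Lemma Cn_lincomp n W Z (l : {linear W -> Z}) (f : V -> W) :
  continuous l -> Cn n U f -> Cn n U (fun x => l (f x)).
Proof.
move=> cl; elim: n f => [|n IH] f.
  by move=> cf x Ux; apply: (@continuous_comp _ _ _ f l); [exact: cf|exact: cl].
move=> [df cf]; split=> [x Ux|v].
  apply: (differentiable_comp (g := l)); first exact: df.
  exact: linear_differentiable.
apply: Cn_ext (IH _ (cf v)) => // x Ux.
by rewrite derive_lincomp //; exact: df.
Qed.

Lemma Cn_opp n W (f : V -> W) : Cn n U f -> Cn n U (fun x => - f x).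
Proof.
elim: n f => [|n IH] f; first by move=> cf x Ux; apply: cvgN; exact: cf.
move=> [df cf]; split=> [x Ux|v]; first by apply: differentiableN; exact: df.
apply: Cn_ext (IH _ (cf v)) => // x Ux.
by rewrite deriveN //; apply: diff_derivable; exact: df.
Qed.

Lemma Cn_scale n W (k : V -> R^o) (f : V -> W) :
  Cn n U k -> Cn n U f -> Cn n U (fun x => k x *: f x).
Proof.
elim: n k f => [|n IH] k f.
  by move=> ck cf x Ux; apply: cvgZ; [exact: ck|exact: cf].
move=> Hk Hf; have [dk ck] := Hk; have [df cf] := Hf; split=> [x Ux|v].
  by apply: differentiable_scale; [exact: dk|exact: df].
(* Each summand of the product rule keeps one factor undifferentiated; [CnS] lowers that factor to
   order [n]. *)
apply: Cn_ext (Cn_add (IH _ _ (ck v) (CnS Hf)) (IH _ _ (CnS Hk) (cf v))) => //.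
by move=> x Ux; rewrite derive_scale //; [exact: dk|exact: df].
Qed.

Lemma Cn_pair n W Z (f : V -> W) (g : V -> Z) :
  Cn n U f -> Cn n U g -> Cn n U (fun x => (f x, g x)).
Proof.
elim: n f g => [|n IH] f g.
  by move=> cf cg x Ux; apply: cvg_pair; [exact: cf|exact: cg].
move=> [df cf] [dg cg]; split=> [x Ux|v].
  by apply: differentiable_pair; [exact: df|exact: dg].
apply: Cn_ext (IH _ _ (cf v) (cg v)) => // x Ux.
by rewrite derive_pair //; [exact: df|exact: dg].
Qed.

Lemma Cn_sum n W (N : nat) (f : 'I_N -> V -> W) :
  (forall i, Cn n U (f i)) -> Cn n U (fun x => \sum_i f i x).
Proof.
move=> Hf; elim: N f Hf => [|N IH] f Hf.
  by apply: Cn_ext (@Cn_cst n _ _ U 0) => // x _; rewrite big_ord0.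
apply: Cn_ext (Cn_add (IH (fun i => f (lift ord0 i)) _) (Hf ord0)) => // x _.
by rewrite big_ord_recl addrC.
Qed.

(** By the chain rule the direction in which [g] is differentiated moves with the point, while [Cn]
    speaks of fixed directions. Expanding ['D_v f x] in the spanning family of [W] leaves regular
    coefficients and the fixed directions [e i]. *)
Lemma Cn_comp n W Z {hW : findim W} (U' : set W) (f : V -> W) (g : W -> Z) :
  (forall x, U x -> U' (f x)) ->
  Cn n U f -> Cn n U' g -> Cn n U (fun x => g (f x)).
Proof.
move=> fU; have [[N [e [l [cl dl]]]]] := hW.
elim: n Z f g fU => [|n IH] Z f g fU.
  move=> cf cg x Ux; apply: (@continuous_comp _ _ _ f g); first exact: cf.
  by apply: cg; exact: fU.
move=> Hf [dg cg]; have [df cf] := Hf; split=> [x Ux|v].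
  by apply: (differentiable_comp (g := g)); [exact: df|apply: dg; exact: fU].
apply: (@Cn_ext _ _ _ _ (fun x => \sum_i l i ('D_v f x) *: 'D_(e i) g (f x))) => //.
  move=> x Ux; rewrite (derive_compE (g := g)); first last.
  - by apply: dg; exact: fU.
  - exact: df.
  rewrite -derive_dir_sum; last by apply: dg; exact: fU.
  by rewrite -dl.
apply: Cn_sum => i; apply: Cn_scale; first exact: Cn_lincomp (cf v).
exact: IH fU (CnS Hf) (cg (e i)).
Qed.

End Open.

Lemma smooth_ext V W (U : set V) (f g : V -> W) : open U ->
  (forall x, U x -> f x = g x) -> smooth_on U f -> smooth_on U g.
Proof. by move=> oU fg Hf n; exact: Cn_ext (Hf n). Qed.

Lemma smooth_sub V W (U U' : set V) (f : V -> W) :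
  U' `<=` U -> smooth_on U f -> smooth_on U' f.
Proof. by move=> UU' Hf n; exact: Cn_sub (Hf n). Qed.

Lemma smooth_local V W (U : set V) (f : V -> W) :
  (forall x, U x -> exists2 U', U' x & smooth_on U' f) -> smooth_on U f.
Proof. by move=> H n; apply: Cn_local => x /H[U' U'x Hf]; exists U'. Qed.

Lemma smooth_diff V W (U : set V) (f : V -> W) x :
  smooth_on U f -> U x -> differentiable f x.
Proof. by move=> /(_ 1%N) [df _]; exact: df. Qed.

Lemma smooth_D V W (U : set V) (f : V -> W) v :
  smooth_on U f -> smooth_on U ('D_v f).
Proof. by move=> Hf n; have [_] := Hf n.+1; exact. Qed.

Lemma smooth_cst V W (U : set V) (w : W) : smooth_on U (fun _ : V => w).
Proof. by move=> n; exact: Cn_cst. Qed.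

Lemma smooth_lin V W (U : set V) (l : {linear V -> W}) :
  continuous l -> smooth_on U l.
Proof. by move=> cl n; exact: Cn_lin. Qed.

Section SmoothOpen.
Variables (V : normedModType R) (U : set V).
Hypothesis oU : open U.

Lemma smooth_add W (f g : V -> W) :
  smooth_on U f -> smooth_on U g -> smooth_on U (fun x => f x + g x).
Proof. by move=> Hf Hg n; exact: Cn_add. Qed.

Lemma smooth_opp W (f : V -> W) : smooth_on U f -> smooth_on U (fun x => - f x).
Proof. by move=> Hf n; exact: Cn_opp. Qed.

Lemma smooth_subf W (f g : V -> W) :
  smooth_on U f -> smooth_on U g -> smooth_on U (fun x => f x - g x).
Proof. by move=> Hf Hg; apply: smooth_add => //; exact: smooth_opp. Qed.

Lemma smooth_scale W (k : V -> R^o) (f : V -> W) :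
  smooth_on U k -> smooth_on U f -> smooth_on U (fun x => k x *: f x).
Proof. by move=> Hf Hg n; exact: Cn_scale. Qed.

Lemma smooth_pair W Z (f : V -> W) (g : V -> Z) :
  smooth_on U f -> smooth_on U g -> smooth_on U (fun x => (f x, g x)).
Proof. by move=> Hf Hg n; exact: Cn_pair. Qed.

Lemma smooth_sum W (N : nat) (f : 'I_N -> V -> W) :
  (forall i, smooth_on U (f i)) -> smooth_on U (fun x => \sum_i f i x).
Proof. by move=> Hf n; apply: Cn_sum => // i; exact: Hf. Qed.

Lemma smooth_lincomp W Z (l : {linear W -> Z}) (f : V -> W) :
  continuous l -> smooth_on U f -> smooth_on U (fun x => l (f x)).
Proof. by move=> cl Hf n; exact: Cn_lincomp. Qed.

Lemma smooth_comp W Z {hW : findim W} (U' : set W) (f : V -> W) (g : W -> Z) :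
  (forall x, U x -> U' (f x)) ->
  smooth_on U f -> smooth_on U' g -> smooth_on U (fun x => g (f x)).
Proof. by move=> fU Hf Hg n; exact: Cn_comp fU (Hf n) (Hg n). Qed.

Lemma smooth_dir W Z {hW : findim W} (U' : set W)
    (w f : V -> W) (g : W -> Z) :
  (forall x, U x -> U' (f x)) ->
  smooth_on U w -> smooth_on U f -> smooth_on U' g ->
  smooth_on U (fun x => 'D_(w x) g (f x)).
Proof.
move=> fU Hw Hf Hg; have [[N [e [l [cl dl]]]]] := hW.
apply: (@smooth_ext _ _ _ (fun x => \sum_i l i (w x) *: 'D_(e i) g (f x))) => //.
  move=> x Ux; rewrite -derive_dir_sum -?dl //.
  by apply: smooth_diff Hg _; exact: fU.
apply: smooth_sum => i; apply: smooth_scale; first exact: smooth_lincomp.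
exact: (smooth_comp fU Hf (smooth_D _ Hg)).
Qed.

End SmoothOpen.

(* The second difference of [f] over [h v], [h w] is [h^2] times the mixed
   derivative, up to [o(h^2)]: apply the mean value theorem to
   [s |-> f (x + s v + h w) - f (x + s v)]. *)
Lemma second_difference V (U : set V) (f : V -> R^o) x v w (e : R) : open U ->
  U x -> (forall y, U y -> differentiable f y) -> differentiable ('D_v f) x ->
  0 < e ->
  \forall h \near (0 : R)^'+,
    `|f (x + h *: v + h *: w) - f (x + h *: v) - (f (x + h *: w) - f x)
       - h ^+ 2 * 'D_w ('D_v f) x| <= h ^+ 2 * e.
Proof.
move=> oU Ux df d2 e0.
have /eqaddoP F := diff_locally d2.
(* [h * K] bounds the displacements [s v + a w] with [s, a] in [[0, h]]; the summand 1 keeps [K]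
   positive. *)
set K := 2 * `|v| + `|w| + 1.
have K0 : 0 < K by rewrite /K; have := normr_ge0 v; have := normr_ge0 w; lra.
(* An error of [e / K / 2] per unit length costs [h e / 2] at each of the two points compared by the
   mean value theorem, hence [h e] in all. *)
have /F : 0 < e / K / 2 by rewrite !divr_gt0.
move=> /nbhs_ballP[d1 /= d10 H1].
have /nbhs_ballP[d2' /= d20 H2] := open_nbhs_nbhs (conj oU Ux).
pose d := Num.min d1 d2'.
have dgt0 : 0 < d by rewrite /d lt_min d10.
near=> h.
have h0 : 0 < h by near: h; exact: nbhs_right_gt.
have hd : h * K < d.
  rewrite -ltr_pdivlMr //; near: h; apply: nbhs_right_lt.
  by rewrite divr_gt0.
have small s a : 0 <= s <= h -> 0 <= a <= h -> `|s *: v + a *: w| <= h * K.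
  move=> /andP[s0 sh] /andP[a0 ah].
  rewrite (le_trans (ler_normD _ _)) // !normrZ !ger0_norm //.
  rewrite /K mulrDr mulrDr mulr1 mulrCA.
  have := ler_wpM2r (normr_ge0 v) sh; have := ler_wpM2r (normr_ge0 w) ah.
  have := mulr_ge0 (ltW h0) (normr_ge0 v); lra.
have inU s a : 0 <= s <= h -> 0 <= a <= h -> U (x + (s *: v + a *: w)).
  move=> Hs Ha; apply: H2; rewrite -ball_normE /ball_ /= opprD addrA subrr.
  rewrite sub0r normrN (le_lt_trans (small _ _ Hs Ha)) //.
  by apply: lt_le_trans hd _; rewrite /d ge_min lexx orbT.
(* The summand [0 *: w] gives both terms the shape of [app], which is used at [a = h] and at
   [a = 0]. *)
pose phi (s : R) : R := f (x + (s *: v + h *: w)) - f (x + (s *: v + 0 *: w)).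
have hh : 0 <= h <= h by rewrite (ltW h0) lexx.
have h00 : 0 <= (0 : R) <= h by rewrite lexx (ltW h0).
have dl s a : 0 <= s <= h -> 0 <= a <= h ->
    is_derive s 1 (fun s => f (x + (s *: v + a *: w)) : R^o) ('D_v f (x + (s *: v + a *: w))).
  move=> Hs Ha.
  have dg : differentiable (fun s : R^o => x + (s *: v + a *: w)) s.
    apply: differentiableD; first exact: differentiable_cst.
    apply: differentiableD; last exact: differentiable_cst.
    exact: differentiableZl.
  have dfx := df _ (inU _ _ Hs Ha).
  have dfg := differentiable_comp (f := fun s : R^o => x + (s *: v + a *: w)) (g := f) dg dfx.
  apply: DeriveDef; first exact: diff_derivable dfg.
  rewrite (derive_compE (f := fun s : R^o => x + (s *: v + a *: w)) (g := f) 1 dg dfx).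
  congr ('D_ _ _ _).
  rewrite derive_addf; [|exact: differentiable_cst|]; last first.
    apply: differentiableD; last exact: differentiable_cst.
    exact: differentiableZl.
  rewrite derive_addf; [|exact: differentiableZl|exact: differentiable_cst].
  rewrite !derive_cst add0r addr0.
  by rewrite deriveE // diff_val scale1r.
have [c ch Ec] : exists2 c, c \in `]0, h[%R & phi h - phi 0 =
    ('D_v f (x + (c *: v + h *: w)) - 'D_v f (x + (c *: v + 0 *: w))) * (h - 0).
  apply: (MVT h0 (df := fun c => 'D_v f (x + (c *: v + h *: w)) - 'D_v f (x + (c *: v + 0 *: w)))).
    move=> s; rewrite in_itv /= => /andP[s0 sh].
    have Hs : 0 <= s <= h by rewrite !ltW.
    by apply: is_deriveB; apply: dl.
  apply: derivable_within_continuous => s; rewrite in_itv /= => Hs.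
  by apply: derivableB; apply: (@ex_derive _ _ _ _ _ _ _ (dl _ _ _ _)).
have Hc : 0 <= c <= h by move: ch; rewrite in_itv /= => /andP[? ?]; rewrite !ltW.
have app a : 0 <= a <= h -> `|'D_v f (x + (c *: v + a *: w)) - 'D_v f x - (c * 'D_v ('D_v f) x + a * 'D_w ('D_v f) x)| <= h * e / 2.
  move=> Ha.
  have := H1 (c *: v + a *: w).
  rewrite -ball_normE /ball_ /= sub0r normrN => H.
  have {}H := H (le_lt_trans (small _ _ Hc Ha) (lt_le_trans hd _)).
  have dd1 : d <= d1 by rewrite /d ge_min lexx.
  have {}H := H dd1.
  have -> : c * 'D_v ('D_v f) x + a * 'D_w ('D_v f) x =
      'd ('D_v f) x (c *: v + a *: w) by rewrite !deriveE // linearD !linearZ.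
  rewrite [x + _]addrC -[X in `|X|]addrA -opprD; apply: (le_trans H).
  apply: (le_trans (ler_wpM2l _ (small _ _ Hc Ha))); first by rewrite !divr_ge0 // ltW.
  by rewrite le_eqVlt; apply/orP; left; apply/eqP; field; rewrite gt_eqF.
have := app h hh; have := app 0 h00.
have Ephi : f (x + h *: v + h *: w) - f (x + h *: v) - (f (x + h *: w) - f x) = phi h - phi 0.
  by rewrite /phi !scale0r !addr0 !add0r !addrA.
rewrite Ephi Ec subr0.
move: (c *: v + h *: w) (c *: v + 0 *: w) => y z.
move: ('D_v f (x + y)) ('D_v f (x + z)) ('D_v f x) => B A p.
move: ('D_w ('D_v f) x) ('D_v ('D_v f) x) => q r.
rewrite mul0r addr0 => Hb Ha.
have -> : (B - A) * h - h ^+ 2 * q = h * ((B - p - (c * r + h * q)) - (A - p - c * r)) by ring.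
rewrite normrM gtr0_norm // expr2 -mulrA ler_pM2l //.
apply: (le_trans (ler_normB _ _)); lra.
Unshelve. all: by end_near. Qed.

(** The second difference is symmetric in [v] and [w]. One small [h] that serves both orders bounds
    the gap of the mixed derivatives by [e], and [e] is arbitrary. *)
Lemma Schwarz_scalar V (U : set V) (f : V -> R^o) x v w : open U -> U x ->
  smooth_on U f -> 'D_w ('D_v f) x = 'D_v ('D_w f) x.
Proof.
move=> oU Ux sf.
have df y : U y -> differentiable f y by exact: smooth_diff.
have d2 u : differentiable ('D_u f) x by apply: smooth_diff Ux; exact: smooth_D.
apply/eqP; rewrite -subr_eq0 -normr_le0; apply/ler_addgt0Pr => e e0.
rewrite add0r.
have e2 : 0 < e / 2 by rewrite divr_gt0.
have P1 := second_difference w oU Ux df (d2 v) e2.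
have P2 := second_difference v oU Ux df (d2 w) e2.
have [h [[H1 H2] h0]] := filter_ex (filterI (filterI P1 P2) (nbhs_right_gt (0 : R))).
move: H1 H2; rewrite [x + h *: w + h *: v]addrAC.
move: (f (x + h *: v + h *: w)) (f (x + h *: v)) (f (x + h *: w)) (f x) => A B C D.
move: ('D_w ('D_v f) x) ('D_v ('D_w f) x) => a b H1 H2.
have h2 : 0 < h ^+ 2 by rewrite exprn_gt0.
rewrite -(ler_pM2l h2) -[X in X * `|_|]gtr0_norm // -normrM.
have -> : h ^+ 2 * (a - b) =
  (A - C - (B - D) - h ^+ 2 * b) - (A - B - (C - D) - h ^+ 2 * a) by ring.
by apply: (le_trans (ler_normB _ _)); lra.
Qed.

Lemma Schwarz V W {hW : findim W} (U : set V) (f : V -> W) x v w :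
  open U -> U x -> smooth_on U f -> 'D_w ('D_v f) x = 'D_v ('D_w f) x.
Proof.
move=> oU Ux sf; have [[N [e [l [cl dl]]]]] := hW.
have d2 u : differentiable ('D_u f) x by apply: smooth_diff Ux; exact: smooth_D.
have E i u u' : l i ('D_u ('D_u' f) x) = 'D_u ('D_u' (fun y => l i (f y))) x.
  rewrite -(derive_lincomp _ (cl i) (d2 u')).
  apply: near_eq_derive; apply: filterS (open_nbhs_nbhs (conj oU Ux)) => y Uy.
  by rewrite (derive_lincomp _ (cl i) (smooth_diff sf Uy)).
rewrite (dl ('D_w _ x)) (dl ('D_v _ x)).
apply: eq_bigr => i _; rewrite !E; apply: (f_equal (fun a : R => a *: e i)).
by apply: (Schwarz_scalar _ _ oU Ux); exact: smooth_lincomp.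
Qed.

(** Along a spanning family the function is a finite sum of products, to which the product rule
    applies. The formula is used for coordinate changes of vector fields, for derivatives of the
    coframe and for curvature. *)
Lemma derive_dir V W Z {hW : findim W} (U : set W) (b Y : V -> W) (f : W -> Z) x v :
  open U -> U (b x) -> smooth_on U f ->
  differentiable b x -> differentiable Y x ->
  'D_v (fun w => 'D_(Y w) f (b w)) x =
    'D_('D_v b x) ('D_(Y x) f) (b x) + 'D_('D_v Y x) f (b x).
Proof.
move=> oU Ux sf db dY; have [[N [e [l [cl dl]]]]] := hW.
have df y : U y -> differentiable f y by exact: smooth_diff.
have d2 u : differentiable ('D_u f) (b x) by apply: smooth_diff Ux; exact: smooth_D.
have Ub : \forall w \near x, U (b w).
  by apply: (differentiable_continuous db); exact: open_nbhs_nbhs (conj oU Ux).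
have E : 'D_v (fun w => 'D_(Y w) f (b w)) x =
    'D_v (fun w => \sum_i l i (Y w) *: 'D_(e i) f (b w)) x.
  apply: near_eq_derive; apply: filterS Ub => y Uy.
  by rewrite -derive_dir_sum -?dl //; exact: df.
have dlY i : differentiable (fun w => l i (Y w)) x.
  by apply: (differentiable_comp (g := l i)) => //; exact: linear_differentiable.
have dfb i : differentiable (fun w => 'D_(e i) f (b w)) x.
  exact: (differentiable_comp (g := 'D_(e i) f)).
rewrite E derive_sumf; last by move=> i; exact: differentiable_scale.
under eq_bigr => i _ do rewrite derive_scale // derive_lincomp //
  (derive_compE (g := 'D_(e i) f)) //.
rewrite big_split /= addrC; congr (_ + _); last first.
  by rewrite -derive_dir_sum -?dl //; exact: df.
have -> : 'D_('D_v b x) ('D_(Y x) f) (b x) =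
    'D_('D_v b x) (fun y => \sum_i l i (Y x) *: 'D_(e i) f y) (b x).
  apply: near_eq_derive; apply: filterS (open_nbhs_nbhs (conj oU Ux)) => y Uy.
  by rewrite -derive_dir_sum -?dl //; exact: df.
rewrite derive_sumf; last first.
  by move=> i; apply: differentiable_scale => //; exact: differentiable_cst.
apply: eq_bigr => i _.
have dc : differentiable (fun=> l i (Y x) : R^o) (b x) by exact: differentiable_cst.
rewrite [RHS](derive_scale _ dc (d2 (e i))).
by rewrite derive_cst scale0r add0r.
Qed.
End CnCalculus.

(** * Bump functions *)

Section FlatFunctions.
Context {R : realType}.
Implicit Types p : {poly R}.

(** The functions p(1/x) exp(-1/x), extended by 0, are closed under differentiation: the derivative
    belongs to the polynomial X^2 (p - p'). One induction over all polynomials then gives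
    smoothness. *)
Definition flat p (x : R) : R :=
  if 0 < x then p.[x^-1] * expR (- x^-1) else 0.

(** exp(1/x) is at least x^-(i+2) / (i+2)!, which bounds the degree i term by a multiple of x^2. The
    quadratic bound makes the derivative at 0 vanish. *)
Lemma flat_bound p : exists C, forall x, `|flat p x| <= C * x ^+ 2.
Proof.
exists (\sum_(i < size p) `|p`_i| * (i.+2)`!%:R) => x.
rewrite /flat; case: ifPn => [x0|_]; last first.
  by rewrite normr0 mulr_ge0 ?sqr_ge0 // sumr_ge0 // => i _; exact: mulr_ge0.
rewrite normrM (gtr0_norm (expR_gt0 _)) horner_coef.
apply: (le_trans (ler_wpM2r (expR_ge0 _) (ler_norm_sum _ _ _))).
rewrite !mulr_suml; apply: ler_sum => i _.
have y0 : 0 < x^-1 by rewrite invr_gt0.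
rewrite normrM (gtr0_norm (exprn_gt0 _ y0)) -!mulrA; apply: ler_wpM2l => //.
have := expR_ge1Dxn i.+1 (ltW y0).
set f := (_`!)%:R; have f0 : 0 < f by rewrite ltr0n fact_gt0.
rewrite expRN ler_pdivrMr ?expR_gt0 // => H.
have : x^-1 ^+ i.+2 / f <= expR x^-1 by apply: le_trans H; rewrite lerDr.
rewrite ler_pdivrMr // => {}H.
have -> : x^-1 ^+ i = x^-1 ^+ i.+2 * x ^+ 2.
  by rewrite -addn2 exprD -mulrA -exprMn mulVf ?gt_eqF // expr1n mulr1.
rewrite [leRHS](_ : _ = expR x^-1 * f * x ^+ 2); last by ring.
by apply: ler_wpM2r => //; exact: sqr_ge0.
Qed.

Lemma is_derive_flat p (x : R) :
  is_derive x 1 (flat p) (flat ('X^2 * (p - p^`())) x).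
Proof.
have [x0|x0|->] := ltgtP x 0.
- have -> : flat ('X^2 * (p - p^`())) x = 0 by rewrite /flat ltNge ltW.
  have N : \forall y \near x, cst 0 y = flat p y.
    near=> y; rewrite /flat ltNge ltW //; near: y; exact: lt_nbhsl.
  exact: near_eq_is_derive N (is_derive_cst _ _ _).
- have -> : flat ('X^2 * (p - p^`())) x =
      p.[x^-1] * (expR (- x^-1) * x ^- 2) + expR (- x^-1) * (p^`().[x^-1] * - x ^- 2).
    rewrite /flat x0 hornerM hornerXn hornerD hornerN -exprVn; set a := p.[_]; set b := _.[x^-1]; set c := expR _; set d := x^-1; ring.
  have N : \forall y \near x, p.[y^-1] * expR (- y^-1) = flat p y.
    near=> y; rewrite /flat ifT //; near: y; exact: lt_nbhsr.
  apply: near_eq_is_derive N _.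
  have dV : is_derive x 1 (fun y : R => y^-1) (- x ^- 2).
    apply: DeriveDef; first exact: (@derivableV _ _ id x 1 (lt0r_neq0 x0)).
    by rewrite (@deriveV _ _ id x 1 (lt0r_neq0 x0)) // derive_id /GRing.scale /= mulr1.
  have dNV : is_derive x 1 (fun y : R => - y^-1) (x ^- 2).
    by apply: is_derive_eq; rewrite opprK.
  have H1 : is_derive x 1 (horner p \o (fun y : R => y^-1)) (p^`().[x^-1] * - x ^- 2).
    by apply: is_derive1_comp.
  have H2 : is_derive x 1 (expR \o (fun y : R => - y^-1)) (expR (- x^-1) * x ^- 2).
    by apply: is_derive1_comp.
  exact: (is_deriveM H1 H2).
- have f0 q : flat q 0 = 0 by rewrite /flat ltxx.
  rewrite f0; have [C HC] := flat_bound p.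
  suff L : (fun h : R => h^-1 *: (flat p (h *: 1 + 0) - flat p 0)) @ 0^' --> (0 : R).
    by apply: DeriveDef; [exact: cvgP L|exact: cvg_lim L].
  apply/cvgrPdist_le => e e0; rewrite f0.
  have K0 : 0 < `|C| + 1 by rewrite ltr_pwDr.
  near=> h; rewrite sub0r normrN subr0 addr0 /GRing.scale /= mulr1.
  have h0 : h != 0 by near: h; exact: nbhs_dnbhs_neq.
  rewrite normrM normfV ler_pdivrMl ?normr_gt0 //.
  apply: (le_trans (HC _)); rewrite -real_normK ?num_real // expr2 mulrCA.
  apply: ler_wpM2l => //.
  apply: (le_trans (ler_wpM2r _ (_ : C <= `|C| + 1))) => //.
    by have := ler_norm C; lra.
  rewrite mulrC -ler_pdivlMr //; near: h; apply: dnbhs0_le; exact: divr_gt0.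
Unshelve. all: by end_near. Qed.

Lemma differentiable_flat p x : differentiable (flat p : R^o -> R^o) x.
Proof. by apply/derivable1_diffP; case: (is_derive_flat p x). Qed.

Lemma smooth_flat p : smooth_on setT (flat p : R^o -> R^o).
Proof.
move=> n; elim: n p => [|n IH] p.
  by move=> x _; apply: differentiable_continuous; exact: differentiable_flat.
split=> [x _|v]; first exact: differentiable_flat.
have dE : forall x : R^o, v * flat ('X^2 * (p - p^`())) x = 'D_v (flat p : R^o -> R^o) x.
  move=> x; have [_ <-] := is_derive_flat p x.
  have := derive_dirZ v (1 : R^o) (differentiable_flat p x).
  by rewrite [_ *: (1 : R^o)]mulr1 => ->.
apply: Cn_ext (fun x _ => dE x) _; first exact: openT.
by apply: (Cn_scale openT (Cn_cst _ _ _) (IH _)).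
Qed.

Lemma flat1_gt0 x : 0 < x -> 0 < flat 1 x.
Proof. by move=> x0; rewrite /flat x0 hornerC mul1r expR_gt0. Qed.

Lemma flat1_le0 x : x <= 0 -> flat 1 x = 0.
Proof. by rewrite /flat ltNge => ->. Qed.

(** The inner [flat 1] vanishes for [x <= 0] and is at least [flat 1 1] for [x >= 1], so the outer
    argument is constant on the left and nonpositive on the right; the denominator normalizes the
    left plateau to 1. *)
Definition step (x : R) : R := flat 1 (flat 1 1 - flat 1 x) / flat 1 (flat 1 1).

Lemma step_le0 x : x <= 0 -> step x = 1.
Proof.
move=> x0; rewrite /step (flat1_le0 x0) subr0 divff // gt_eqF //.
by apply: flat1_gt0; exact: flat1_gt0.
Qed.

Lemma step_ge1 x : 1 <= x -> step x = 0.
Proof.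
move=> x1; rewrite /step flat1_le0 ?mul0r // subr_le0.
have x0 : 0 < x by exact: lt_le_trans x1.
rewrite /flat ltr01 x0 !hornerC !mul1r ler_expR lerN2 invr1.
by rewrite invf_le1.
Qed.

Lemma smooth_step : smooth_on setT (step : R^o -> R^o).
Proof.
apply: (@smooth_ext _ _ _ _ (fun x : R^o => (flat 1 (flat 1 1))^-1 *: (flat 1 (flat 1 1 - flat 1 x) : R^o))).
- exact: openT.
- by move=> x _; rewrite /step mulrC.
apply: smooth_scale; [exact: openT|exact: smooth_cst|].
apply: (@smooth_comp _ _ _ openT _ _ _ setT (fun x : R^o => flat 1 1 - flat 1 x : R^o) (flat 1)) => //.
  by apply: (smooth_subf openT); [exact: smooth_cst|exact: smooth_flat].
exact: smooth_flat.
Qed.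

End FlatFunctions.

(** A norm need not be smooth, so the distance from [z] is measured by a quadratic function [q] of
    the coordinates. The argument of [step] is at most 0 where [q <= r / 2] and at least 1 where
    [q >= r]; [K] is the sublevel set [q <= r]. *)
Lemma bump_function (R : realType) (V : normedModType R) {hV : findim V} (U : set V)
    (z : V) : nbhs z U ->
  exists (f : V -> R^o) (K : set V), [/\ smooth_on setT f,
    (\forall y \near z, f y = 1), closed K, K `<=` U & forall y, ~ K y -> f y = 0].
Proof.
move=> /nbhs_ballP[d /= d0 HU]; have [[n [e [l [cl dl]]]]] := hV.
pose S := \sum_i `|e i| + 1.
have S0 : 0 < S by rewrite ltr_pwDr // sumr_ge0.
(* If [q y <= r], each coordinate of [y - z] is at most [d / S / 2] in absolute value, so the norm
   of [y - z] is at most [d / 2]. *)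
pose r := (d / S / 2) ^+ 2.
have del0 : 0 < d / S / 2 by rewrite !divr_gt0.
have r0 : 0 < r by rewrite exprn_gt0.
pose q (y : V) : R^o := \sum_i l i (y - z) *: l i (y - z).
have sq : smooth_on setT q.
  have sl i : smooth_on setT (fun y => l i (y - z)).
    apply: (smooth_lincomp openT (cl i)); apply: (smooth_subf openT).
      by apply: (@smooth_lin _ _ _ _ idfun) => x; exact: cvg_id.
    exact: smooth_cst.
  by apply: (smooth_sum openT) => i; apply: smooth_scale => //; exact: openT.
have cq : continuous q.
  by move=> y; apply: differentiable_continuous; exact: smooth_diff sq _.
have sa : smooth_on setT (fun y => (2 / r) *: q y - 1).
  apply: (smooth_subf openT); last exact: smooth_cst.
  by apply: (smooth_scale openT) => //; exact: smooth_cst.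
exists (fun y => step ((2 / r) *: q y - 1)), (q @^-1` [set x : R^o | x <= r]); split.
- exact: (smooth_comp (U' := setT) openT (fun _ _ => I) sa smooth_step).
- have qz : q z = 0.
    by rewrite /q big1 // => i _; rewrite subrr linear0 scale0r.
  have : \forall y \near z, q y < r / 2.
    have N : \forall a \near q z, a < r / 2.
      by rewrite qz; apply: lt_nbhsl; exact: divr_gt0.
    exact: (cq z _ N).
  apply: filterS => y qy; apply: step_le0; rewrite subr_le0.
  rewrite /GRing.scale /= mulrAC ler_pdivrMr // mul1r mulrC.
  by rewrite -ler_pdivlMr // ltW.
- by apply: closed_comp; [move=> x _; exact: cq|exact: closed_le].
- move=> y /= qy; apply: HU; rewrite -ball_normE /ball_ /= distrC.
  have ll i : `|l i (y - z)| <= d / S / 2.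
    rewrite -(ler_pXn2r (n := 2)) // ?nnegrE ?(ltW del0) //.
    apply: le_trans qy; rewrite real_normK ?num_real // /q (bigD1 i) //= expr2.
    by rewrite lerDl sumr_ge0 // => j _; rewrite /GRing.scale /= -expr2 sqr_ge0.
  rewrite [y - z]dl; apply: (le_lt_trans (ler_norm_sum _ _ _)).
  apply: (@le_lt_trans _ _ (d / S / 2 * S)).
    rewrite /S mulrDr mulr1 mulr_sumr -[X in X <= _]addr0 lerD ?(ltW del0) //.
    by apply: ler_sum => i _; rewrite normrZ ler_wpM2r.
  by rewrite mulrAC divfK ?gt_eqF // ltr_pdivrMr // ltr_pMr // ltr1n.
- move=> y /= /negP; rewrite -ltNge => qy; apply: step_ge1.
  rewrite lerBrDr /GRing.scale /= mulrAC ler_pdivlMr //; lra.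
Qed.

(** The chart axioms alone; the global topology enters through [has_bumps]. Both properties pass
    from the two factors to [Etilde]. *)
Record premanifold (R : realType) (V : normedModType R) (M : charted V) : Prop :=
  Premanifold {
  pm_inj : forall (c : chart M) p q,
    dom c p -> dom c q -> coord c p = coord c q -> p = q;
  pm_open : forall c c' : chart M, open (coord c @` (dom c' `&` dom c));
  pm_trans : forall c c' : chart M,
    smooth_on (coord c @` (dom c' `&` dom c)) (trans c c') }.

(* [f] is 1 near [p], and its support is contained in [dom c] and closed in
   [M], so that multiplication by [f] globalizes objects defined in [c]. *)
Record bump_at (R : realType) (V : normedModType R) (M : charted V)
    (c : chart M) (p : pt M) (f : pt M -> R^o) (A : set (pt M)) : Prop := BumpAt {
  bump_smooth : smooth_fun f;
  bump_open : chart_open c A;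
  bump_in : A p;
  bump_one : forall q, A q -> f q = 1;
  bump_supp : forall c' q, dom c' q ->
    dom c q \/ \forall z \near coord c' q, lrep c' f z = 0 }.

Definition has_bumps (R : realType) (V : normedModType R) (M : charted V) : Prop :=
  forall (c : chart M) p, dom c p -> exists f A, bump_at c p f A.

(** * Charts and vector fields *)

Section Premanifold.
Context {R : realType} {V : normedModType R} {hV : findim V} {M : charted V}.
Hypothesis hM : premanifold M.
Implicit Types (c : chart M) (p q : pt M) (X Y Z : field M).

Definition overlap c c' : set V := coord c @` (dom c' `&` dom c).

Lemma open_overlap c c' : open (overlap c c').
Proof. exact: pm_open. Qed.

Lemma overlap_id c : overlap c c = cod c.
Proof. by rewrite /overlap setIid. Qed.

Lemma open_cod c : open (cod c).
Proof. by rewrite -overlap_id; exact: open_overlap. Qed.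

Lemma cod_dom c p : dom c p -> cod c (coord c p).
Proof. by move=> h; exists p. Qed.

Lemma near_cod c z : cod c z -> \forall y \near z, cod c y.
Proof. by move=> h; apply: open_nbhs_nbhs; split=> //; exact: open_cod. Qed.

Lemma near_overlap c c' z : overlap c c' z -> \forall y \near z, overlap c c' y.
Proof. by move=> h; apply: open_nbhs_nbhs; split=> //; exact: open_overlap. Qed.

Lemma lrepE (W : normedModType R) c (f : pt M -> W) p :
  dom c p -> lrep c f (coord c p) = f p.
Proof.
move=> cp; rewrite /lrep; case: xgetP => [y -> [q [cq e <-]]|].
  by rewrite (pm_inj hM cq cp e).
by move=> /(_ (f p)); case; exists p.
Qed.

Lemma lrep_out (W : normedModType R) c (f : pt M -> W) z :
  ~ cod c z -> lrep c f z = 0.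
Proof.
move=> cz; rewrite /lrep; case: xgetP => // y _ [q [cq e _]].
by case: cz; exists q.
Qed.

Lemma transE c c' p : dom c p -> trans c c' (coord c p) = coord c' p.
Proof. exact: lrepE. Qed.

Lemma trans_diff c c' p : dom c p -> dom c' p ->
  differentiable (trans c c') (coord c p).
Proof.
by move=> h h'; apply: (smooth_diff (pm_trans hM c c')); exists p.
Qed.

Lemma trans_id c z : cod c z -> trans c c z = z.
Proof. by move=> [p h <-]; exact: transE. Qed.

Lemma D_trans_id c z v : cod c z -> 'D_v (trans c c) z = v.
Proof.
move=> cz; rewrite -[RHS](derive_id z v); apply: near_eq_derive.
by apply: filterS (near_cod cz) => y; exact: trans_id.
Qed.

Lemma D_trans_comp c c' c'' p v : dom c p -> dom c' p -> dom c'' p ->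
  'D_('D_v (trans c c') (coord c p)) (trans c' c'') (coord c' p) =
  'D_v (trans c c'') (coord c p).
Proof.
move=> h h' h''.
have dt : differentiable (trans c' c'') (trans c c' (coord c p)).
  by rewrite transE //; exact: trans_diff.
rewrite -(transE c' h) -derive_compE //; last exact: trans_diff.
apply: near_eq_derive.
have : overlap c c' (coord c p) by exists p.
move=> /near_overlap; apply: filterS => y [q [q1 q2] <-] /=.
by rewrite !transE.
Qed.

Lemma vf_smooth c X : vector_field X -> smooth_on (cod c) (X c).
Proof. by case. Qed.

Lemma vf_diff c X z : vector_field X -> cod c z -> differentiable (X c) z.
Proof. by move=> [sX _]; exact: smooth_diff. Qed.

Lemma vf_trans c c' X z : vector_field X -> overlap c c' z ->
  X c' (trans c c' z) = 'D_(X c z) (trans c c') z.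
Proof. by move=> [_ h] [p [p1 p2] <-]; rewrite transE //; exact: h. Qed.

Lemma vf_add X Y : vector_field X -> vector_field Y -> vector_field (addf X Y).
Proof.
move=> [sX tX] [sY tY]; split=> [c|c c' p h h'].
  by apply: smooth_add; [exact: open_cod| |].
by rewrite /addf (tX c c') // (tY c c') // derive_dirD //; exact: trans_diff.
Qed.

Lemma vf_sub X Y : vector_field X -> vector_field Y -> vector_field (subf X Y).
Proof.
move=> [sX tX] [sY tY]; split=> [c|c c' p h h'].
  by apply: smooth_subf; [exact: open_cod| |].
by rewrite /subf (tX c c') // (tY c c') // derive_dirB //; exact: trans_diff.
Qed.

Lemma vf_zero : vector_field (zerof M).
Proof.
split=> [c|c c' p h h']; first exact: smooth_cst.
by rewrite derive0.
Qed.

Lemma vf_scale f X : smooth_fun f -> vector_field X -> vector_field (scalef f X).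
Proof.
move=> sf [sX tX]; split=> [c|c c' p h h'].
  by apply: smooth_scale; [exact: open_cod|exact: sf|exact: sX].
rewrite /scalef (tX c c') // !lrepE // derive_dirZ //; exact: trans_diff.
Qed.

Lemma vf_eqf X Y : eqf X Y -> vector_field X -> vector_field Y.
Proof.
move=> XY [sX tX]; split=> [c|c c' p h h'].
  by apply: smooth_ext (sX c); [exact: open_cod|exact: XY].
by rewrite -!XY; [exact: tX|exact: cod_dom..].
Qed.

Lemma eqf_near c X Y z : eqf X Y -> cod c z -> \forall y \near z, X c y = Y c y.
Proof. by move=> XY /near_cod; apply: filterS => y; exact: XY. Qed.

Definition sumf n (F : 'I_n -> field M) : field M := fun c z => \sum_i F i c z.

Lemma sumfS n (F : 'I_n.+1 -> field M) :
  sumf F = addf (F ord0) (sumf (fun i => F (lift ord0 i))).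
Proof. by apply/funext => c; apply/funext => z; rewrite /sumf /addf big_ord_recl. Qed.

Lemma sumf0 (F : 'I_0 -> field M) : sumf F = zerof M.
Proof. by apply/funext => c; apply/funext => z; rewrite /sumf big_ord0. Qed.

Lemma vf_sum n (F : 'I_n -> field M) :
  (forall i, vector_field (F i)) -> vector_field (sumf F).
Proof.
elim: n F => [|n IH] F hF; first by rewrite sumf0; exact: vf_zero.
by rewrite sumfS; apply: vf_add => //; exact: IH.
Qed.

(** The Hessian of the transition map is the obstruction to ['D_X Y] being a vector field. In
    [vf_bracket] it cancels by Schwarz; in [Ups_law] it becomes the inhomogeneous term of the
    Christoffel symbols. *)
Lemma derive_push c c' X Y z : vector_field X -> vector_field Y -> overlap c c' z ->
  'D_(X c' (trans c c' z)) (Y c') (trans c c' z) =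
  'D_(X c z) ('D_(Y c z) (trans c c')) z +
  'D_('D_(X c z) (Y c) z) (trans c c') z.
Proof.
move=> hX hY hz; have [p [h h'] pz] := hz.
have cz : cod c z by exists p.
have dt : differentiable (trans c c') z by rewrite -pz; exact: trans_diff.
have dY : differentiable (Y c') (trans c c' z).
  by apply: vf_diff => //; rewrite -pz transE //; exact: cod_dom.
rewrite (vf_trans hX hz) -(derive_compE _ dt dY).
have -> : 'D_(X c z) (Y c' \o trans c c') z = 'D_(X c z) (fun w => 'D_(Y c w) (trans c c') w) z.
  apply: near_eq_derive; apply: filterS (near_overlap hz) => y hy.
  by rewrite /= (vf_trans hY hy).
rewrite (derive_dir _ (open_overlap c c') hz (pm_trans hM c c') (b := fun w => w)).
- by rewrite (derive_id z).
- by [].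
- exact: vf_diff.
Qed.

Lemma vf_bracket X Y : vector_field X -> vector_field Y -> vector_field (bracket X Y).
Proof.
move=> hX hY; split=> [c|c c' p h h'].
  apply: (smooth_subf (open_cod c)).
    by apply: (smooth_dir (open_cod c) (U' := cod c) (f := fun z => z)) => //;
      [exact: vf_smooth|apply: (@smooth_lin _ _ _ _ idfun) => x; exact: cvg_id|exact: vf_smooth].
  by apply: (smooth_dir (open_cod c) (U' := cod c) (f := fun z => z)) => //;
    [exact: vf_smooth|apply: (@smooth_lin _ _ _ _ idfun) => x; exact: cvg_id|exact: vf_smooth].
have hz : overlap c c' (coord c p) by exists p.
rewrite /bracket -(transE c' h) !derive_push // derive_dirB; last exact: trans_diff.
rewrite (Schwarz _ _ (open_overlap c c') hz (pm_trans hM c c')) opprD addrACA subrr.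
by rewrite add0r.
Qed.

(** * Globalization with a bump function *)

Section Bump.
Variables (c : chart M) (p : pt M) (f : pt M -> R^o) (A : set (pt M)).
Hypotheses (cp : dom c p) (hf : bump_at c p f A).

(** In another chart [c'] the local field [W] is carried over by the transition map. Outside the
    overlap, where [trans c' c] has a junk value, the factor [lrep c' f z] is 0. *)
Definition bfield (W : V -> V) : field M := fun c' z =>
  lrep c' f z *: 'D_(W (trans c' c z)) (trans c c') (trans c' c z).

Definition bfun (g : V -> R^o) : pt M -> R^o := fun q => f q * g (coord c q).

Lemma bump_out c' q : dom c' q -> ~ dom c q -> f q = 0.
Proof.
move=> h' h; have [//|/nbhs_singleton] := bump_supp hf h'.
by rewrite lrepE.
Qed.

Lemma near_bump : \forall y \near coord c p, lrep c f y = 1.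
Proof.
have [oA AD] := bump_open hf.
have : open_nbhs (coord c p) (coord c @` (A `&` dom c)).
  by split; [exact: oA|exists p => //; split=> //; exact: (bump_in hf)].
move=> /open_nbhs_nbhs; apply: filterS => y [q [Aq cq] <-].
by rewrite lrepE // (bump_one hf).
Qed.

Lemma smooth_bfun g : smooth_on (cod c) g -> smooth_fun (bfun g).
Proof.
move=> sg c'; apply: smooth_local => _ [q h' <-].
have [h|h] := pselect (dom c q).
  exists (overlap c' c); first by exists q.
  apply: (@smooth_ext _ _ _ _ (fun z => lrep c' f z *: g (trans c' c z))).
  - exact: open_overlap.
  - by move=> _ [r [r1 r2] <-]; rewrite transE // !lrepE.
  apply: (smooth_scale (open_overlap c' c)).
    apply: smooth_sub (bump_smooth hf c') => _ [r [r1 r2] <-]; exact: cod_dom.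
  apply: (smooth_comp (open_overlap c' c) (U' := cod c)) => //.
    by move=> _ [r [r1 r2] <-]; rewrite transE //; exact: cod_dom.
  exact: pm_trans.
(* Outside [dom c] the bump function vanishes in a whole coordinate neighbourhood, so the product is
   locally the zero function. *)
have [//|N] := bump_supp hf h'.
  have : nbhs (coord c' q) [set z | lrep c' f z = 0] := N.
  rewrite nbhsE => -[B [oB Bq] HB].
exists B => //; apply: (@smooth_ext _ _ _ _ (fun=> 0)) => //; last exact: smooth_cst.
move=> z Bz; have [[r r1 rz]|nz] := pselect (cod c' z); last by rewrite lrep_out.
have := HB _ Bz; rewrite -rz /= !lrepE // /bfun => ->.
by rewrite mul0r.
Qed.

Lemma bfieldE W z : cod c z -> bfield W c z = lrep c f z *: W z.
Proof. by move=> cz; rewrite /bfield trans_id // D_trans_id. Qed.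

Lemma bfield_one W q : A q -> bfield W c (coord c q) = W (coord c q).
Proof.
move=> Aq; have [_ AD] := bump_open hf.
rewrite bfieldE ?lrepE ?(bump_one hf) ?scale1r //; [exact: AD|exact/cod_dom/AD].
Qed.

Lemma near_bfield W : \forall y \near coord c p, bfield W c y = W y.
Proof.
have := near_cod (cod_dom cp); apply: filterS2 near_bump => y fy cy.
by rewrite bfieldE // fy scale1r.
Qed.

Lemma vf_bfield W : smooth_on (cod c) W -> vector_field (bfield W).
Proof.
move=> sW; split=> [c'|c' c'' q h' h''].
  apply: smooth_local => _ [q h' <-].
  have [h|h] := pselect (dom c q).
    exists (overlap c' c); first by exists q.
    have maps z : overlap c' c z -> overlap c c' (trans c' c z).
      by move=> [r [r1 r2] <-]; rewrite transE //; exists r.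
    apply: (smooth_scale (open_overlap c' c)).
      apply: smooth_sub (bump_smooth hf c') => _ [r [r1 r2] <-]; exact: cod_dom.
    apply: (smooth_dir (open_overlap c' c) maps).
    - apply: (smooth_comp (open_overlap c' c) (U' := cod c)) => //; last exact: pm_trans.
      by move=> _ [r [r1 r2] <-]; rewrite transE //; exact: cod_dom.
    - exact: pm_trans.
    - exact: pm_trans.
  have [//|N] := bump_supp hf h'.
  have : nbhs (coord c' q) [set z | lrep c' f z = 0] := N.
  rewrite nbhsE => -[B [oB Bq] HB].
  exists B => //; apply: (@smooth_ext _ _ _ _ (fun=> 0)) => //; last exact: smooth_cst.
  by move=> z Bz; rewrite /bfield HB // scale0r.
rewrite /bfield !lrepE //.
have [h|h] := pselect (dom c q); last first.
  by rewrite (bump_out h') // !scale0r derive0.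
rewrite -!/(trans _ _) !transE // derive_dirZ; last exact: trans_diff.
by rewrite D_trans_comp.
Qed.

End Bump.

(** * The local form of a linear connection *)

Section Connection.
Variable D : field M -> field M -> field M.
Hypothesis hD : linear_connection D.

Lemma smooth_fun_cst (a : R^o) : smooth_fun (fun _ : pt M => a).
Proof.
move=> c; apply: (@smooth_ext _ _ _ _ (fun=> a)); [exact: open_cod| |exact: smooth_cst].
by move=> _ [q h <-]; rewrite lrepE.
Qed.

Lemma conn_sl n (F : 'I_n -> field M) Y : (forall i, vector_field (F i)) ->
  vector_field Y -> eqf (D (sumf F) Y) (sumf (fun i => D (F i) Y)).
Proof.
move=> hF hY; elim: n F hF => [|n IH] F hF.
  rewrite !sumf0 => c z hz.
  have s0 := smooth_fun_cst 0.
  (* The empty sum: function-linearity applies to the zero field once it is written as 0 times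
     [Y]. *)
  have E : eqf (zerof M) (scalef (fun=> 0) Y).
    by move=> c' _ [q h <-]; rewrite /scalef lrepE // scale0r.
  have hs : vector_field (scalef (fun=> 0) Y) by exact: vf_scale.
  rewrite (conn_ext hD vf_zero hs hY hY E) // (conn_scalel hD s0 hY hY) //.
  by case: hz => q h <-; rewrite /scalef lrepE // scale0r.
have hF' i : vector_field (F (lift ord0 i)) by [].
rewrite !sumfS => c z hz; rewrite (conn_addl hD) //; last exact: vf_sum.
by rewrite /addf IH.
Qed.

Lemma conn_sr n (F : 'I_n -> field M) X : (forall i, vector_field (F i)) ->
  vector_field X -> eqf (D X (sumf F)) (sumf (fun i => D X (F i))).
Proof.
move=> hF hX; elim: n F hF => [|n IH] F hF.
  rewrite !sumf0 => c z hz.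
  have s0 := smooth_fun_cst 0.
  have E : eqf (zerof M) (scalef (fun=> 0) X).
    by move=> c' _ [q h <-]; rewrite /scalef lrepE // scale0r.
  have hs : vector_field (scalef (fun=> 0) X) by exact: vf_scale.
  rewrite (conn_ext hD hX hX vf_zero hs _ E) // (conn_leibniz hD s0 hX hX) //.
  rewrite /addf /dscalef /scalef.
  have -> : 'D_(X c z) (lrep c (fun _ : pt M => 0)) z = 'D_(X c z) (fun _ : V => 0 : R^o) z.
    apply: near_eq_derive; apply: filterS (near_cod hz) => _ [q h <-].
    by rewrite lrepE.
  rewrite derive_cst scale0r add0r.
  by case: hz => q h <-; rewrite lrepE // scale0r.
have hF' i : vector_field (F (lift ord0 i)) by [].
rewrite !sumfS => c z hz; rewrite (conn_addr hD) //; last exact: vf_sum.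
by rewrite /addf IH.
Qed.

(* With [f] a bump function at [p] and [E_i] the globalized basis fields,
   [f^2 X = sum_i (f X^i) (f E_i)] holds globally, so that no separate locality
   argument is needed. *)
Lemma conn_local c p : has_bumps M -> dom c p ->
  exists G : V -> V -> V,
    [/\ forall a u v w, G (a *: u + v) w = a *: G u w + G v w,
        forall a u v w, G w (a *: u + v) = a *: G w u + G w v
      & forall X Y, vector_field X -> vector_field Y ->
          D X Y c (coord c p) = 'D_(X c (coord c p)) (Y c) (coord c p)
            + G (X c (coord c p)) (Y c (coord c p))].
Proof.
move=> hB cp; have [f [A hf]] := hB _ _ cp.
have [[n [e [l [cl dl]]]]] := hV.
have cz := cod_dom cp; set z := coord c p in cz *.
pose E i := bfield c f (fun=> e i).
have hE i : vector_field (E i) by apply: (vf_bfield hf); exact: smooth_cst.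
have Ez i : E i c z = e i by apply: (nbhs_singleton (near_bfield cp hf (fun=> e i))).
(* The values of [D (E i) (E j)] play the part of Christoffel symbols; bilinearity comes from the
   linear forms [l i], so independence of the [e i] does not enter. *)
exists (fun v w => \sum_i l i v *: \sum_j l j w *: D (E i) (E j) c z); split.
- move=> a u v w; rewrite scaler_sumr -big_split /=; apply: eq_bigr => i _.
  by rewrite linearP scalerDl scalerA.
- move=> a u v w; rewrite scaler_sumr -big_split /=; apply: eq_bigr => i _.
  rewrite scalerA mulrC -scalerA -scalerDr; congr (_ *: _).
  rewrite scaler_sumr -big_split /=; apply: eq_bigr => j _.
  by rewrite linearP scalerDl scalerA.
move=> X Y hX hY.
pose g : pt M -> R^o := bfun c f (lrep c f).
have sg : smooth_fun g by apply: (smooth_bfun hf); exact: (bump_smooth hf).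
pose Xc (X : field M) i := bfun c f (fun y => l i (X c y)).
have sXc X' i : vector_field X' -> smooth_fun (Xc X' i).
  move=> hX'; apply: (smooth_bfun hf); apply: (smooth_lincomp (open_cod c) (cl i)).
  exact: vf_smooth.
have decomp X' : vector_field X' -> eqf (scalef g X') (sumf (fun i => scalef (Xc X' i) (E i))).
  move=> hX' c' _ [q h' <-]; rewrite /scalef /sumf lrepE //.
  under eq_bigr => i _ do rewrite lrepE //.
  have [h|h] := pselect (dom c q); last first.
    rewrite /g /bfun (bump_out hf h') // mul0r scale0r big1 // => i _.
    by rewrite /Xc /bfun (bump_out hf h') // mul0r scale0r.
  rewrite /g /bfun (hX'.2 c c') // lrepE //.
  rewrite {1}[X' c _]dl derive_dir_sum; last exact: trans_diff.
  rewrite scaler_sumr; apply: eq_bigr => i _.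
  rewrite /Xc /bfun /E /bfield lrepE // !transE // !scalerA.
  by congr (_ *: _); rewrite -!mulrA; congr (_ * _); rewrite mulrC.
have lg : \forall y \near z, lrep c g y = 1.
  have := near_cod cz; apply: filterS2 (near_bump cp hf) => y fy [q h qy].
  by move: fy; rewrite -qy !lrepE // /g /bfun lrepE // => ->; rewrite mulr1.
have lXc i : \forall y \near z, lrep c (Xc Y i) y = l i (Y c y).
  have := near_cod cz; apply: filterS2 (near_bump cp hf) => y fy [q h qy].
  by move: fy; rewrite -qy !lrepE // /Xc /bfun => ->; rewrite mul1r.
have lXcz X' i : vector_field X' -> lrep c (Xc X' i) z = l i (X' c z).
  move=> hX'; rewrite lrepE // /Xc /bfun.
  by have := nbhs_singleton (near_bump cp hf); rewrite lrepE // => ->; rewrite mul1r.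
have vs X' i : vector_field X' -> vector_field (scalef (Xc X' i) (E i)).
  by move=> hX'; apply: vf_scale => //; exact: sXc.
have vg X' : vector_field X' -> vector_field (scalef g X') by exact: vf_scale.
(* [g] is constantly 1 near [z], so its derivative drops out of the Leibniz rule. *)
have S1 : D X Y c z = D X (scalef g Y) c z.
  rewrite (conn_leibniz hD sg hX hY) // /addf /dscalef /scalef.
  rewrite (nbhs_singleton lg) scale1r.
  have -> : 'D_(X c z) (lrep c g) z = 'D_(X c z) (fun=> 1 : R^o) z.
    exact: near_eq_derive lg.
  by rewrite derive_cst scale0r add0r.
have S2 : D X (scalef g Y) c z = D (scalef g X) (scalef g Y) c z.
  rewrite (conn_scalel hD sg hX (vg _ hY)) // /scalef.
  by rewrite (nbhs_singleton lg) scale1r.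
have vss X' : vector_field X' -> vector_field (sumf (fun i => scalef (Xc X' i) (E i))).
  by move=> hX'; apply: vf_sum => i; exact: vs.
rewrite S1 S2 (conn_ext hD (vg _ hX) (vss _ hX) (vg _ hY) (vss _ hY) (decomp _ hX) (decomp _ hY)) //.
rewrite (conn_sl (fun i => vs _ i hX) (vss _ hY)) // /sumf.
rewrite {1}[X c z]dl derive_dir_sum; last exact: vf_diff.
rewrite -big_split /=; apply: eq_bigr => i _.
rewrite (conn_scalel hD (sXc _ i hX) (hE i) (vss _ hY)) // {1}/scalef lXcz //.
rewrite -scalerDr; congr (_ *: _).
rewrite (conn_sr (fun i => vs _ i hY) (hE i)) // /sumf.
rewrite (dl ('D_(e i) (Y c) z)) -big_split /=; apply: eq_bigr => j _.
rewrite (conn_leibniz hD (sXc _ j hY) (hE i) (hE j)) // /addf /dscalef /scalef lXcz // !Ez.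
congr (_ *: _ + _).
rewrite (near_eq_derive _ (lXc j)) derive_lincomp //; exact: vf_diff.
Qed.

End Connection.
End Premanifold.

Lemma smooth_manifold_pre (R : realType) (V : normedModType R) (M : charted V) :
  smooth_manifold M -> premanifold M.
Proof. by case=> inj _ ov tr _ _; split. Qed.

Section MOpen.
Context {R : realType} {V : normedModType R} {M : charted V}.
Hypothesis hM : premanifold M.

Lemma mopen_near (c : chart M) (A : set (pt M)) q : mopen A -> dom c q -> A q ->
  \forall y \near coord c q, (coord c @` (A `&` dom c)) y.
Proof.
by move=> oA cq Aq; apply: open_nbhs_nbhs; split; [exact: oA|exists q].
Qed.

Lemma mopen_chart (c : chart M) (B : set V) : open B ->
  mopen (dom c `&` [set q | B (coord c q)]).
Proof.
move=> oB c'; rewrite openE => _ [q [[cq /= Bq] c'q] <-].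
have hq : overlap c' c (coord c' q) by exists q.
have ct : {for coord c' q, continuous (trans c' c)}.
  by apply: differentiable_continuous; exact: trans_diff.
have N : nbhs (trans c' c (coord c' q)) B.
  by rewrite transE //; exact: open_nbhs_nbhs.
rewrite /interior; apply: filterS2 (near_overlap hM hq) (ct _ N).
by move=> _ [r [cr c'r] <-]; rewrite /= transE // => Br; exists r.
Qed.

End MOpen.

(* The support of the bump function is compact in the chart, hence closed in
   the Hausdorff manifold. *)
Lemma manifold_bumps (R : realType) (n : nat) (M : charted 'rV[R]_n) :
  smooth_manifold M -> has_bumps M.
Proof.
move=> hM c p cp; have pM := smooth_manifold_pre hM.
(* Intersecting with a unit ball makes the support bounded, hence compact in finite dimension. *)
have zU : nbhs (coord c p) (cod c `&` ball (coord c p) 1).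
  apply: filterI; last exact: nbhsx_ballx.
  exact: (near_cod pM (cod_dom cp)).
have [f [K [sf f1 cK KU f0]]] := bump_function zU.
have compK : compact K.
  apply: bounded_closed_compact => //.
  exists (`|coord c p| + 1); split; first exact: num_real.
  move=> r hr x Kx; apply: le_trans (ltW hr).
  have [_] := KU _ Kx; rewrite -ball_normE /ball_ /= distrC => h.
  have -> : x = coord c p + (x - coord c p) by rewrite addrC subrK.
  by rewrite (le_trans (ler_normD _ _)) // lerD2l ltW.
pose g (q : pt M) : R^o := if `[< dom c q >] then f (coord c q) else 0.
have gE q : dom c q -> g q = f (coord c q) by move=> h; rewrite /g asboolT.
have gout q : ~ dom c q -> g q = 0 by move=> h; rewrite /g asboolF.
have far c' q : dom c' q -> ~ dom c q -> \forall y \near coord c' q, lrep c' g y = 0.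
  move=> c'q cq.
  (* The relation says that no point has coordinates [x] in [c] and [y] in [c']. Separation gives it
     near each pair [(x, coord c' q)] with [x] in [K]; compactness makes one neighbourhood of
     [coord c' q] work for all of [K]. *)
  have /compact_near_coveringP /(_ 'rV[R]_n (nbhs (coord c' q))
    (fun y x => ~ exists r, [/\ dom c r, dom c' r, coord c r = x & coord c' r = y])) := compK.
  have H x : K x -> \forall x' \near x & y \near coord c' q,
      ~ exists r, [/\ dom c r, dom c' r, coord c r = x' & coord c' r = y].
    move=> Kx; have [[p' cp' <-] _] := KU _ Kx.
    have pq : p' <> q by move=> e; apply: cq; rewrite -e.
    have [A [B [oA oB Ap Bq AB]]] := mhausdorff hM pq.
    exists (coord c @` (A `&` dom c), coord c' @` (B `&` dom c')).
      by split; [exact: (mopen_near oA cp' Ap)|exact: (mopen_near oB c'q Bq)].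
    move=> [x' y] /= [[a [Aa ca] ax] [b [Bb cb] by_]] [r [cr c'r rx ry]].
    have ra : r = a by apply: (pm_inj pM cr ca); rewrite rx ax.
    have rb : r = b by apply: (pm_inj pM c'r cb); rewrite ry by_.
    have : (A `&` B) r by split; [rewrite ra|rewrite rb].
    by rewrite AB.
  move=> /(_ _ H); apply: filterS => y Hy.
  have [[r c'r ry]|] := pselect (cod c' y); last exact: lrep_out.
  rewrite -ry lrepE //; have [cr|/gout //] := pselect (dom c r).
  rewrite gE //; apply: f0 => Kr; apply: (Hy _ Kr).
  by exists r.
move: f1; rewrite /prop_near1 nbhsE => -[B [oB Bz] HB].
exists g, (dom c `&` [set q | B (coord c q)]); split.
- move=> c'; apply: smooth_local => _ [q c'q <-].
  have [cq|cq] := pselect (dom c q).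
    exists (overlap c' c); first by exists q.
    apply: (@smooth_ext _ _ _ _ (fun z => f (trans c' c z))).
    + exact: open_overlap.
    + by move=> _ [r [cr c'r] <-]; rewrite transE // lrepE // gE.
    apply: (smooth_comp (open_overlap pM c' c) (U' := setT)) => //.
    exact: pm_trans.
  have := far _ _ c'q cq; rewrite /prop_near1 nbhsE => -[B' [oB' Bq] HB'].
  exists B' => //; apply: (@smooth_ext _ _ _ _ (fun=> 0)) => //; last exact: smooth_cst.
  by move=> z /HB'.
- by split; [exact: mopen_chart|move=> q []].
- by [].
- by move=> q [cq /= /HB]; rewrite gE.
- move=> c' q c'q; have [cq|cq] := pselect (dom c q); first by left.
  by right; exact: far.
Qed.

(** * The product manifold and the evolution space *)

Section ProductManifold.
Context {R : realType} {V1 V2 : normedModType R} {M1 : charted V1} {M2 : charted V2}.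
Hypotheses (h1 : premanifold M1) (h2 : premanifold M2).
Local Notation M := (prod_charted M1 M2).
Implicit Types c : chart M.

Lemma prod_overlap c c' x y : overlap c c' (x, y) <->
  overlap (M := M1) c.1 c'.1 x /\ overlap (M := M2) c.2 c'.2 y.
Proof.
split; first by move=> [[p q] /= [[a b] [a' b']] [<- <-]]; split; [exists p|exists q].
by move=> [[p [a b] <-] [q [a' b'] <-]]; exists (p, q).
Qed.

Lemma prod_pm_inj c (p q : pt M) :
  dom c p -> dom c q -> coord c p = coord c q -> p = q.
Proof.
move: p q => [p1 p2] [q1 q2] [a b] [a' b'] [e1 e2]; congr pair.
  exact: (pm_inj h1 a a' e1).
exact: (pm_inj h2 b b' e2).
Qed.

Lemma prod_trans c c' x y : overlap c c' (x, y) ->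
  trans c c' (x, y) = (trans c.1 c'.1 x, trans c.2 c'.2 y).
Proof.
move=> [[p q] /= [[a b] [a' b']] [<- <-]]; rewrite (transE h1) // (transE h2) //.
rewrite /trans /lrep; case: xgetP => [w -> [[r1 r2] [[cr1 cr2] [e1 e2] <-]]|].
  by rewrite (pm_inj h1 cr1 a' e1 : r1 = p) (pm_inj h2 cr2 b' e2 : r2 = q).
by move=> /(_ (coord c' (p, q))); case; exists (p, q).
Qed.

Lemma prod_open_overlap c c' : open (overlap c c').
Proof.
rewrite openE => -[x y] /prod_overlap [ox oy].
exists (overlap (M := M1) c.1 c'.1, overlap (M := M2) c.2 c'.2).
  by split; exact: near_overlap.
by move=> [x' y'] /= [a b]; apply/prod_overlap.
Qed.

Lemma prod_premanifold {f1 : findim V1} {f2 : findim V2} : premanifold M.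
Proof.
split; [exact: prod_pm_inj|exact: prod_open_overlap|].
move=> c c'; have oU := @prod_open_overlap c c'.
apply: (@smooth_ext _ _ _ _ (fun z => (trans c.1 c'.1 z.1, trans c.2 c'.2 z.2))) => //.
  by move=> [x y] h; rewrite prod_trans.
apply: (smooth_pair oU).
  apply: (smooth_comp oU (U' := overlap (M := M1) c.1 c'.1)).
  - by move=> [x y] /prod_overlap[].
  - by apply: smooth_lin => x; exact: cvg_fst.
  - exact: pm_trans.
apply: (smooth_comp oU (U' := overlap (M := M2) c.2 c'.2)).
- by move=> [x y] /prod_overlap[].
- by apply: smooth_lin => x; exact: cvg_snd.
- exact: pm_trans.
Qed.

Lemma prod_D_trans c c' x y v w : overlap c c' (x, y) ->
  'D_(v, w) (trans c c') (x, y) =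
  ('D_v (trans c.1 c'.1) x, 'D_w (trans c.2 c'.2) y).
Proof.
move=> hxy; have [[p [p1 p2] px] [q [q1 q2] qy]] := (prod_overlap _ _ _ _).1 hxy.
have d1 : differentiable (trans c.1 c'.1) x by rewrite -px; exact: trans_diff.
have d2 : differentiable (trans c.2 c'.2) y by rewrite -qy; exact: trans_diff.
have dfst : differentiable (fst : V1 * V2 -> V1) (x, y).
  by apply: linear_differentiable => z; exact: cvg_fst.
have dsnd : differentiable (snd : V1 * V2 -> V2) (x, y).
  by apply: linear_differentiable => z; exact: cvg_snd.
have -> : 'D_(v, w) (trans c c') (x, y) = 'D_(v, w)
    (fun z : V1 * V2 => ((trans c.1 c'.1 \o fst) z, (trans c.2 c'.2 \o snd) z)) (x, y).
  apply: near_eq_derive.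
  have : \forall z \near (x, y), overlap c c' z.
    by apply: open_nbhs_nbhs; split=> //; exact: prod_open_overlap.
  by apply: filterS => -[x' y'] h; rewrite prod_trans.
rewrite derive_pair; [|exact: differentiable_comp..].
have Lfst : 'D_(v, w) (fst : V1 * V2 -> V1) (x, y) = v.
  by rewrite derive_lin // => z; exact: cvg_fst.
have Lsnd : 'D_(v, w) (snd : V1 * V2 -> V2) (x, y) = w.
  by rewrite derive_lin // => z; exact: cvg_snd.
by rewrite !derive_compE // Lfst Lsnd.
Qed.

End ProductManifold.

Local Opaque derive.

(** * The model space of [Etilde] and its coordinate projections *)

Section Components.
Context {R : realType} {m k : nat}.
Local Notation E := (VE R m k).

Lemma ct_linear : linear (@ct R m k : E -> R^o). Proof. by []. Qed.
Lemma cx_linear : linear (@cx R m k : E -> 'rV[R]_m). Proof. by []. Qed.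
Lemma cy_linear : linear (@cy R m k : E -> 'rV[R]_k). Proof. by []. Qed.
Lemma cu_linear : linear (@cu R m k : E -> 'rV[R]_m). Proof. by []. Qed.
HB.instance Definition _ := GRing.isLinear.Build R E R^o _ (@ct R m k) ct_linear.
HB.instance Definition _ := GRing.isLinear.Build R E 'rV[R]_m _ (@cx R m k) cx_linear.
HB.instance Definition _ := GRing.isLinear.Build R E 'rV[R]_k _ (@cy R m k) cy_linear.
HB.instance Definition _ := GRing.isLinear.Build R E 'rV[R]_m _ (@cu R m k) cu_linear.

Lemma continuous_comp_fst (A B C : topologicalType) (f : A -> C) :
  continuous f -> continuous (fun p : A * B => f p.1).
Proof.
move=> cf p; apply: (@continuous_comp _ _ _ fst f); last exact: cf.
exact: cvg_fst.
Qed.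
Lemma cu_continuous : continuous (@cu R m k : E -> 'rV[R]_m).
Proof. by move=> z; exact: cvg_snd. Qed.
Lemma cy_continuous : continuous (@cy R m k : E -> 'rV[R]_k).
Proof. by apply: (continuous_comp_fst (f := snd)) => z; exact: cvg_snd. Qed.
Lemma cx_continuous : continuous (@cx R m k : E -> 'rV[R]_m).
Proof.
apply: (continuous_comp_fst (f := fun z => z.1.2)).
by apply: (continuous_comp_fst (f := snd)) => z; exact: cvg_snd.
Qed.
Lemma ct_continuous : continuous (@ct R m k : E -> R^o).
Proof.
apply: (continuous_comp_fst (f := fun z => z.1.1)).
by apply: (continuous_comp_fst (f := fst)) => z; exact: cvg_fst.
Qed.

Definition ctL : {linear E -> R^o} := @ct R m k.
Lemma smooth_ct (U : set E) : smooth_on U (@ct R m k).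
Proof. exact: (@smooth_lin R E R^o U ctL ct_continuous). Qed.
Lemma diff_ct (z : E) : differentiable (@ct R m k) z.
Proof. exact: (@linear_differentiable _ _ _ ctL z ct_continuous). Qed.
Lemma Dlin_ct (z v : E) : 'D_v (@ct R m k) z = ct v.
Proof. exact: (@derive_lin R E R^o ctL z v ct_continuous). Qed.
Definition cxL : {linear E -> 'rV[R]_m} := @cx R m k.
Lemma smooth_cx (U : set E) : smooth_on U (@cx R m k).
Proof. exact: (@smooth_lin R E 'rV[R]_m U cxL cx_continuous). Qed.
Lemma diff_cx (z : E) : differentiable (@cx R m k) z.
Proof. exact: (@linear_differentiable _ _ _ cxL z cx_continuous). Qed.
Lemma Dlin_cx (z v : E) : 'D_v (@cx R m k) z = cx v.
Proof. exact: (@derive_lin R E 'rV[R]_m cxL z v cx_continuous). Qed.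
Definition cyL : {linear E -> 'rV[R]_k} := @cy R m k.
Lemma smooth_cy (U : set E) : smooth_on U (@cy R m k).
Proof. exact: (@smooth_lin R E 'rV[R]_k U cyL cy_continuous). Qed.
Lemma diff_cy (z : E) : differentiable (@cy R m k) z.
Proof. exact: (@linear_differentiable _ _ _ cyL z cy_continuous). Qed.
Lemma Dlin_cy (z v : E) : 'D_v (@cy R m k) z = cy v.
Proof. exact: (@derive_lin R E 'rV[R]_k cyL z v cy_continuous). Qed.
Definition cuL : {linear E -> 'rV[R]_m} := @cu R m k.
Lemma smooth_cu (U : set E) : smooth_on U (@cu R m k).
Proof. exact: (@smooth_lin R E 'rV[R]_m U cuL cu_continuous). Qed.
Lemma diff_cu (z : E) : differentiable (@cu R m k) z.
Proof. exact: (@linear_differentiable _ _ _ cuL z cu_continuous). Qed.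
Lemma Dlin_cu (z v : E) : 'D_v (@cu R m k) z = cu v.
Proof. exact: (@derive_lin R E 'rV[R]_m cuL z v cu_continuous). Qed.

Lemma D_ct (V : normedModType R) (f : V -> E) x v : differentiable f x ->
  'D_v (fun y => ct (f y)) x = ct ('D_v f x).
Proof. exact: (@derive_lincomp _ _ _ _ ctL f x v ct_continuous). Qed.
Lemma D_cx (V : normedModType R) (f : V -> E) x v : differentiable f x ->
  'D_v (fun y => cx (f y)) x = cx ('D_v f x).
Proof. exact: (@derive_lincomp _ _ _ _ cxL f x v cx_continuous). Qed.

Lemma eqE (z w : E) : ct z = ct w -> cx z = cx w -> cy z = cy w -> cu z = cu w -> z = w.
Proof.
by move: z w => [[[t x] y] u] [[[t' x'] y'] u']; rewrite /ct /cx /cy /cu /= => -> -> -> ->.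
Qed.

Lemma differentiable_pair4 (V : normedModType R) (f1 : V -> R^o) (f2 : V -> 'rV[R]_m)
    (f3 : V -> 'rV[R]_k) (f4 : V -> 'rV[R]_m) x :
  differentiable f1 x -> differentiable f2 x -> differentiable f3 x ->
  differentiable f4 x -> differentiable (fun y => (f1 y, f2 y, f3 y, f4 y) : E) x.
Proof. by move=> *; do 3!apply: differentiable_pair => //. Qed.

Lemma derive_pair4 (V : normedModType R) (f1 : V -> R^o) (f2 : V -> 'rV[R]_m)
    (f3 : V -> 'rV[R]_k) (f4 : V -> 'rV[R]_m) x v :
  differentiable f1 x -> differentiable f2 x -> differentiable f3 x ->
  differentiable f4 x -> 'D_v (fun y => (f1 y, f2 y, f3 y, f4 y) : E) x =
    ('D_v f1 x, 'D_v f2 x, 'D_v f3 x, 'D_v f4 x).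
Proof.
move=> d1 d2 d3 d4; rewrite derive_pair //; last by do 2!apply: differentiable_pair => //.
rewrite derive_pair //; last exact: differentiable_pair.
by rewrite derive_pair.
Qed.

Lemma smooth_pair4 (V : normedModType R) (U : set V) (f1 : V -> R^o)
    (f2 : V -> 'rV[R]_m) (f3 : V -> 'rV[R]_k) (f4 : V -> 'rV[R]_m) : open U ->
  smooth_on U f1 -> smooth_on U f2 -> smooth_on U f3 -> smooth_on U f4 ->
  smooth_on U (fun y => (f1 y, f2 y, f3 y, f4 y) : E).
Proof. by move=> oU *; do 3!apply: smooth_pair => //. Qed.

End Components.

(** * The evolution space as a manifold: charts, transition maps, bump functions *)

Section EtildeManifold.
Context {R : realType} {m k : nat}.
Context {M1 : charted 'rV[R]_m} {M2 : charted 'rV[R]_k} {s : csys M1 M2}.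
Hypotheses (h1 : premanifold M1) (h2 : premanifold M2) (hs : constrained_system s).
Local Notation M := (prod_charted M1 M2).
Local Notation E := (Etilde s).
Implicit Types (c : chart M).

Let hM : premanifold M. Proof. exact: prod_premanifold. Qed.

Section Point.
Variables (t : R) (p : pt M) (c : chart M) (cp : dom c p) (v : 'rV[R]_m * 'rV[R]_k).

Definition mktvec (c' : chart M) : 'rV[R]_m * 'rV[R]_k :=
  if `[< dom c' p >] then 'D_v (trans c c') (coord c p) else 0.

Lemma mktvec_trans c' c'' : dom c' p -> dom c'' p ->
  mktvec c'' = 'D_(mktvec c') (trans c' c'') (coord c' p).
Proof.
move=> d d'; rewrite /mktvec (asboolT d) (asboolT d').
exact: esym (D_trans_comp hM v cp d d').
Qed.

Lemma mktvec_junk c' : ~ dom c' p -> mktvec c' = 0.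
Proof. by move=> d; rewrite /mktvec asboolF. Qed.

Definition mkjet : jet M := Jet t (Tangent mktvec_trans mktvec_junk).

Lemma mkjet_coord : jcoord c mkjet = (t, coord c.1 p.1, coord c.2 p.2, v.1) /\
  tvec (jvel mkjet) c = v.
Proof.
have e : mktvec c = v.
  rewrite /mktvec (asboolT cp); exact: (D_trans_id hM v (cod_dom cp)).
by split=> //; rewrite /jcoord /= e.
Qed.

End Point.

(** Time and velocity are unrestricted. For the converse, the velocity [(u, Psi)] satisfies the
    constraint in [c] by construction, and [constraint_chart] carries it to the other charts. *)
Lemma codE c z : cod (M := E) c z <-> cod c.1 (cx z) /\ cod c.2 (cy z).
Proof.
split=> [[[j cj] /= [d1 d2] <-]|[[p1 d1 e1] [p2 d2 e2]]].
  by split; exact: cod_dom.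
have cp : dom (c : chart M) ((p1, p2) : pt M) by [].
pose j := mkjet (ct z) cp (cu z, cPsi s c z).
have [jz jt] := mkjet_coord (ct z) cp (cu z, cPsi s c z).
have {}jz : jcoord c j = z.
  by rewrite jz /= e1 e2; move: z {j jt jz e1 e2} => [[[? ?] ?] ?].
have jc : constraint s c j by rewrite /constraint jt jz.
have jall c' : dom c' (jbase j) -> constraint s c' j.
  by move=> d; exact: (@constraint_chart _ _ _ _ _ _ hs j c c' cp d jc).
by exists (exist _ j jall).
Qed.

(** The chart records half of the velocity; the constraint returns the other half, and a tangent
    vector is determined by its components in one chart. Proof irrelevance then identifies the
    records. *)
Lemma E_inj (c : chart E) (p q : pt E) : dom c p -> dom c q -> coord c p = coord c q -> p = q.
Proof.
move: p q => [[t [p1 p2] [v vt vj]] cj] [[t' [q1 q2] [v' vt' vj']] cj'] /=.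
move=> [d1 d2] [d1' d2']; rewrite /jcoord /= => -[et e1 e2 ev].
have E1 : p1 = q1 by exact: (pm_inj h1 d1 d1' e1).
have E2 : p2 = q2 by exact: (pm_inj h2 d2 d2' e2).
subst t' q1 q2.
have evc : v c = v' c.
  have := cj c (conj d1 d2); have := cj' c (conj d1 d2).
  rewrite /constraint /jcoord /= ev => <-.
  by move: ev; case: (v c) => a b; case: (v' c) => a' b' /= -> ->.
have vv : v = v'.
  apply/funext => c'; have [d|d] := pselect (dom c' ((p1, p2) : pt M)).
    by rewrite (vt c c' (conj d1 d2) d) (vt' c c' (conj d1 d2) d) evc.
  by rewrite vj // vj'.
subst v'.
rewrite (Prop_irrelevance vt vt') (Prop_irrelevance vj vj') in cj cj' *.
by rewrite (Prop_irrelevance cj cj').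
Qed.

Lemma E_overlap c c' z : overlap (M := E) c c' z <->
  overlap (M := M1) c.1 c'.1 (cx z) /\ overlap (M := M2) c.2 c'.2 (cy z).
Proof.
split=> [[[j cj] /= [[d1' d2'] [d1 d2]] <-]|[[q1 [a1 b1] e1] [q2 [a2 b2] e2]]].
  by split; [exists (jbase j).1|exists (jbase j).2].
have : cod (M := E) c z by apply/codE; split; [exists q1|exists q2].
move=> [[j cj] /= [d1 d2] jz]; exists (exist _ j cj) => //=; split=> //.
have E1 : q1 = (jbase j).1 by apply: (pm_inj h1 b1 d1); rewrite e1 -jz.
have E2 : q2 = (jbase j).2 by apply: (pm_inj h2 b2 d2); rewrite e2 -jz.
by split; [rewrite -E1|rewrite -E2].
Qed.

Lemma E_open_overlap c c' : open (overlap (M := E) c c').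
Proof.
rewrite openE => z /E_overlap [ox oy]; rewrite /interior.
have N1 : \forall w \near z, overlap (M := M1) c.1 c'.1 (cx w).
  exact: cx_continuous (near_overlap h1 ox).
have N2 : \forall w \near z, overlap (M := M2) c.2 c'.2 (cy w).
  exact: cy_continuous (near_overlap h2 oy).
by apply: filterS2 N1 N2 => w w1 w2; apply/E_overlap.
Qed.

Definition etrans c c' (z : VE R m k) : VE R m k :=
  (ct z, trans c.1 c'.1 (cx z), trans c.2 c'.2 (cy z), 'D_(cu z) (trans c.1 c'.1) (cx z)).

(** Transition maps of a product are products, so the new u^a depends on x^a and u^a alone and the
    coordinates of [Etilde] transform without reference to u^alpha. *)
Lemma E_trans c c' z : overlap (M := E) c c' z -> trans (M := E) c c' z = etrans c c' z.
Proof.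
move=> oz; have [[j cj] /= [d' d] jz] := oz.
have -> : trans (M := E) c c' z = jcoord c' j.
  rewrite /trans /lrep; case: xgetP => [w -> [q [cq e <-]]|].
    by rewrite (@E_inj c q (exist _ j cj)) // e.
  by move=> /(_ (jcoord c' j)); case; exists (exist _ j cj).
have [ox oy] := (E_overlap _ _ _).1 oz.
rewrite -jz /etrans /jcoord /ct /cx /cy /cu /=.
move: d d' => [d1 d2] [d1' d2'].
rewrite (transE h1) // (transE h2) //.
rewrite (tvec_trans (jvel j) (conj d1 d2 : dom c (jbase j)) (conj d1' d2' : dom c' (jbase j))).
have -> : coord c (jbase j) = (coord c.1 (jbase j).1, coord c.2 (jbase j).2) by [].
case: (tvec (jvel j) c) => v w /=.
rewrite (prod_D_trans h1 h2) //; apply/prod_overlap.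
by split; [exists (jbase j).1|exists (jbase j).2].
Qed.

Lemma smooth_etrans c c' : smooth_on (overlap (M := E) c c') (etrans c c').
Proof.
have oU := @E_open_overlap c c'.
have m1 z : overlap (M := E) c c' z -> overlap (M := M1) c.1 c'.1 (cx z).
  by move=> /E_overlap[].
have m2 z : overlap (M := E) c c' z -> overlap (M := M2) c.2 c'.2 (cy z).
  by move=> /E_overlap[].
apply: smooth_pair4 => //.
- exact: smooth_ct.
- by apply: (smooth_comp oU m1); [exact: smooth_cx|exact: pm_trans].
- by apply: (smooth_comp oU m2); [exact: smooth_cy|exact: pm_trans].
- by apply: (smooth_dir oU m1); [exact: smooth_cu|exact: smooth_cx|exact: pm_trans].
Qed.

Lemma E_premanifold : premanifold E.
Proof.
split; [exact: E_inj|exact: E_open_overlap|move=> c c'].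
apply: smooth_ext (smooth_etrans c c'); first exact: E_open_overlap.
by move=> z oz; rewrite E_trans.
Qed.

(** Second derivatives of the transition map enter the velocity slot through [cx v]. They vanish on
    vectors along x^alpha and u^a, so these directions are natural at once, while H_a and psi need a
    separate argument. *)
Lemma D_etrans c c' z v : overlap (M := E) c c' z ->
  'D_v (trans (M := E) c c') z =
  (ct v, 'D_(cx v) (trans c.1 c'.1) (cx z), 'D_(cy v) (trans c.2 c'.2) (cy z),
   'D_(cx v) ('D_(cu z) (trans c.1 c'.1)) (cx z) + 'D_(cu v) (trans c.1 c'.1) (cx z)).
Proof.
move=> oz; have [ox oy] := (E_overlap _ _ _).1 oz.
have -> : 'D_v (trans (M := E) c c') z = 'D_v (etrans c c') z.
  apply: near_eq_derive; apply: filterS (near_overlap E_premanifold oz) => w ow.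
  by rewrite E_trans.
have dx : differentiable (@cx R m k) z by exact: diff_cx.
have dy : differentiable (@cy R m k) z by exact: diff_cy.
have dt : differentiable (@ct R m k) z by exact: diff_ct.
have du : differentiable (@cu R m k) z by exact: diff_cu.
have d1 : differentiable (trans c.1 c'.1) (cx z) by exact: smooth_diff (pm_trans h1 _ _) ox.
have d2 : differentiable (trans c.2 c'.2) (cy z) by exact: smooth_diff (pm_trans h2 _ _) oy.
have oU := open_overlap h1 c.1 c'.1.
have sdir : smooth_on (overlap (M := E) c c') (fun z : VE R m k => 'D_(cu z) (trans c.1 c'.1) (cx z)).
  apply: (smooth_dir (@E_open_overlap c c') (U' := overlap (M := M1) c.1 c'.1)).
  - by move=> w /E_overlap[].
  - exact: smooth_cu.
  - exact: smooth_cx.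
  - exact: pm_trans.
have e1 : 'D_v (trans c.1 c'.1 \o @cx R m k) z = 'D_(cx v) (trans c.1 c'.1) (cx z).
  by rewrite (derive_compE v (diff_cx z) d1) Dlin_cx.
have e2 : 'D_v (trans c.2 c'.2 \o @cy R m k) z = 'D_(cy v) (trans c.2 c'.2) (cy z).
  by rewrite (derive_compE v (diff_cy z) d2) Dlin_cy.
have := derive_dir (hW := findim_rV m) v oU ox (pm_trans h1 c.1 c'.1) (diff_cx z) (diff_cu z).
rewrite Dlin_cx Dlin_cu => e3.
rewrite derive_pair4 //; first last.
- exact: smooth_diff sdir oz.
- exact: (differentiable_comp (diff_cy z) d2).
- exact: (differentiable_comp (diff_cx z) d1).
apply: eqE; rewrite /ct /cx /cy /cu /=.
- exact: Dlin_ct.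
- exact: e1.
- exact: e2.
- exact: e3.
Qed.

(** The product of the pulled-back bump functions is constant in time and velocity, so its support
    is not compact. [bump_supp] asks for vanishing near the points outside the chart instead, and
    this survives the pullback. *)
Lemma E_bumps : has_bumps M1 -> has_bumps M2 -> has_bumps E.
Proof.
move=> b1 b2 c [j cj] /= [d1 d2].
have [f1 [A1 H1]] := b1 _ _ d1; have [f2 [A2 H2]] := b2 _ _ d2.
pose f (q : pt E) : R^o := f1 (jbase (sval q)).1 * f2 (jbase (sval q)).2.
have fE c' z : lrep (M := E) c' f z = lrep c'.1 f1 (cx z) * lrep c'.2 f2 (cy z).
  have [[q dq <-]|nz] := pselect (cod (M := E) c' z).
    rewrite (lrepE E_premanifold) //; move: q dq => [q cq] /= [dq1 dq2].
    by rewrite (lrepE h1) // (lrepE h2).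
  rewrite lrep_out //.
  have [[q dq qz]|nz1] := pselect (cod c'.1 (cx z)); last by rewrite (lrep_out _ nz1) mul0r.
  have [[q' dq' qz']|nz2] := pselect (cod c'.2 (cy z)); last by rewrite (lrep_out _ nz2) mulr0.
  case: nz; apply/codE; split; [exists q|exists q'] => //.
exists f, [set q : pt E | A1 (jbase (sval q)).1 /\ A2 (jbase (sval q)).2]; split.
- move=> c'; apply: (@smooth_ext _ _ _ _ (fun z => lrep c'.1 f1 (cx z) *: (lrep c'.2 f2 (cy z) : R^o))).
  + exact: open_cod E_premanifold _.
  + by move=> z _; rewrite fE.
  apply: (smooth_scale (open_cod E_premanifold _)).
    apply: (smooth_comp (open_cod E_premanifold _) (U' := cod c'.1)).
    * by move=> z /codE[].
    * exact: smooth_cx.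
    * exact: (bump_smooth H1).
  apply: (smooth_comp (open_cod E_premanifold _) (U' := cod c'.2)).
  * by move=> z /codE[].
  * exact: smooth_cy.
  * exact: (bump_smooth H2).
- have [oA1 AD1] := bump_open H1; have [oA2 AD2] := bump_open H2.
  split; last by move=> q [/AD1 ? /AD2 ?].
  move=> c'; rewrite openE => _ [[q cq] /= [[a1 a2] [e1 e2]] <-]; rewrite /interior.
  have N1 : \forall z \near jcoord c' q, (coord c'.1 @` (A1 `&` dom c'.1)) (cx z).
    exact: (@cx_continuous R m k (jcoord c' q) _ (mopen_near oA1 e1 a1)).
  have N2 : \forall z \near jcoord c' q, (coord c'.2 @` (A2 `&` dom c'.2)) (cy z).
    exact: (@cy_continuous R m k (jcoord c' q) _ (mopen_near oA2 e2 a2)).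
  apply: filterS2 N1 N2 => z [q1 [aq1 dq1] x1] [q2 [aq2 dq2] x2].
  have : cod (M := E) c' z by apply/codE; split; [exists q1|exists q2].
  move=> [[r cr] /= [r1 r2] rz]; exists (exist _ r cr) => //=; split=> //.
  have E1 : q1 = (jbase r).1 by apply: (pm_inj h1 dq1 r1); rewrite x1 -rz.
  have E2 : q2 = (jbase r).2 by apply: (pm_inj h2 dq2 r2); rewrite x2 -rz.
  by split; [rewrite -E1|rewrite -E2].
- by split; [exact: (bump_in H1)|exact: (bump_in H2)].
- by move=> q [/(bump_one H1) e1 /(bump_one H2) e2]; rewrite /f e1 e2 mulr1.
- move=> c' [q cq] /= [e1 e2].
  have [dq1|N] := bump_supp H1 e1; last first.
    right; have N' : \forall z \near jcoord c' q, lrep c'.1 f1 (cx z) = 0.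
      exact: (@cx_continuous R m k (jcoord c' q) _ N).
    apply: filterS N' => z Hz.
    by rewrite fE Hz mul0r.
  have [dq2|N] := bump_supp H2 e2; last first.
    right; have N' : \forall z \near jcoord c' q, lrep c'.2 f2 (cy z) = 0.
      exact: (@cy_continuous R m k (jcoord c' q) _ N).
    apply: filterS N' => z Hz.
    by rewrite fE Hz mulr0.
  by left.
Qed.
End EtildeManifold.

Section RowCoordinates.
Context {R : realType} {V : normedModType R} {n : nat}.

Lemma row_coord_linear (i : 'I_n) : linear (fun v : 'rV[R]_n => v 0 i : R^o).
Proof. by move=> a u v; rewrite !mxE. Qed.
Definition row_coord (i : 'I_n) : {linear 'rV[R]_n -> R^o} :=
  HB.pack (fun v : 'rV[R]_n => v 0 i : R^o)
    (GRing.isLinear.Build _ _ _ _ _ (row_coord_linear i)).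
Lemma row_coord_continuous i : continuous (row_coord i).
Proof. exact: coord_continuous. Qed.

Lemma D_coord (F : V -> 'rV[R]_n) i z v : differentiable F z ->
  'D_v (fun w => F w 0 i : R^o) z = ('D_v F z) 0 i.
Proof. exact: (@derive_lincomp _ _ _ _ (row_coord i) F z v (@row_coord_continuous i)). Qed.

Lemma smooth_coord (U : set V) (F : V -> 'rV[R]_n) i : open U ->
  smooth_on U F -> smooth_on U (fun z => F z 0 i : R^o).
Proof.
by move=> oU sF; apply: (@smooth_lincomp _ _ _ oU _ _ (row_coord i)) => //; exact: row_coord_continuous.
Qed.

Lemma smooth_row (U : set V) (F : 'I_n -> V -> R^o) : open U ->
  (forall i, smooth_on U (F i)) -> smooth_on U (fun z => \row_i F i z).
Proof.
move=> oU sF; apply: (@smooth_ext _ _ _ _ (fun z => \sum_i F i z *: (delta_mx 0 i : 'rV[R]_n))) => //.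
  move=> z _; rewrite [RHS]row_sum_delta; apply: eq_bigr => i _.
  by rewrite mxE.
by apply: (smooth_sum oU) => i; apply: (smooth_scale oU) => //; exact: smooth_cst.
Qed.

End RowCoordinates.

(** * The connection of the second factor *)

Section Christoffel.
Context {R : realType} {k : nat} {M : charted 'rV[R]_k}.
Hypotheses (hM : premanifold M) (hB : has_bumps M).
Variable D : field M -> field M -> field M.
Hypothesis hD : linear_connection D.
Variable Ups : chart M -> 'I_k -> 'I_k -> 'I_k -> 'rV[R]_k -> R.
Hypothesis hUps : has_coefficients D Ups.

Definition UpsV (c : chart M) (z v w : 'rV[R]_k) : 'rV[R]_k :=
  \row_l \sum_(i < k) \sum_(j < k) Ups c i j l z * v 0 i * w 0 j.

Lemma UpsV_delta c z i j : UpsV c z (delta_mx 0 i) (delta_mx 0 j) =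
  \sum_(l < k) Ups c i j l z *: delta_mx 0 l.
Proof.
rewrite [LHS]row_sum_delta; apply: eq_bigr => l _; congr (_ *: _).
rewrite mxE (bigD1 i) //= (bigD1 j) //= !mxE !eqxx !mulr1.
rewrite big1 ?addr0 => [|j' /negPf nj]; last by rewrite !mxE nj !andbF !mulr0.
rewrite big1 ?addr0 // => i' /negPf ni; rewrite big1 // => j' _.
by rewrite !mxE ni andbF mulr0 mul0r.
Qed.

Lemma UpsV_sum c z v w : UpsV c z v w =
  \sum_(i < k) v 0 i *: \sum_(j < k) w 0 j *: UpsV c z (delta_mx 0 i) (delta_mx 0 j).
Proof.
apply/rowP => l; rewrite mxE summxE; apply: eq_bigr => i _.
rewrite mxE summxE mulr_sumr; apply: eq_bigr => j _.
rewrite UpsV_delta !mxE summxE (bigD1 l) //= !mxE !eqxx mulr1 big1 ?addr0.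
  by rewrite [v 0 i * _]mulrC [w 0 j * _]mulrC -!mulrA [w 0 j * _]mulrC.
by move=> l' /negPf nl; rewrite !mxE [l == _]eq_sym nl andbF mulr0.
Qed.

(** The coefficients are given on basis fields. Globalized basis fields are constant near [p], so
    the derivative term of [conn_local] vanishes on them and the bilinear part is identified on
    pairs of basis vectors. *)
Lemma Ups_local c p X Y : dom c p -> vector_field X -> vector_field Y ->
  D X Y c (coord c p) = 'D_(X c (coord c p)) (Y c) (coord c p) +
    UpsV c (coord c p) (X c (coord c p)) (Y c (coord c p)).
Proof.
move=> cp hX hY; have [G [Gl Gr GE]] := conn_local hM hD hB cp.
rewrite GE //; congr (_ + _); move: (X c _) (Y c _) => v w {X Y hX hY}.
have [f [A hf]] := hB cp.
have Gd i j : G (delta_mx 0 i) (delta_mx 0 j) =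
    UpsV c (coord c p) (delta_mx 0 i) (delta_mx 0 j).
  pose F i : field M := bfield c f (fun=> delta_mx 0 i).
  have hF i' : vector_field (F i') by apply: (vf_bfield hM hf); exact: smooth_cst.
  have nF i' : \forall y \near coord c p, F i' c y = delta_mx 0 i'.
    exact: (near_bfield hM cp hf).
  have aF i' : agree_on c A (F i') (fun=> delta_mx 0 i').
    by move=> q Aq; rewrite /F (bfield_one hM hf).
  have := hUps (bump_open hf) (hF i) (hF j) (aF i) (aF j) (bump_in hf).
  rewrite GE // UpsV_delta => <-.
  rewrite (nbhs_singleton (nF i)) (nbhs_singleton (nF j)).
  by rewrite (near_eq_derive _ (nF j)) derive_cst add0r.
rewrite UpsV_sum.
have G0l w' : G 0 w' = 0.
  by have := Gl (-1) 0 0 w'; rewrite scaler0 addr0 scaleN1r addNr.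
have G0r w' : G w' 0 = 0.
  by have := Gr (-1) 0 0 w'; rewrite scaler0 addr0 scaleN1r addNr.
have Gsl (I : Type) (r : seq I) (a : I -> R) e w' :
    G (\sum_(i <- r) a i *: e i) w' = \sum_(i <- r) a i *: G (e i) w'.
  by elim: r => [|i r IH]; rewrite ?big_nil // !big_cons Gl IH.
have Gsr (I : Type) (r : seq I) (a : I -> R) e w' :
    G w' (\sum_(i <- r) a i *: e i) = \sum_(i <- r) a i *: G w' (e i).
  by elim: r => [|i r IH]; rewrite ?big_nil // !big_cons Gr IH.
rewrite {1}[v]row_sum_delta Gsl; apply: eq_bigr => i _; congr (_ *: _).
rewrite {1}[w]row_sum_delta Gsr; apply: eq_bigr => j _; congr (_ *: _).
exact: Gd.
Qed.

(** This is the transformation law of Christoffel symbols, read off from the fact that [D X Y] is a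
    vector field for [X] and [Y] constant near [p] in the chart [c]. *)
Lemma Ups_law c c' p v w : dom c p -> dom c' p ->
  UpsV c' (coord c' p) ('D_v (trans c c') (coord c p)) ('D_w (trans c c') (coord c p))
    + 'D_v ('D_w (trans c c')) (coord c p)
  = 'D_(UpsV c (coord c p) v w) (trans c c') (coord c p).
Proof.
move=> cp c'p; set z := coord c p; have [f [A hf]] := hB cp.
have ex u : exists2 X : field M, vector_field X & \forall y \near z, X c y = u.
  exists (bfield c f (fun=> u)); first by apply: (vf_bfield hM hf); exact: smooth_cst.
  exact: (near_bfield hM cp hf).
have [X hX nX] := ex v; have [Y hY nY] := ex w.
have ov : overlap c c' z by exists p.
have Xz := nbhs_singleton nX; have Yz := nbhs_singleton nY.
have X' := hX.2 c c' p cp c'p; have Y' := hY.2 c c' p cp c'p.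
have DY : 'D_v (Y c) z = 0 by rewrite (near_eq_derive v nY) derive_cst.
have P := derive_push hM hX hY ov; rewrite (transE hM c' cp) Xz Yz DY derive0 addr0 in P.
have L := Ups_local cp hX hY; rewrite -/z Xz Yz DY add0r in L.
have L' := Ups_local c'p hX hY; rewrite P X' Y' -/z Xz Yz addrC in L'.
by rewrite -L' -L; exact: (conn_field hD hX hY).2 c c' p cp c'p.
Qed.

(** Near each point the coefficients are components of the smooth field that [D] assigns to two
    globalized basis fields. *)
Lemma Ups_smooth c i j l : smooth_on (cod c) (Ups c i j l : _ -> R^o).
Proof.
apply: smooth_local => _ [p cp <-].
have [f [A hf]] := hB cp.
pose F i : field M := bfield c f (fun=> delta_mx 0 i).
have hF i' : vector_field (F i') by apply: (vf_bfield hM hf); exact: smooth_cst.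
have aF i' : agree_on c A (F i') (fun=> delta_mx 0 i').
  by move=> q Aq; rewrite /F (bfield_one hM hf).
have H := hUps (bump_open hf) (hF i) (hF j) (aF i) (aF j).
have [oA AD] := bump_open hf.
exists (coord c @` (A `&` dom c)); first by exists p => //; split=> //; exact: bump_in hf.
apply: (@smooth_ext _ _ _ _ (fun z => D (F i) (F j) c z 0 l : R^o)).
- exact: oA.
- move=> _ [q [Aq cq] <-]; rewrite H // summxE (bigD1 l) //= !mxE !eqxx mulr1.
  rewrite big1 ?addr0 // => l' /negPf nl.
  by rewrite !mxE [l == _]eq_sym nl mulr0.
apply: smooth_coord; first exact: oA.
apply: smooth_sub (vf_smooth c (conn_field hD (hF i) (hF j))).
by move=> _ [q [_ cq] <-]; exact: cod_dom.
Qed.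

Lemma smooth_UpsV (V : normedModType R) (U : set V) c (b X Y : V -> 'rV[R]_k) :
  open U -> (forall z, U z -> cod c (b z)) -> smooth_on U b ->
  smooth_on U X -> smooth_on U Y ->
  smooth_on U (fun z => UpsV c (b z) (X z) (Y z)).
Proof.
move=> oU bU sb sX sY; apply: (smooth_row oU) => l.
apply: (smooth_sum oU) => i; apply: (smooth_sum oU) => j.
apply: (smooth_scale oU); last exact: smooth_coord.
apply: (smooth_scale oU); last exact: smooth_coord.
exact: (smooth_comp oU bU sb (@Ups_smooth c i j l)).
Qed.

End Christoffel.

(** * Frame and coframe *)

Section Frame.
Context {R : realType} {m k : nat}.
Local Notation E := (VE R m k).

Lemma findim_VE : findim (E : normedModType R). Proof. exact: _. Qed.

Definition euv (w : 'rV[R]_m) : E := (0, 0, 0, w).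
Definition eyv (w : 'rV[R]_k) : E := (0, 0, w, 0).

Lemma euv_linear : linear euv.
Proof. by move=> a u v; apply: eqE; rewrite /ct /cx /cy /cu /= ?scaler0 ?addr0. Qed.
Lemma eyv_linear : linear eyv.
Proof. by move=> a u v; apply: eqE; rewrite /ct /cx /cy /cu /= ?scaler0 ?addr0. Qed.
HB.instance Definition _ := GRing.isLinear.Build R 'rV[R]_m E _ euv euv_linear.
HB.instance Definition _ := GRing.isLinear.Build R 'rV[R]_k E _ eyv eyv_linear.
Definition euvL : {linear 'rV[R]_m -> E} := euv.
Definition eyvL : {linear 'rV[R]_k -> E} := eyv.

Lemma euv_continuous : continuous euv.
Proof.
move=> w; apply: differentiable_continuous.
by apply: differentiable_pair4 => //; exact: differentiable_cst.
Qed.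
Lemma eyv_continuous : continuous eyv.
Proof.
move=> w; apply: differentiable_continuous.
by apply: differentiable_pair4 => //; exact: differentiable_cst.
Qed.
Lemma smooth_euv (V : normedModType R) (U : set V) (f : V -> 'rV[R]_m) : open U ->
  smooth_on U f -> smooth_on U (fun z => euv (f z)).
Proof. by move=> oU; apply: (@smooth_lincomp _ _ _ oU _ _ euvL) euv_continuous. Qed.
Lemma smooth_eyv (V : normedModType R) (U : set V) (f : V -> 'rV[R]_k) : open U ->
  smooth_on U f -> smooth_on U (fun z => eyv (f z)).
Proof. by move=> oU; apply: (@smooth_lincomp _ _ _ oU _ _ eyvL) eyv_continuous. Qed.
Lemma D_euv (V : normedModType R) (f : V -> 'rV[R]_m) x v : differentiable f x ->
  'D_v (fun y => euv (f y)) x = euv ('D_v f x).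
Proof. exact: (@derive_lincomp _ _ _ _ euvL f x v euv_continuous). Qed.
Lemma D_eyv (V : normedModType R) (f : V -> 'rV[R]_k) x v : differentiable f x ->
  'D_v (fun y => eyv (f y)) x = eyv ('D_v f x).
Proof. exact: (@derive_lincomp _ _ _ _ eyvL f x v eyv_continuous). Qed.

(* [th] is the coframe component theta; [fr pi kap G] is eta for
   (pi, kap, G) = (cy, 1, Psi) and tilde psi for (cu, 1/2, F). *)
Definition th (z v : E) : 'rV[R]_m := cx v - ct v *: cu z.

Definition fr (W : normedModType R) (pi : E -> W) (kap : R) (G : E -> W) (z v : E) : W :=
  pi v - ct v *: G z - kap *: 'D_(euv (th z v)) G z.

(** [dth v y] and [dfr kap G z v y] differentiate the coframe coefficients along [v] with the
    argument [y] held fixed. Antisymmetrized in [v] and [y] they are the exterior derivatives of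
    theta, eta and psi. *)
Definition dth (v y : E) : 'rV[R]_m := - (ct y *: cu v).

Definition dfr (W : normedModType R) (kap : R) (G : E -> W) (z v y : E) : W :=
  - (ct y *: 'D_v G z) - kap *: 'D_v ('D_(euv (th z y)) G) z
  + kap *: (ct y *: 'D_(euv (cu v)) G z).

Lemma th_linear z : linear (th z).
Proof.
move=> a u v; rewrite /th !linearP /= scalerDl scalerBr -scalerA.
by rewrite opprD addrACA.
Qed.
HB.instance Definition _ z := GRing.isLinear.Build R E 'rV[R]_m _ (th z) (th_linear z).

Lemma smooth_th (U : set E) (Y : E -> E) : open U -> smooth_on U Y ->
  smooth_on U (fun z => th z (Y z)).
Proof.
move=> oU sY; apply: (smooth_subf oU).
  by apply: (@smooth_lincomp _ _ _ oU _ _ (@cxL R m k)) => //; exact: cx_continuous.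
apply: (smooth_scale oU); last exact: smooth_cu.
by apply: (@smooth_lincomp _ _ _ oU _ _ (@ctL R m k)) => //; exact: ct_continuous.
Qed.

Lemma D_th (Y : E -> E) z v : differentiable Y z ->
  'D_v (fun w => th w (Y w)) z = dth v (Y z) + th z ('D_v Y z).
Proof.
move=> dY.
have dct : differentiable (fun w => ct (Y w) : R^o) z.
  exact: (differentiable_comp dY (diff_ct _)).
have dcx : differentiable (fun w => cx (Y w)) z.
  exact: (differentiable_comp dY (diff_cx _)).
have dsc : differentiable (fun w => ct (Y w) *: cu w) z.
  exact: differentiable_scale dct (diff_cu z).
rewrite (derive_subf v dcx dsc) (derive_scale v dct (diff_cu z)).
rewrite (D_ct v dY) (D_cx v dY) Dlin_cu /dth /th.
by rewrite opprD [RHS]addrC -addrA.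
Qed.

Section General.
Variables (n : nat) (pi : {linear E -> 'rV[R]_n}) (kap : R).
Variables (G : E -> 'rV[R]_n) (U : set E).
Hypotheses (cpi : continuous pi) (oU : open U) (sG : smooth_on U G).

Lemma D_id_smooth : smooth_on U (fun z : E => z).
Proof. by apply: (@smooth_lin _ _ _ _ idfun) => x; exact: cvg_id. Qed.

Lemma smooth_dirU (Z : normedModType R) (f : E -> Z) (Y : E -> E) :
  smooth_on U f -> smooth_on U Y -> smooth_on U (fun z => 'D_(Y z) f z).
Proof. by move=> sf sY; apply: (smooth_dir oU (fun x h => h) sY D_id_smooth sf). Qed.

Lemma smooth_fr (Y : E -> E) : smooth_on U Y ->
  smooth_on U (fun z => fr pi kap G z (Y z)).
Proof.
move=> sY; apply: (smooth_subf oU); first apply: (smooth_subf oU).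
- exact: (@smooth_lincomp _ _ _ oU _ _ pi).
- apply: (smooth_scale oU) => //.
  by apply: (@smooth_lincomp _ _ _ oU _ _ (@ctL R m k)) => //; exact: ct_continuous.
apply: (smooth_scale oU); first exact: smooth_cst.
by apply: smooth_dirU => //; apply: smooth_euv => //; exact: smooth_th.
Qed.

Lemma D_fr (Y : E -> E) z v : U z -> smooth_on U Y ->
  'D_v (fun w => fr pi kap G w (Y w)) z = dfr kap G z v (Y z) + fr pi kap G z ('D_v Y z).
Proof.
move=> Uz sY; have dY := smooth_diff sY Uz; have dG := smooth_diff sG Uz.
have dct : differentiable (fun w => ct (Y w) : R^o) z.
  exact: (differentiable_comp dY (diff_ct _)).
have dpi : differentiable (fun w => pi (Y w)) z.
  have dpiY : differentiable pi (Y z) by exact: linear_differentiable.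
  exact: (differentiable_comp dY dpiY).
have dsc : differentiable (fun w => ct (Y w) *: G w) z.
  exact: differentiable_scale dct dG.
have dth' : differentiable (fun w => euv (th w (Y w))) z.
  by apply: smooth_diff Uz; apply: smooth_euv => //; exact: smooth_th.
have ddir : differentiable (fun w => 'D_(euv (th w (Y w))) G w) z.
  by apply: smooth_diff Uz; apply: smooth_dirU => //; apply: smooth_euv => //; exact: smooth_th.
have dkd : differentiable (fun w => kap *: 'D_(euv (th w (Y w))) G w) z.
  exact: (differentiable_scale (differentiable_cst (kap : R^o) z) ddir).
have dthz : differentiable (fun w => th w (Y w)) z.
  by apply: smooth_diff Uz; exact: smooth_th.
have e1 : 'D_v (fun w => kap *: 'D_(euv (th w (Y w))) G w) z =
    kap *: ('D_v ('D_(euv (th z (Y z))) G) z - ct (Y z) *: 'D_(euv (cu v)) G z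
            + 'D_(euv (th z ('D_v Y z))) G z).
  rewrite (derive_scale (k := fun=> kap : R^o) v (differentiable_cst (kap : R^o) z) ddir).
  rewrite derive_cst scale0r add0r; congr (_ *: _).
  have did : differentiable (fun w : E => w) z by exact: smooth_diff D_id_smooth Uz.
  (* The direction itself depends on the base point through [th]; its [dth] part produces the last
     term of [dfr]. *)
  have H : 'D_v (fun w => 'D_(euv (th w (Y w))) G w) z =
      'D_('D_v (fun w : E => w) z) ('D_(euv (th z (Y z))) G) z +
      'D_('D_v (fun w => euv (th w (Y w))) z) G z.
    exact: (derive_dir (hW := findim_VE) v oU Uz sG did dth').
  have e2 : 'D_v (fun w : E => w) z = v by exact: derive_id.
  have e3 : 'D_v (fun w => euv (th w (Y w))) z =
      - (ct (Y z) *: euv (cu v)) + euv (th z ('D_v Y z)).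
    by rewrite (D_euv v dthz) (D_th v dY) /dth linearD linearN linearZ.
  rewrite e2 e3 (derive_dirD _ _ dG) (derive_dirN _ dG) (derive_dirZ _ _ dG) addrA in H.
  exact: H.
have e0 : 'D_v (fun w => pi (Y w) - ct (Y w) *: G w) z =
    pi ('D_v Y z) - (ct ('D_v Y z) *: G z + ct (Y z) *: 'D_v G z).
  rewrite (derive_subf v dpi dsc) (derive_scale v dct dG) (D_ct v dY).
  by rewrite (derive_lincomp v cpi dY).
have dps : differentiable (fun w => pi (Y w) - ct (Y w) *: G w) z.
  exact: differentiableB.
rewrite (derive_subf v dps dkd) e0 e1 /dfr /fr.
move: ('D_v ('D_(euv _) G) z) ('D_v G z) ('D_(euv (cu v)) G z) ('D_(euv _) G z) (pi _) (ct _ *: G z).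
move=> a b c d p g; move: (ct (Y z)) => t.
apply/rowP => i; rewrite !mxE; ring.
Qed.

End General.
End Frame.

(** * The frame, coframe and tensors of the system as linear maps *)

Section SystemFrame.
Context {R : realType} {m k : nat}.
Context {M1 : charted 'rV[R]_m} {M2 : charted 'rV[R]_k} (s : csys M1 M2).
Local Notation E := (Etilde s).
Local Notation VE := (VE R m k).
Local Notation tG := (@tGamma R m k M1 M2 s).
Implicit Types (c : chart E) (z v : VE) (X Y : field E).

Definition Gam c z (w : 'rV[R]_m) : 'rV[R]_m := \row_b \sum_a w 0 a * GamT s c a b z.
Definition Psi c z (w : 'rV[R]_m) : 'rV[R]_k := \row_i \sum_a w 0 a * PsiT s c a i z.

Lemma Gam_linear c z : linear (Gam c z).
Proof.
move=> a u v; apply/rowP => i; rewrite !mxE mulr_sumr -big_split /=.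
by apply: eq_bigr => b _; rewrite !mxE mulrDl mulrA.
Qed.
Lemma Psi_linear c z : linear (Psi c z).
Proof.
move=> a u v; apply/rowP => i; rewrite !mxE mulr_sumr -big_split /=.
by apply: eq_bigr => b _; rewrite !mxE mulrDl mulrA.
Qed.
HB.instance Definition _ c z := GRing.isLinear.Build R 'rV[R]_m 'rV[R]_m _ (Gam c z) (Gam_linear c z).
HB.instance Definition _ c z := GRing.isLinear.Build R 'rV[R]_m 'rV[R]_k _ (Psi c z) (Psi_linear c z).

Definition et c z v : 'rV[R]_k := cy v - ct v *: cPsi s c z + Psi c z (th z v).
Definition ps c z v : 'rV[R]_m := cu v - ct v *: cF s c z + Gam c z (th z v).

Lemma et_linear c z : linear (et c z).
Proof.
move=> a u v; rewrite /et !linearP /= scalerDl -scalerA.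
move: (Psi c z _) (Psi c z _) (cy u) (cy v) (cPsi s c z) => p q a1 a2 g.
by apply/rowP => i; rewrite !mxE; ring.
Qed.
Lemma ps_linear c z : linear (ps c z).
Proof.
move=> a u v; rewrite /ps !linearP /= scalerDl -scalerA.
move: (Gam c z _) (Gam c z _) (cu u) (cu v) (cF s c z) => p q a1 a2 g.
by apply/rowP => i; rewrite !mxE; ring.
Qed.
HB.instance Definition _ c z := GRing.isLinear.Build R VE 'rV[R]_k _ (et c z) (et_linear c z).
HB.instance Definition _ c z := GRing.isLinear.Build R VE 'rV[R]_m _ (ps c z) (ps_linear c z).

Definition Hv c z (w : 'rV[R]_m) : VE := (0, w, - Psi c z w, - Gam c z w).

Lemma Gam0 c z : Gam c z 0 = 0. Proof. exact: linear0. Qed.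
Lemma Psi0 c z : Psi c z 0 = 0. Proof. exact: linear0. Qed.

Lemma ctG c z : ct (tG c z) = 1. Proof. by []. Qed.
Lemma ctY (y : 'rV[R]_k) : ct (eyv y : VE) = 0. Proof. by []. Qed.
Lemma ctU (w : 'rV[R]_m) : ct (euv w : VE) = 0. Proof. by []. Qed.
Lemma ctH c z w : ct (Hv c z w) = 0. Proof. by []. Qed.
Lemma thG c z : th z (tG c z) = 0.
Proof. by rewrite /th ctG scale1r; exact: subrr. Qed.
Lemma thY z (y : 'rV[R]_k) : th z (eyv y) = 0.
Proof. by rewrite /th ctY scale0r subr0. Qed.
Lemma thU z (w : 'rV[R]_m) : th z (euv w : VE) = 0.
Proof. by rewrite /th ctU scale0r subr0. Qed.
Lemma thH c z w : th z (Hv c z w) = w.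
Proof. by rewrite /th ctH scale0r subr0. Qed.
Lemma etG c z : et c z (tG c z) = 0.
Proof. by rewrite /et thG ctG scale1r Psi0 addr0; exact: subrr. Qed.
Lemma etY c z (y : 'rV[R]_k) : et c z (eyv y) = y.
Proof. by rewrite /et thY ctY scale0r Psi0 addr0 subr0. Qed.
Lemma etU c z (w : 'rV[R]_m) : et c z (euv w) = 0.
Proof. by rewrite /et thU ctU scale0r Psi0 addr0 subr0. Qed.
Lemma etH c z w : et c z (Hv c z w) = 0.
Proof. by rewrite /et thH ctH scale0r subr0; exact: addNr. Qed.
Lemma psG c z : ps c z (tG c z) = 0.
Proof. by rewrite /ps thG ctG scale1r Gam0 addr0; exact: subrr. Qed.
Lemma psY c z (y : 'rV[R]_k) : ps c z (eyv y) = 0.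
Proof. by rewrite /ps thY ctY scale0r Gam0 addr0 subr0. Qed.
Lemma psU c z (w : 'rV[R]_m) : ps c z (euv w) = w.
Proof. by rewrite /ps thU ctU scale0r Gam0 addr0 subr0. Qed.
Lemma psH c z w : ps c z (Hv c z w) = 0.
Proof. by rewrite /ps thH ctH scale0r subr0; exact: addNr. Qed.

Lemma thD z (u v : VE) : th z (u + v) = th z u + th z v. Proof. exact: linearD. Qed.
Lemma thZ z (r : R) (u : VE) : th z (r *: u) = r *: th z u. Proof. exact: linearZ. Qed.
Lemma thB z (u v : VE) : th z (u - v) = th z u - th z v. Proof. by rewrite -(scaleN1r v) thD thZ scaleN1r. Qed.
Lemma th0 z : th z 0 = 0. Proof. exact: linear0. Qed.
Lemma etD c z (u v : VE) : et c z (u + v) = et c z u + et c z v. Proof. exact: linearD. Qed.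
Lemma etZ c z (r : R) (u : VE) : et c z (r *: u) = r *: et c z u. Proof. exact: linearZ. Qed.
Lemma etB c z (u v : VE) : et c z (u - v) = et c z u - et c z v. Proof. by rewrite -(scaleN1r v) etD etZ scaleN1r. Qed.
Lemma et0 c z : et c z 0 = 0. Proof. exact: linear0. Qed.
Lemma psD c z (u v : VE) : ps c z (u + v) = ps c z u + ps c z v. Proof. exact: linearD. Qed.
Lemma psZ c z (r : R) (u : VE) : ps c z (r *: u) = r *: ps c z u. Proof. exact: linearZ. Qed.
Lemma psB c z (u v : VE) : ps c z (u - v) = ps c z u - ps c z v. Proof. by rewrite -(scaleN1r v) psD psZ scaleN1r. Qed.
Lemma ps0 c z : ps c z 0 = 0. Proof. exact: linear0. Qed.
Lemma ctD (u v : VE) : ct (u + v : VE) = ct u + ct v. Proof. by []. Qed.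
Lemma ctB (u v : VE) : ct (u - v : VE) = ct u - ct v. Proof. by []. Qed.
Lemma ctZ (r : R) (u : VE) : ct (r *: u : VE) = r * ct u. Proof. by []. Qed.
Lemma ct0 : ct (0 : VE) = 0. Proof. by []. Qed.

(** Most identities between tangent vectors below are proved by comparing the four coframe
    components. Equal [ct] and [th] make the corrections in [et] and [ps] equal, after which the
    remaining coordinates can be read off. *)
Lemma frame_inj c z v w : ct v = ct w -> th z v = th z w -> et c z v = et c z w ->
  ps c z v = ps c z w -> v = w.
Proof.
move=> e1 e2; rewrite /et /ps e1 e2 => /addIr /addIr e3 /addIr /addIr e4.
by apply: eqE => //; move: e2; rewrite /th e1 => /addIr.
Qed.

Lemma frame_dec c z v :
  v = ct v *: tG c z + eyv (et c z v) + Hv c z (th z v) + euv (ps c z v).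
Proof.
apply: (@frame_inj c z).
- by rewrite -[RHS]/(ct v * 1 + 0 + 0 + 0) mulr1 !addr0.
- rewrite !thD thZ thG thY thU thH.
  by rewrite scaler0 !add0r addr0.
- rewrite !etD etZ etG etY etU etH.
  by rewrite scaler0 add0r !addr0.
- rewrite !psD psZ psG psY psU psH.
  by rewrite scaler0 !add0r.
Qed.

Lemma thetaE (a : 'I_m) z v : theta a z v = th z v 0 a.
Proof. by rewrite /theta /th !mxE mulrC. Qed.
Lemma etaE c i z v : eta s c i z v = et c z v 0 i.
Proof.
rewrite /eta /et !mxE [_ * ct v]mulrC; congr (_ + _).
by apply: eq_bigr => b _; rewrite thetaE mulrC.
Qed.
Lemma psiE c a z v : psi s c a z v = ps c z v 0 a.
Proof.
rewrite /psi /ps !mxE [_ * ct v]mulrC; congr (_ + _).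
by apply: eq_bigr => b _; rewrite thetaE mulrC.
Qed.

Lemma euv_sum (w : 'rV[R]_m) : euv w = \sum_a w 0 a *: (e_u a : VE).
Proof.
have E : @euvL R m k w = \sum_a w 0 a *: @euvL R m k (delta_mx 0 a).
  rewrite {1}[w]row_sum_delta linear_sum; apply: eq_bigr => a _; exact: linearZ.
exact: E.
Qed.
Lemma eyv_sum (w : 'rV[R]_k) : eyv w = \sum_i w 0 i *: (e_y i : VE).
Proof.
have E : @eyvL R m k w = \sum_a w 0 a *: @eyvL R m k (delta_mx 0 a).
  rewrite {1}[w]row_sum_delta linear_sum; apply: eq_bigr => a _; exact: linearZ.
exact: E.
Qed.
Lemma Hv_linear c z : linear (Hv c z).
Proof.
move=> a u v; apply: eqE; rewrite /ct /cx /cy /cu /= ?scaler0 ?addr0 //.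
  by rewrite linearP opprD scalerN.
by rewrite linearP opprD scalerN.
Qed.
HB.instance Definition _ c z := GRing.isLinear.Build R 'rV[R]_m VE _ (Hv c z) (Hv_linear c z).

Lemma HvD c z (u v : 'rV[R]_m) : Hv c z (u + v) = Hv c z u + Hv c z v. Proof. exact: linearD. Qed.
Lemma HvZ c z (r : R) (u : 'rV[R]_m) : Hv c z (r *: u) = r *: Hv c z u. Proof. exact: linearZ. Qed.
Lemma Hv0 c z : Hv c z 0 = 0. Proof. exact: linear0. Qed.

Definition HvL c z : {linear 'rV[R]_m -> VE} := Hv c z.

Lemma HfrE c a z : Hfr s c a z = Hv c z (delta_mx 0 a).
Proof.
rewrite /Hfr -[\sum_b _ *: e_u b](_ : euv (\row_b GamT s c a b z) = _); last first.
  by rewrite euv_sum; apply: eq_bigr => b _; rewrite mxE.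
rewrite -[\sum_i _ *: e_y i](_ : eyv (\row_i PsiT s c a i z) = _); last first.
  by rewrite eyv_sum; apply: eq_bigr => b _; rewrite mxE.
have D (n : nat) (f : 'I_m -> R) : \sum_a0 (delta_mx 0 a : 'rV[R]_m) 0 a0 * f a0 = f a.
  rewrite (bigD1 a) //= mxE !eqxx mul1r big1 ?addr0 // => b /negPf nb.
  by rewrite mxE nb andbF mul0r.
apply: eqE; rewrite /e_x /Hv /ct /cx /cy /cu /= ?subr0 //.
- rewrite sub0r; congr (- _); apply/rowP => i; rewrite !mxE.
  by rewrite (D k).
- rewrite sub0r; congr (- _); apply/rowP => i; rewrite !mxE.
  by rewrite (D m).
Qed.

Lemma Hv_sum c z (w : 'rV[R]_m) : \sum_a w 0 a *: Hfr s c a z = Hv c z w.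
Proof.
have E : HvL c z w = \sum_a w 0 a *: HvL c z (delta_mx 0 a).
  rewrite {1}[w]row_sum_delta linear_sum; apply: eq_bigr => a _; exact: linearZ.
by rewrite -[RHS]/(HvL c z w) E; apply: eq_bigr => a _; rewrite HfrE.
Qed.

Lemma PNE X : PN X = fun c z => eyv (et c z (X c z)).
Proof.
apply/funext => c; apply/funext => z; rewrite eyv_sum; apply: eq_bigr => i _.
by rewrite etaE.
Qed.
Lemma PVE X : PV X = fun c z => euv (ps c z (X c z)).
Proof.
apply/funext => c; apply/funext => z; rewrite euv_sum; apply: eq_bigr => i _.
by rewrite psiE.
Qed.
Lemma PHE X : PH X = fun c z => Hv c z (th z (X c z)).
Proof.
apply/funext => c; apply/funext => z; rewrite -Hv_sum; apply: eq_bigr => i _.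
by rewrite thetaE.
Qed.
Lemma tSE X : tS X = fun c z => euv (th z (X c z)).
Proof.
apply/funext => c; apply/funext => z; rewrite euv_sum; apply: eq_bigr => i _.
by rewrite thetaE.
Qed.
Lemma tQE X : tQ X = fun c z => Hv c z (ps c z (X c z)).
Proof.
apply/funext => c; apply/funext => z; rewrite -Hv_sum; apply: eq_bigr => i _.
by rewrite psiE.
Qed.

End SystemFrame.

Lemma lin0 (R : realType) (U W : lmodType R) (f : U -> W) :
  (forall a u v, f (a *: u + v) = a *: f u + f v) -> f 0 = 0.
Proof.
move=> fl; have := fl (-1) 0 0.
by rewrite scaler0 addr0 scaleN1r addNr.
Qed.

Lemma lin0_delta (R : realType) n (W : lmodType R) (f : 'rV[R]_n -> W) :
  (forall a u v, f (a *: u + v) = a *: f u + f v) ->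
  (forall i, f (delta_mx 0 i) = 0) -> forall u, f u = 0.
Proof.
move=> fl fd u; rewrite (row_sum_delta u).
elim/big_rec: _ => [|i x _ IH]; first exact: lin0.
by rewrite fl fd IH scaler0 addr0.
Qed.

(** The local form sees [Y] only through its germ. This permits replacing an inner covariant
    derivative under an outer one when curvatures are compared. *)
Lemma conn_near (R : realType) (V : normedModType R) (hV : findim V) (M : charted V)
    (D : field M -> field M -> field M) (c : chart M) (p : pt M) (X Y Y' : field M) :
  premanifold M -> has_bumps M -> linear_connection D -> dom c p ->
  vector_field X -> vector_field Y -> vector_field Y' ->
  (\forall w \near coord c p, Y c w = Y' c w) ->
  D X Y c (coord c p) = D X Y' c (coord c p).
Proof.
move=> hM hB hD cp hX hY hY' N; have [G [_ _ GE]] := conn_local hM hD hB cp.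
rewrite (GE _ _ hX hY) (GE _ _ hX hY') (nbhs_singleton N).
by apply: (f_equal (fun x => x + _)); exact: near_eq_derive.
Qed.

Lemma diff_tensor (R : realType) (V : normedModType R) (hV : findim V) (M : charted V)
    (D D' : field M -> field M -> field M) (c : chart M) (p : pt M) :
  premanifold M -> has_bumps M -> linear_connection D -> linear_connection D' -> dom c p ->
  exists A : V -> V -> V,
    [/\ forall a u v w, A (a *: u + v) w = a *: A u w + A v w,
        forall a u v w, A w (a *: u + v) = a *: A w u + A w v
      & forall X Y, vector_field X -> vector_field Y ->
          D X Y c (coord c p) = D' X Y c (coord c p) + A (X c (coord c p)) (Y c (coord c p))].
Proof.
move=> hM hB hD hD' cp.
have [G [Gl Gr GE]] := conn_local hM hD hB cp.
have [G' [Gl' Gr' GE']] := conn_local hM hD' hB cp.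
have alg (a : R) (x y x' y' : V) : a *: x + y - (a *: x' + y') = a *: (x - x') + (y - y').
  by rewrite scalerBr opprD addrACA.
exists (fun v w => G v w - G' v w); split.
- by move=> a u v w; rewrite Gl Gl'; exact: alg.
- by move=> a u v w; rewrite Gr Gr'; exact: alg.
- move=> X Y hX hY; rewrite (GE _ _ hX hY) (GE' _ _ hX hY).
  have alg2 (x y y' : V) : x + y = x + y' + (y - y') by rewrite -addrA [y' + _]addrC subrK.
  exact: alg2.
Qed.

(** * Smoothness of the coframe and coframe components of brackets *)

Section CharacterizedConnection.
Context {R : realType} {m k : nat}.
Context {M1 : charted 'rV[R]_m} {M2 : charted 'rV[R]_k} {s : csys M1 M2}.
Hypotheses (h1 : premanifold M1) (h2 : premanifold M2) (hs : constrained_system s).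
Hypotheses (b1 : has_bumps M1) (b2 : has_bumps M2).
Variable D2 : field M2 -> field M2 -> field M2.
Hypothesis hD2 : linear_connection D2.
Variable Ups : chart M2 -> 'I_k -> 'I_k -> 'I_k -> 'rV[R]_k -> R.
Hypothesis hUps : has_coefficients D2 Ups.
Local Notation E := (Etilde s).
Local Notation VE := (VE R m k).
Local Notation tG := (@tGamma R m k M1 M2 s).
Local Notation nab := (@tnabla R m k M1 M2 s Ups).
Implicit Types (c : chart E) (z v y : VE) (X Y Z : field E).

Let hE : premanifold E. Proof. exact: E_premanifold. Qed.
Let oE c : open (cod c). Proof. exact: open_cod hE c. Qed.
Let bE : has_bumps E. Proof. exact: E_bumps. Qed.

Lemma smF c : smooth_on (cod c) (cF s c).
Proof. by apply: smooth_sub (cF_smooth hs c) => z /(codE h1 h2 hs). Qed.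
Lemma smPsi c : smooth_on (cod c) (cPsi s c).
Proof. by apply: smooth_sub (cPsi_smooth hs c) => z /(codE h1 h2 hs). Qed.

Lemma PsiD c z w : cod c z -> Psi c z w = - 'D_(euv w) (cPsi s c) z.
Proof.
move=> cz; have dP := smooth_diff (smPsi c) cz.
have -> : 'D_(euv w) (cPsi s c) z = \sum_a w 0 a *: 'D_(e_u a) (cPsi s c) z.
  by rewrite euv_sum (derive_dir_sum _ _ dP).
apply/rowP => i; rewrite !mxE summxE -sumrN; apply: eq_bigr => a _.
by rewrite !mxE /PsiT (D_coord _ _ dP) mulrN.
Qed.

Lemma GamD c z w : cod c z -> Gam c z w = - 2^-1 *: 'D_(euv w) (cF s c) z.
Proof.
move=> cz; have dP := smooth_diff (smF c) cz.
have -> : 'D_(euv w) (cF s c) z = \sum_a w 0 a *: 'D_(e_u a) (cF s c) z.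
  by rewrite euv_sum (derive_dir_sum _ _ dP).
apply/rowP => i; rewrite !mxE summxE mulr_sumr; apply: eq_bigr => a _.
by rewrite !mxE /GamT (D_coord _ _ dP) mulrCA.
Qed.

(** With the sum over the frame index collected into one directional derivative, [et] and [ps]
    become instances of [fr], and one calculus serves both. *)
Lemma etfr c z v : cod c z -> et c z v = fr (@cyL R m k) 1 (cPsi s c) z v.
Proof. by move=> cz; rewrite /et /fr scale1r (PsiD _ cz). Qed.
Lemma psfr c z v : cod c z -> ps c z v = fr (@cuL R m k) 2^-1 (cF s c) z v.
Proof. by move=> cz; rewrite /ps /fr (GamD _ cz) scaleNr. Qed.

Section Smooth.
Variables (c : chart E) (Y : VE -> VE).
Hypothesis sY : smooth_on (cod c) Y.
Lemma sm_ct : smooth_on (cod c) (fun z => ct (Y z) : R^o).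
Proof. exact: (@smooth_lincomp _ _ _ (@oE c) _ _ (@ctL R m k) Y (@ct_continuous R m k) sY). Qed.
Lemma sm_th : smooth_on (cod c) (fun z => th z (Y z)).
Proof. exact: (smooth_th (@oE c) sY). Qed.
Lemma sm_et : smooth_on (cod c) (fun z => et c z (Y z)).
Proof.
apply: (smooth_ext (@oE c) _ (smooth_fr (pi := @cyL R m k) 1 (@cy_continuous R m k) (@oE c) (smPsi c) sY)).
by move=> z cz; rewrite etfr.
Qed.
Lemma sm_ps : smooth_on (cod c) (fun z => ps c z (Y z)).
Proof.
apply: (smooth_ext (@oE c) _ (smooth_fr (pi := @cuL R m k) 2^-1 (@cu_continuous R m k) (@oE c) (smF c) sY)).
by move=> z cz; rewrite psfr.
Qed.
Lemma D_et z v : cod c z ->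
  'D_v (fun w => et c w (Y w)) z = dfr 1 (cPsi s c) z v (Y z) + et c z ('D_v Y z).
Proof.
move=> cz; rewrite (etfr _ cz).
rewrite -(D_fr (pi := @cyL R m k) 1 (@cy_continuous R m k) (@oE c) (smPsi c) v cz sY).
apply: near_eq_derive; apply: filterS (near_cod hE cz) => w cw; exact: etfr.
Qed.
Lemma D_ps z v : cod c z ->
  'D_v (fun w => ps c w (Y w)) z = dfr 2^-1 (cF s c) z v (Y z) + ps c z ('D_v Y z).
Proof.
move=> cz; rewrite (psfr _ cz).
rewrite -(D_fr (pi := @cuL R m k) 2^-1 (@cu_continuous R m k) (@oE c) (smF c) v cz sY).
apply: near_eq_derive; apply: filterS (near_cod hE cz) => w cw; exact: psfr.
Qed.
End Smooth.

Lemma sm_Gam c (w : VE -> 'rV[R]_m) : smooth_on (cod c) w ->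
  smooth_on (cod c) (fun z => Gam c z (w z)).
Proof.
move=> sw; have sd := smooth_dirU (@oE c) (smF c) (smooth_euv (k := k) (@oE c) sw).
apply: (smooth_ext (@oE c) _ (smooth_scale (@oE c) (smooth_cst (cod c) (- 2^-1 : R^o)) sd)).
by move=> z cz; rewrite GamD.
Qed.
Lemma sm_Psi c (w : VE -> 'rV[R]_m) : smooth_on (cod c) w ->
  smooth_on (cod c) (fun z => Psi c z (w z)).
Proof.
move=> sw; have sd := smooth_dirU (@oE c) (smPsi c) (smooth_euv (k := k) (@oE c) sw).
by apply: (smooth_ext (@oE c) _ (smooth_opp (@oE c) sd)) => z cz; rewrite PsiD.
Qed.
Lemma sm_Hv c (w : VE -> 'rV[R]_m) : smooth_on (cod c) w ->
  smooth_on (cod c) (fun z => Hv c z (w z)).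
Proof.
move=> sw; apply: smooth_pair4 => //.
- exact: smooth_cst.
- exact: (smooth_opp (@oE c) (sm_Psi sw)).
- exact: (smooth_opp (@oE c) (sm_Gam sw)).
Qed.

Lemma br_alg n (a b d e : 'rV[R]_n) : a - b = d + a - (e + b) - (d - e).
Proof. by apply/rowP => i; rewrite !mxE; ring. Qed.

Section Bracket.
Variables (X Y : field E) (c : chart E) (z : VE).
Hypotheses (sX : smooth_on (cod c) (X c)) (sY : smooth_on (cod c) (Y c)) (cz : cod c z).
Let dX : differentiable (X c) z. Proof. exact: smooth_diff sX cz. Qed.
Let dY : differentiable (Y c) z. Proof. exact: smooth_diff sY cz. Qed.

Lemma ct_br : ct (bracket X Y c z) =
  'D_(X c z) (fun w => ct (Y c w)) z - 'D_(Y c z) (fun w => ct (X c w)) z.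
Proof. by rewrite /bracket ctB (D_ct _ dX) (D_ct _ dY). Qed.

(** Cartan's formula: theta of a bracket is X(theta(Y)) - Y(theta(X)) - d theta(X, Y). The formulas
    for [et] and [ps] have the same form; in [ct_br] the last term is absent because dt is
    closed. *)
Lemma th_br : th z (bracket X Y c z) =
  'D_(X c z) (fun w => th w (Y c w)) z - 'D_(Y c z) (fun w => th w (X c w)) z
  - (dth (X c z) (Y c z) - dth (Y c z) (X c z)).
Proof.
rewrite /bracket thB (D_th _ dX) (D_th _ dY).
exact: br_alg.
Qed.

Lemma et_br : et c z (bracket X Y c z) =
  'D_(X c z) (fun w => et c w (Y c w)) z - 'D_(Y c z) (fun w => et c w (X c w)) z
  - (dfr 1 (cPsi s c) z (X c z) (Y c z) - dfr 1 (cPsi s c) z (Y c z) (X c z)).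
Proof.
rewrite /bracket etB (D_et sX _ cz) (D_et sY _ cz).
exact: br_alg.
Qed.

Lemma ps_br : ps c z (bracket X Y c z) =
  'D_(X c z) (fun w => ps c w (Y c w)) z - 'D_(Y c z) (fun w => ps c w (X c w)) z
  - (dfr 2^-1 (cF s c) z (X c z) (Y c z) - dfr 2^-1 (cF s c) z (Y c z) (X c z)).
Proof.
rewrite /bracket psB (D_ps sX _ cz) (D_ps sY _ cz).
exact: br_alg.
Qed.
End Bracket.

Lemma derive_fun0 (V W : normedModType R) (f : V -> W) (z v : V) :
  (forall w, f w = 0) -> 'D_v f z = 0.
Proof.
move=> f0; have -> : f = fun=> 0 by apply/funext.
exact: derive_cst.
Qed.

Lemma dfr_th0 n kap (G : VE -> 'rV[R]_n) z v y : th z y = 0 ->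
  dfr kap G z v y = - (ct y *: 'D_v G z) + kap *: (ct y *: 'D_(euv (cu v)) G z).
Proof.
move=> y0; rewrite /dfr y0 (linear0 (@euvL R m k)) (derive_fun0 (f := 'D_0 G)) ?scaler0 ?subr0 //.
by move=> w; exact: derive0.
Qed.

(** * Naturality of the tensors *)

Section Transition.
Variables (c c' : chart E) (z : VE).
Hypothesis oz : overlap c c' z.
Let d1 : differentiable (trans c.1 c'.1) (cx z).
Proof. by apply: smooth_diff (pm_trans h1 _ _) _; have [] := (E_overlap h1 h2 hs c c' z).1 oz. Qed.

Lemma th_trans v : th (trans c c' z) ('D_v (trans c c') z) =
  'D_(th z v) (trans c.1 c'.1) (cx z).
Proof.
rewrite (E_trans h1 h2 hs oz) (D_etrans h1 h2 hs v oz) /th.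
by rewrite (derive_dirB _ _ d1) (derive_dirZ _ _ d1).
Qed.

Lemma euv_trans w : 'D_(euv w) (trans c c') z = euv ('D_w (trans c.1 c'.1) (cx z)).
Proof.
rewrite (D_etrans h1 h2 hs _ oz) /euv /ct /cx /cy /cu /= !derive0 add0r //.
Qed.

Lemma eyv_trans w : 'D_(eyv w) (trans c c') z = eyv ('D_w (trans c.2 c'.2) (cy z)).
Proof.
rewrite (D_etrans h1 h2 hs _ oz) /eyv /ct /cx /cy /cu /= !derive0 addr0 //.
Qed.

Lemma ct_trans v : ct ('D_v (trans c c') z) = ct v.
Proof. by rewrite (D_etrans h1 h2 hs _ oz). Qed.

End Transition.

Lemma cuG c z : cu (tG c z) = cF s c z. Proof. by []. Qed.
Lemma cuU (w : 'rV[R]_m) : cu (euv w : VE) = w. Proof. by []. Qed.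
Lemma cyY (w : 'rV[R]_k) : cy (eyv w : VE) = w. Proof. by []. Qed.
Local Opaque euv eyv Hv tGamma bracket.

Lemma natural X : (forall c, smooth_on (cod c) (X c)) ->
  (forall c c' z, overlap c c' z -> X c' (trans c c' z) = 'D_(X c z) (trans c c') z) ->
  vector_field X.
Proof.
move=> sX nX; split=> // c c' p cp c'p.
by rewrite -(transE hE c' cp); apply: nX; exists p.
Qed.

Lemma vf_tG : vector_field tG. Proof. exact: tGamma_field hs. Qed.

Lemma vf_tS X : vector_field X -> vector_field (tS X).
Proof.
move=> hX; rewrite tSE; apply: natural => [c|c c' z oz].
  by apply: smooth_euv => //; apply: sm_th; exact: vf_smooth.
by rewrite (vf_trans hE hX oz) (th_trans oz) (euv_trans oz).
Qed.

Lemma vf_PG X : vector_field X -> vector_field (PG X).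
Proof.
move=> hX; apply: natural => [c|c c' z oz].
  by apply: (smooth_scale (@oE c)); [apply: sm_ct; exact: vf_smooth|exact: vf_smooth vf_tG].
rewrite /PG (vf_trans hE hX oz) (vf_trans hE vf_tG oz) (ct_trans oz).
rewrite derive_dirZ //; apply: smooth_diff oz; exact: pm_trans hE c c'.
Qed.

Lemma dfr_alg0 n (kap : R) (a b : 'rV[R]_n) :
  - ((0 : R^o) *: a) + kap *: ((0 : R^o) *: b) = 0.
Proof. by rewrite !scale0r scaler0 oppr0 addr0. Qed.
Lemma dfr_alg1 n (kap : R) (a b : 'rV[R]_n) :
  - ((1 : R^o) *: a) + kap *: ((1 : R^o) *: b) = - a + kap *: b.
Proof. by rewrite !scale1r. Qed.

Lemma lie_alg n (p q u g : 'rV[R]_n) (t : R^o) :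
  p - 0 - (0 - (- q + 2^-1 *: q)) - (p - 0 - (- (t *: g) - - u)) =
  u - t *: g + - 2^-1 *: q - 0.
Proof. by apply/rowP => i; rewrite !mxE; field. Qed.

(** The derivatives of [X] along Gamma cancel between the two brackets, so an algebraic expression
    in [X] remains. In its psi component the derivative of F has coefficient -1 + 1/2, which is the
    tilde Gamma term of [ps]. *)
Lemma lieS X : vector_field X ->
  eqf (subf (bracket tG (tS X)) (tS (bracket tG X))) (subf (PV X) (PH X)).
Proof.
move=> hX c z cz; have sX := vf_smooth c hX; have sG := vf_smooth c vf_tG.
have sS := vf_smooth c (vf_tS hX);
have S2 : tS (bracket tG X) c z = euv (th z (bracket tG X c z)) by rewrite tSE.
rewrite /subf S2 PVE PHE.
have Sz : tS X c z = euv (th z (X c z)) by rewrite tSE.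
have thS w : th w (tS X c w) = 0 by rewrite tSE thU.
have etS w : et c w (tS X c w) = 0 by rewrite tSE etU.
have psS w : ps c w (tS X c w) = th w (X c w) by rewrite tSE psU.
have ctS w : ct (tS X c w) = 0 by rewrite tSE ctU.
have dGS n kap (G : VE -> 'rV[R]_n) : dfr kap G z (tG c z) (tS X c z) = 0.
  rewrite (dfr_th0 kap G (tG c z) (thS z)).
  rewrite ctS.
  exact: dfr_alg0.
have dSG n kap (G : VE -> 'rV[R]_n) : dfr kap G z (tS X c z) (tG c z) =
    - 'D_(euv (th z (X c z))) G z + kap *: 'D_(euv (th z (X c z))) G z.
  rewrite (dfr_th0 kap G (tS X c z) (thG c z)).
  rewrite ctG Sz cuU.
  exact: dfr_alg1.
apply: (@frame_inj _ _ _ _ _ s c z).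
- rewrite [LHS]ctB [RHS]ctB !ctU ctH (ct_br sG sS cz) derive_fun0 // !subr0 sub0r.
  have -> : (fun w => ct (tG c w) : R^o) = (fun=> 1) by apply/funext => w; exact: ctG.
  by rewrite derive_cst oppr0.
- rewrite [LHS]thB [RHS]thB !thU thH (th_br sG sS cz) !derive_fun0 //; last by move=> w; exact: thG.
  rewrite /dth ctS ctG scale0r scale1r Sz cuU.
  by rewrite !subr0 !sub0r oppr0 sub0r opprK.
- rewrite [LHS]etB [RHS]etB !etU etH (et_br sG sS cz) !derive_fun0 //; last by move=> w; exact: etG.
  by rewrite dGS dSG scale1r addNr !subr0.
- rewrite [LHS]psB [RHS]psB !psU psH (ps_br sG sS cz) (th_br sG sX cz).
  have z1 : 'D_(tS X c z) (fun w => ps c w (tG c w)) z = 0.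
    by apply: derive_fun0 => w; exact: psG.
  have z2 : 'D_(X c z) (fun w => th w (tG c w)) z = 0.
    by apply: derive_fun0 => w; exact: thG.
  rewrite z1 z2.
  rewrite dGS dSG /dth ctG scale1r cuG.
  have psSf : (fun w => ps c w (tS X c w)) = (fun w => th w (X c w)).
    by apply/funext => w; exact: psS.
  rewrite psSf.
  rewrite /ps (GamD _ cz).
  exact: lie_alg.
Qed.

Lemma vf_half X : vector_field X -> vector_field (fun c z => 2^-1 *: X c z).
Proof.
move=> hX; apply: natural => [c|c c' z oz].
  by apply: (smooth_scale (@oE c)); [exact: (smooth_cst (cod c) (2^-1 : R^o))|exact: vf_smooth].
rewrite (vf_trans hE hX oz) derive_dirZ //; apply: smooth_diff oz; exact: pm_trans hE c c'.
Qed.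

Definition lie X := subf (bracket tG (tS X)) (tS (bracket tG X)).
Lemma vf_lie X : vector_field X -> vector_field (lie X).
Proof.
move=> hX.
exact: (vf_sub hE (vf_bracket hE vf_tG (vf_tS hX)) (vf_tS (vf_bracket hE vf_tG hX))).
Qed.

Lemma half_alg (V : lmodType R) (a : V) : 2^-1 *: (a + a) = a.
Proof.
have e : 2^-1 + 2^-1 = 1 :> R by field.
by rewrite scalerDr -scalerDl e scale1r.
Qed.
Lemma HvN c z (w : 'rV[R]_m) : Hv c z (- w) = - Hv c z w.
Proof. by rewrite -(scaleN1r w) HvZ scaleN1r. Qed.

Lemma lieE X : vector_field X -> eqf (lie X) (subf (PV X) (PH X)).
Proof. exact: lieS. Qed.

(** [lie] has eigenvalue 1 on V_a, -1 on H_a and 0 on Gamma and the x^alpha directions. Hence [PV]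
    and [PH] are half the sum and half the difference of the square of [lie] and [lie], and inherit
    its invariance. *)
Lemma lie2 X : vector_field X -> eqf (lie (lie X)) (addf (PV X) (PH X)).
Proof.
move=> hX c z cz; rewrite (lieE (vf_lie hX) cz).
rewrite /subf /addf !(PVE, PHE) (lieE hX cz) /subf PVE PHE.
by rewrite psB psU psH thB thU thH subr0 sub0r HvN opprK.
Qed.

Lemma vf_PV X : vector_field X -> vector_field (PV X).
Proof.
move=> hX; have hL := vf_lie hX.
apply: (vf_eqf hE _ (vf_half (vf_add hE (vf_lie hL) hL))) => c z cz.
rewrite /addf (lie2 hX cz) (lieE hX cz) /addf /subf addrACA subrr addr0.
exact: half_alg.
Qed.

Lemma vf_PH X : vector_field X -> vector_field (PH X).
Proof.
move=> hX; have hL := vf_lie hX.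
apply: (vf_eqf hE _ (vf_half (vf_sub hE (vf_lie hL) hL))) => c z cz.
rewrite /subf (lie2 hX cz) (lieE hX cz) /addf /subf opprB addrC addrA subrK.
exact: half_alg.
Qed.

Lemma zalg1 (V : zmodType) (a b c d : V) : a + b + c + d - a - c - d = b.
Proof.
apply: (addIr d); rewrite subrK; apply: (addIr c); rewrite subrK.
apply: (addIr a); rewrite subrK.
by rewrite [a + b]addrC (addrAC (b + a)) [RHS]addrAC (addrAC b d).
Qed.

(** [PN] is what remains of the identity after the other three projectors, whose invariance is
    established. *)
Lemma vf_PN X : vector_field X -> vector_field (PN X).
Proof.
move=> hX; apply: (vf_eqf hE _ (vf_sub hE (vf_sub hE (vf_sub hE hX (vf_PG hX)) (vf_PH hX)) (vf_PV hX))).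
move=> c z cz; rewrite /subf PHE PVE PNE {1}[X c z](frame_dec c z) /PG.
exact: zalg1.
Qed.

(** Extending a single vector to a field lets the invariance of [PH], [PV] and [PN] as operators on
    fields yield the transformation laws of [Hv], [ps] and [et] at single vectors. *)
Lemma point_field c z v : cod c z -> exists2 X, vector_field X & \forall w \near z, X c w = v.
Proof.
move=> [p cp <-]; have [f [A hf]] := bE cp.
exists (bfield c f (fun=> v)); first by apply: (vf_bfield hE hf); exact: smooth_cst.
exact: (near_bfield hE cp hf).
Qed.

Lemma ov_cod c c' z : overlap c c' z -> cod c z.
Proof. by move=> [p [_ cp] <-]; exists p. Qed.

Lemma Hv_trans c c' z w : overlap c c' z ->
  'D_(Hv c z w) (trans c c') z = Hv c' (trans c c' z) ('D_w (trans c.1 c'.1) (cx z)).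
Proof.
move=> oz; have [X hX /nbhs_singleton Xz] := point_field (Hv c z w) (ov_cod oz).
have := vf_trans hE (vf_PH hX) oz; rewrite PHE Xz thH => <-.
by rewrite (vf_trans hE hX oz) (th_trans oz) Xz thH.
Qed.

Lemma ps_trans c c' z v : overlap c c' z ->
  ps c' (trans c c' z) ('D_v (trans c c') z) = 'D_(ps c z v) (trans c.1 c'.1) (cx z).
Proof.
move=> oz; have [X hX /nbhs_singleton Xz] := point_field v (ov_cod oz).
have := vf_trans hE (vf_PV hX) oz; rewrite PVE Xz (vf_trans hE hX oz) Xz (euv_trans oz).
by move=> /(congr1 (@cu R m k)); rewrite !cuU.
Qed.

Lemma et_trans c c' z v : overlap c c' z ->
  et c' (trans c c' z) ('D_v (trans c c') z) = 'D_(et c z v) (trans c.2 c'.2) (cy z).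
Proof.
move=> oz; have [X hX /nbhs_singleton Xz] := point_field v (ov_cod oz).
have := vf_trans hE (vf_PN hX) oz; rewrite PNE Xz (vf_trans hE hX oz) Xz (eyv_trans oz).
by move=> /(congr1 (@cy R m k)); rewrite !cyY.
Qed.

Lemma vf_tQ X : vector_field X -> vector_field (tQ X).
Proof.
move=> hX; rewrite tQE; apply: natural => [c|c c' z oz].
  by apply: sm_Hv; apply: sm_ps; exact: vf_smooth.
by rewrite (vf_trans hE hX oz) (ps_trans _ oz) (Hv_trans _ oz).
Qed.

(** * Invariance of the submodule derivatives on im(P_Gamma) and im(N) *)

Lemma nabGE c z X Y : nabG X Y c z = 'D_(X c z) (fun w => ct (Y c w) : R^o) z *: tG c z.
Proof. by []. Qed.

Lemma nabNE c z X Y : cod c z -> smooth_on (cod c) (Y c) ->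
  nabN Ups X Y c z = eyv ('D_(X c z) (fun w => cy (Y c w)) z +
    UpsV Ups c.2 (cy z) (cy (X c z)) (cy (Y c z))).
Proof.
move=> cz sY; rewrite eyv_sum; apply: eq_bigr => l _.
have dY : differentiable (fun w => cy (Y c w)) z.
  exact: (differentiable_comp (smooth_diff sY cz) (diff_cy _)).
apply: (f_equal (fun a : R => a *: e_y l)).
rewrite !mxE; apply: (f_equal2 +%R); last by [].
exact: (D_coord l _ dY).
Qed.

Lemma vf_nabG X Y : vector_field X -> vector_field Y -> vector_field (nabG X Y).
Proof.
move=> hX hY; apply: (natural) => [c|c c' z oz].
  have sD := smooth_dirU (@oE c) (sm_ct (vf_smooth c hY)) (vf_smooth c hX).
  exact: (smooth_scale (@oE c) sD (vf_smooth c (vf_tG))).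
have cz := ov_cod oz; have dt := smooth_diff (pm_trans hE c c') oz.
have cz' : cod c' (trans c c' z).
  by move: oz => [p [c'p cp] <-]; rewrite (transE hE c' cp); exact: cod_dom.
have dcY : differentiable (fun w => ct (Y c' w) : R^o) (trans c c' z).
  exact: (smooth_diff (sm_ct (vf_smooth c' hY)) cz').
rewrite !nabGE (vf_trans hE hX oz) (vf_trans hE (vf_tG) oz).
rewrite (derive_dirZ _ _ dt).
have <- : 'D_(X c z) ((fun w => ct (Y c' w) : R^o) \o trans c c') z =
    'D_('D_(X c z) (trans c c') z) (fun w => ct (Y c' w) : R^o) (trans c c' z).
  exact: (derive_compE _ dt dcY).
have -> : 'D_(X c z) ((fun w => ct (Y c' w) : R^o) \o trans c c') z =
    'D_(X c z) (fun w => ct (Y c w) : R^o) z.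
  apply: near_eq_derive; apply: filterS (near_overlap hE oz) => w ow /=.
  by rewrite (vf_trans hE hY ow) (ct_trans ow).
by [].
Qed.

(** Differentiating the components of [PN Y] in new coordinates produces the Hessian of the
    transition map of the second factor; [Ups_law] contains the same Hessian and absorbs it. *)
Lemma vf_nabN X Y : vector_field X -> vector_field Y ->
  vector_field (nabN Ups (PN X) (PN Y)).
Proof.
move=> hX hY.
have hNX := vf_PN hX; have hNY := vf_PN hY.
have cyN Z c z : cy (PN Z c z) = et c z (Z c z) by rewrite PNE.
have sN c : smooth_on (cod c) (fun w => cy (PN Y c w)).
  exact: (@smooth_lincomp _ _ _ (@oE c) _ _ (@cyL R m k) _ (@cy_continuous R m k) (vf_smooth c hNY)).
have sNX c : smooth_on (cod c) (fun w => cy (PN X c w)).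
  exact: (@smooth_lincomp _ _ _ (@oE c) _ _ (@cyL R m k) _ (@cy_continuous R m k) (vf_smooth c hNX)).
apply: (natural) => [c|c c' z oz].
  apply: (smooth_ext (@oE c) (f := fun z => eyv ('D_(PN X c z) (fun w => cy (PN Y c w)) z +
    UpsV Ups c.2 (cy z) (cy (PN X c z)) (cy (PN Y c z))))).
    by move=> z cz; rewrite (nabNE _ cz (vf_smooth c hNY)).
  have sD := smooth_dirU (@oE c) (sN c) (vf_smooth c hNX).
  have mc z : cod c z -> cod c.2 (cy z) by move=> /(codE h1 h2 hs) [].
  have sU := smooth_UpsV h2 b2 hD2 hUps (@oE c) mc (smooth_cy (cod c)) (sNX c) (sN c).
  exact: (smooth_eyv (@oE c) (smooth_add (@oE c) sD sU)).
have cz := ov_cod oz; have dt := smooth_diff (pm_trans hE c c') oz.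
have [p [c'p cp] pz] := oz.
have cz' : cod c' (trans c c' z) by rewrite -pz (transE hE c' cp); exact: cod_dom.
rewrite (nabNE _ cz (vf_smooth c hNY)) (nabNE _ cz' (vf_smooth c' hNY)).
rewrite (eyv_trans oz) (vf_trans hE hNX oz).
set a := cy (PN X c z); set b := cy (PN Y c z).
have [ox oy] := (E_overlap h1 h2 hs c c' z).1 oz.
have tau w : overlap c c' w -> cy (PN Y c' (trans c c' w)) =
    'D_(cy (PN Y c w)) (trans c.2 c'.2) (cy w).
  by move=> ow; rewrite !cyN (vf_trans hE hY ow) (et_trans _ ow).
have ta : cy ('D_(PN X c z) (trans c c') z) = 'D_a (trans c.2 c'.2) (cy z).
  by rewrite (D_etrans h1 h2 hs _ oz).
have dcY : differentiable (fun w => cy (PN Y c' w)) (trans c c' z).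
  exact: (smooth_diff (sN c') cz').
have e1 : 'D_('D_(PN X c z) (trans c c') z) (fun w => cy (PN Y c' w)) (trans c c' z) =
    'D_(PN X c z) (fun w => 'D_(cy (PN Y c w)) (trans c.2 c'.2) (cy w)) z.
  rewrite -(derive_compE (g := fun w => cy (PN Y c' w)) _ dt dcY).
  by apply: near_eq_derive; apply: filterS (near_overlap hE oz) => w ow; exact: tau.
have e2 := derive_dir (hW := findim_rV k) (PN X c z) (open_overlap h2 c.2 c'.2) oy
  (pm_trans h2 c.2 c'.2) (diff_cy z) (smooth_diff (sN c) cz).
rewrite Dlin_cy in e2.
rewrite e1 e2 ta (tau _ oz) -/a -/b.
have [p2 [c'p2 cp2] p2z] := oy.
have cyt : cy (trans c c' z) = coord c'.2 p2.
  by rewrite (E_trans h1 h2 hs oz) -(transE h2 c'.2 cp2) p2z.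
have L := Ups_law h2 b2 hD2 hUps a b cp2 c'p2; rewrite p2z -cyt in L.
have d2 : differentiable (trans c.2 c'.2) (cy z).
  exact: smooth_diff (pm_trans h2 c.2 c'.2) oy.
rewrite (derive_dirD _ _ d2) -L; apply: (f_equal (@eyv R m k)).
by rewrite [LHS]addrAC [LHS]addrC [X in _ + X]addrC.
Qed.

(** * The connection in frame components *)

(* In the frame (tGamma, d/dx^alpha, H, V) the connection matrix of tnabla is
   the block matrix diag(0, wN, wH, wH). *)
Definition wH c z v (w : 'rV[R]_m) : 'rV[R]_m :=
  ct v *: Gam c z w - 2^-1 *: 'D_(euv w) ('D_(euv (th z v)) (cF s c)) z.
Definition wN c z v (w : 'rV[R]_k) : 'rV[R]_k :=
  - (ct v *: 'D_(eyv w) (cPsi s c) z) - 'D_(eyv w) ('D_(euv (th z v)) (cPsi s c)) z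
  + UpsV Ups c.2 (cy z) (et c z v) w.

Lemma dfr_alg2 n (kap : R) (a b d : 'rV[R]_n) :
  - ((0 : R^o) *: a) - kap *: b + kap *: ((0 : R^o) *: d) = - (kap *: b).
Proof. by rewrite !scale0r scaler0 oppr0 add0r addr0. Qed.
Lemma dfr_alg3 n (t : R^o) (a b : 'rV[R]_n) :
  - (t *: a) - (1 : R) *: b + (1 : R) *: (t *: 0) = - (t *: a) - b.
Proof. by rewrite !scaler0 scale1r addr0. Qed.
Lemma extN_alg n (a b p q u : 'rV[R]_n) :
  a + u + (b - 0 - (0 - (- p - q))) = a + b + (- p - q + u).
Proof. by apply/rowP => i; rewrite !mxE; ring. Qed.
Lemma extH_alg n (a b p q : 'rV[R]_n) :
  a - 0 - (0 - - p) + (b - 0 - (0 - q)) = a + b + (q - p).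
Proof. by apply/rowP => i; rewrite !mxE; ring. Qed.
Lemma extV_alg1 n (t : R^o) (a b : 'rV[R]_n) :
  - (t *: a) - 2^-1 *: b + 2^-1 *: (t *: a) = t *: (- 2^-1 *: a) - 2^-1 *: b.
Proof. by apply/rowP => i; rewrite !mxE; field. Qed.
Lemma extV_alg n (a b p : 'rV[R]_n) :
  a - 0 - (0 - 0) + (b - 0 - (0 - p)) = a + b + p.
Proof. by apply/rowP => i; rewrite !mxE; ring. Qed.

Lemma dfr_ct0 n kap (G : VE -> 'rV[R]_n) z v y : ct y = 0 ->
  dfr kap G z v y = - (kap *: 'D_v ('D_(euv (th z y)) G) z).
Proof. by move=> y0; rewrite /dfr y0; exact: dfr_alg2. Qed.

Lemma dfr_00 n kap (G : VE -> 'rV[R]_n) z v y : ct y = 0 -> th z y = 0 ->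
  dfr kap G z v y = 0.
Proof.
move=> y0 t0; rewrite (dfr_th0 kap G v t0) y0; exact: dfr_alg0.
Qed.

Lemma dth_0 v y : ct y = 0 -> dth v y = 0.
Proof. by move=> y0; rewrite /dth y0 scale0r oppr0. Qed.

Lemma D_split n (f : VE -> 'rV[R]_n) z v w : differentiable f z ->
  'D_w f z + 'D_(v - w) f z = 'D_v f z.
Proof. by move=> df; rewrite (derive_dirB v w df) addrC subrK. Qed.
Lemma D_split1 (f : VE -> R^o) z v w : differentiable f z ->
  'D_w f z + 'D_(v - w) f z = 'D_v f z.
Proof. by move=> df; rewrite (derive_dirB v w df) addrC subrK. Qed.

Lemma dfrE n kap (G : VE -> 'rV[R]_n) z v y : dfr kap G z v y =
  - (ct y *: 'D_v G z) - kap *: 'D_v ('D_(euv (th z y)) G) z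
  + kap *: (ct y *: 'D_(euv (cu v)) G z).
Proof. by []. Qed.
Lemma dthE v y : dth v y = - (ct y *: cu v). Proof. by []. Qed.
Lemma cuH c z w : cu (Hv c z w) = - Gam c z w. Proof. by []. Qed.
Lemma cuY (w : 'rV[R]_k) : cu (eyv w : VE) = 0. Proof. by []. Qed.
Lemma euv0 : euv 0 = 0 :> VE. Proof. exact: (linear0 (@euvL R m k)). Qed.
Lemma eyv0 : eyv 0 = 0 :> VE. Proof. exact: (linear0 (@eyvL R m k)). Qed.
Lemma euvD (a b : 'rV[R]_m) : euv (a + b) = euv a + euv b :> VE.
Proof. exact: (linearD (@euvL R m k)). Qed.
Lemma eyvD (a b : 'rV[R]_k) : eyv (a + b) = eyv a + eyv b :> VE.
Proof. exact: (linearD (@eyvL R m k)). Qed.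
Lemma PNz X c z : PN X c z = eyv (et c z (X c z)). Proof. by rewrite PNE. Qed.
Lemma PVz X c z : PV X c z = euv (ps c z (X c z)). Proof. by rewrite PVE. Qed.
Lemma PHz X c z : PH X c z = Hv c z (th z (X c z)). Proof. by rewrite PHE. Qed.
Lemma tSz X c z : tS X c z = euv (th z (X c z)). Proof. by rewrite tSE. Qed.
Lemma tQz X c z : tQ X c z = Hv c z (ps c z (X c z)). Proof. by rewrite tQE. Qed.
Lemma D_0 n (z v : VE) : 'D_v (fun _ : VE => 0 : 'rV[R]_n) z = 0.
Proof. exact: derive_cst. Qed.
Local Opaque euv eyv Hv tGamma bracket dth dfr.

Section Fixed.
Variables (X Y : field E) (c : chart E) (z : VE).
Hypotheses (hX : vector_field X) (hY : vector_field Y) (cz : cod c z).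

Let dct : differentiable (fun w => ct (Y c w) : R^o) z.
Proof. exact: (smooth_diff (sm_ct (vf_smooth c hY)) cz). Qed.
Let dth' : differentiable (fun w => th w (Y c w)) z.
Proof. exact: (smooth_diff (sm_th (vf_smooth c hY)) cz). Qed.
Let det : differentiable (fun w => et c w (Y c w)) z.
Proof. exact: (smooth_diff (sm_et (vf_smooth c hY)) cz). Qed.
Let dps : differentiable (fun w => ps c w (Y c w)) z.
Proof. exact: (smooth_diff (sm_ps (vf_smooth c hY)) cz). Qed.

Lemma ct_PG Z w : ct (PG Z c w) = ct (Z c w).
Proof. by rewrite /PG ctZ ctG mulr1. Qed.

(** The inner derivative supplies the derivative of the component along [PG X], the bracket that
    along [X - PG X]. The other three extensions split in the same way; here no connection form is
    left, since dt is closed. *)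
Lemma extG : extend (@PG R m k M1 M2 s) (@nabG R m k M1 M2 s) X (PG Y) c z =
  'D_(X c z) (fun w => ct (Y c w) : R^o) z *: tG c z.
Proof.
have hP := vf_PG hX; have hPY := vf_PG hY.
have br := ct_br (vf_smooth c (vf_sub hE hX hP)) (vf_smooth c hPY) cz.
have f1 : (fun w => ct (PG Y c w) : R^o) = (fun w => ct (Y c w)).
  by apply/funext => w; exact: ct_PG.
have f2 : (fun w => ct (subf X (PG X) c w) : R^o) = (fun=> 0).
  by apply/funext => w; rewrite /subf ctB ct_PG subrr.
have z0 : 'D_(PG Y c z) (fun _ : VE => 0 : R^o) z = 0 by exact: derive_cst.
rewrite f1 f2 z0 subr0 in br.
have -> : extend (@PG R m k M1 M2 s) (@nabG R m k M1 M2 s) X (PG Y) c z =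
  nabG (PG X) (PG Y) c z + ct (bracket (subf X (PG X)) (PG Y) c z) *: tG c z by [].
by rewrite br nabGE f1 -scalerDl (D_split1 (X c z) (PG X c z) dct).
Qed.

(** The [Ups] term of [wN] comes from [nabN], its other terms from the exterior derivative of eta in
    the bracket. *)
Lemma extN : extend (@PN R m k M1 M2 s) (nabN Ups) X (PN Y) c z =
  eyv ('D_(X c z) (fun w => et c w (Y c w)) z + wN c z (X c z) (et c z (Y c z))).
Proof.
have hP := vf_PN hX; have hPY := vf_PN hY.
have br := et_br (vf_smooth c (vf_sub hE hX hP)) (vf_smooth c hPY) cz.
have f1 : (fun w => et c w (PN Y c w)) = (fun w => et c w (Y c w)).
  by apply/funext => w; rewrite PNz etY.
have f1' : (fun w => cy (PN Y c w)) = (fun w => et c w (Y c w)).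
  by apply/funext => w; rewrite PNz cyY.
have f2 : (fun w => et c w (subf X (PN X) c w)) = (fun=> 0).
  by apply/funext => w; rewrite /subf etB PNz etY subrr.
have cN Z : ct (PN Z c z) = 0 by rewrite PNz ctY.
have tN Z : th z (PN Z c z) = 0 by rewrite PNz thY.
have yN Z : cy (PN Z c z) = et c z (Z c z) by rewrite PNz cyY.
have s1 : ct (subf X (PN X) c z) = ct (X c z) by rewrite /subf ctB cN subr0.
have s2 : th z (subf X (PN X) c z) = th z (X c z) by rewrite /subf thB tN subr0.
have s3 : 'D_(euv (cu (PN Y c z))) (cPsi s c) z = 0 by rewrite PNz cuY euv0 derive0.
have e : dfr 1 (cPsi s c) z (PN Y c z) (subf X (PN X) c z) =
    - (ct (X c z) *: 'D_(eyv (et c z (Y c z))) (cPsi s c) z)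
    - 'D_(eyv (et c z (Y c z))) ('D_(euv (th z (X c z))) (cPsi s c)) z.
  by rewrite dfrE s1 s2 s3 PNz; exact: dfr_alg3.
rewrite f1 f2 D_0 (dfr_00 _ _ _ (cN Y) (tN Y)) e in br.
have -> : extend (@PN R m k M1 M2 s) (nabN Ups) X (PN Y) c z =
  nabN Ups (PN X) (PN Y) c z + PN (bracket (subf X (PN X)) (PN Y)) c z by [].
rewrite (nabNE (PN X) cz (vf_smooth c hPY)) f1' (PNz (bracket _ _)) br !yN.
rewrite -eyvD; apply: (f_equal (@eyv R m k)).
rewrite -(D_split (X c z) (PN X c z) det).
exact: extN_alg.
Qed.

(** [wH] has two sources: the second derivative of F comes from d psi inside Q([P_H X, S Y]), the
    tilde Gamma term from d theta in the bracket with [X - PH X]. *)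
Lemma extH : extend (@PH R m k M1 M2 s) (@nabH R m k M1 M2 s) X (PH Y) c z =
  Hv c z ('D_(X c z) (fun w => th w (Y c w)) z + wH c z (X c z) (th z (Y c z))).
Proof.
have hP := vf_PH hX; have hPY := vf_PH hY; have hSY := vf_tS hY.
have S0 : tS (PH Y) = tS Y.
  by apply/funext => c'; apply/funext => w; rewrite !tSz PHz thH.
have br1 := ps_br (vf_smooth c hP) (vf_smooth c hSY) cz.
have br2 := th_br (vf_smooth c (vf_sub hE hX hP)) (vf_smooth c hPY) cz.
have f1 : (fun w => ps c w (tS Y c w)) = (fun w => th w (Y c w)).
  by apply/funext => w; rewrite tSz psU.
have f2 : (fun w => ps c w (PH X c w)) = (fun=> 0).
  by apply/funext => w; rewrite PHz psH.
have g1 : (fun w => th w (PH Y c w)) = (fun w => th w (Y c w)).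
  by apply/funext => w; rewrite PHz thH.
have g2 : (fun w => th w (subf X (PH X) c w)) = (fun=> 0).
  by apply/funext => w; rewrite /subf thB PHz thH subrr.
have cH Z : ct (PH Z c z) = 0 by rewrite PHz ctH.
have tH Z : th z (PH Z c z) = th z (Z c z) by rewrite PHz thH.
have cS : ct (tS Y c z) = 0 by rewrite tSz ctU.
have tS0 : th z (tS Y c z) = 0 by rewrite tSz thU.
have cuP : cu (PH Y c z) = - Gam c z (th z (Y c z)) by rewrite PHz cuH.
have s1 : ct (subf X (PH X) c z) = ct (X c z) by rewrite /subf ctB cH subr0.
have e2 : dth (PH Y c z) (subf X (PH X) c z) = ct (X c z) *: Gam c z (th z (Y c z)).
  by rewrite dthE s1 cuP scalerN opprK.
rewrite f1 f2 D_0 (dfr_00 _ _ _ cS tS0) (dfr_ct0 _ _ _ _ (cH X)) tH tSz in br1.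
rewrite g1 g2 D_0 (dth_0 _ (cH Y)) e2 in br2.
have -> : extend (@PH R m k M1 M2 s) (@nabH R m k M1 M2 s) X (PH Y) c z =
  tQ (bracket (PH X) (tS (PH Y))) c z + PH (bracket (subf X (PH X)) (PH Y)) c z by [].
rewrite S0 (tQz (bracket _ _)) (PHz (bracket _ _)) -HvD; apply: (f_equal (Hv c z)).
rewrite br1 br2 -(D_split (X c z) (PH X c z) dth').
exact: extH_alg.
Qed.

(** All of [wH] now comes from d psi in the bracket with [X - PV X], where the first derivatives of
    F have coefficients -1 and 1/2. Agreement with the block of [extH] is what makes S and Q
    parallel. *)
Lemma extV : extend (@PV R m k M1 M2 s) (@nabV R m k M1 M2 s) X (PV Y) c z =
  euv ('D_(X c z) (fun w => ps c w (Y c w)) z + wH c z (X c z) (ps c z (Y c z))).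
Proof.
have hP := vf_PV hX; have hPY := vf_PV hY.
have hQY := vf_tQ hY.
have S0 : tQ (PV Y) = tQ Y.
  by apply/funext => c'; apply/funext => w; rewrite !tQz PVz psU.
have br1 := th_br (vf_smooth c hP) (vf_smooth c hQY) cz.
have br2 := ps_br (vf_smooth c (vf_sub hE hX hP)) (vf_smooth c hPY) cz.
have f1 : (fun w => th w (tQ Y c w)) = (fun w => ps c w (Y c w)).
  by apply/funext => w; rewrite tQz thH.
have f2 : (fun w => th w (PV X c w)) = (fun=> 0).
  by apply/funext => w; rewrite PVz thU.
have g1 : (fun w => ps c w (PV Y c w)) = (fun w => ps c w (Y c w)).
  by apply/funext => w; rewrite PVz psU.
have g2 : (fun w => ps c w (subf X (PV X) c w)) = (fun=> 0).
  by apply/funext => w; rewrite /subf psB PVz psU subrr.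
have cV Z : ct (PV Z c z) = 0 by rewrite PVz ctU.
have tV Z : th z (PV Z c z) = 0 by rewrite PVz thU.
have cQ : ct (tQ Y c z) = 0 by rewrite tQz ctH.
have s1 : ct (subf X (PV X) c z) = ct (X c z) by rewrite /subf ctB cV subr0.
have s2 : th z (subf X (PV X) c z) = th z (X c z) by rewrite /subf thB tV subr0.
have e : dfr 2^-1 (cF s c) z (PV Y c z) (subf X (PV X) c z) = wH c z (X c z) (ps c z (Y c z)).
  by rewrite dfrE s1 s2 PVz cuU /wH (GamD _ cz); exact: extV_alg1.
rewrite f1 f2 D_0 (dth_0 _ cQ) (dth_0 _ (cV X)) in br1.
rewrite g1 g2 D_0 (dfr_00 _ _ _ (cV Y) (tV Y)) e in br2.
have -> : extend (@PV R m k M1 M2 s) (@nabV R m k M1 M2 s) X (PV Y) c z =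
  tS (bracket (PV X) (tQ (PV Y))) c z + PV (bracket (subf X (PV X)) (PV Y)) c z by [].
rewrite S0 (tSz (bracket _ _)) (PVz (bracket _ _)) -euvD; apply: (f_equal (@euv R m k)).
rewrite br1 br2 -(D_split (X c z) (PV X c z) dps).
exact: extV_alg.
Qed.

Lemma tnablaE : tnabla Ups X Y c z =
  'D_(X c z) (fun w => ct (Y c w) : R^o) z *: tG c z
  + eyv ('D_(X c z) (fun w => et c w (Y c w)) z + wN c z (X c z) (et c z (Y c z)))
  + Hv c z ('D_(X c z) (fun w => th w (Y c w)) z + wH c z (X c z) (th z (Y c z)))
  + euv ('D_(X c z) (fun w => ps c w (Y c w)) z + wH c z (X c z) (ps c z (Y c z))).
Proof. by rewrite -extG -extN -extH -extV. Qed.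

Lemma ct_nabla : ct (tnabla Ups X Y c z) = 'D_(X c z) (fun w => ct (Y c w) : R^o) z.
Proof.
rewrite tnablaE 3!ctD ctZ ctG ctY ctH ctU.
by rewrite mulr1 !addr0.
Qed.
Lemma th_nabla : th z (tnabla Ups X Y c z) =
  'D_(X c z) (fun w => th w (Y c w)) z + wH c z (X c z) (th z (Y c z)).
Proof. by rewrite tnablaE 3!thD thZ thG thY thH thU scaler0 addr0 !add0r. Qed.
Lemma et_nabla : et c z (tnabla Ups X Y c z) =
  'D_(X c z) (fun w => et c w (Y c w)) z + wN c z (X c z) (et c z (Y c z)).
Proof. by rewrite tnablaE 3!etD etZ etG etY etH etU scaler0 !addr0 !add0r. Qed.
Lemma ps_nabla : ps c z (tnabla Ups X Y c z) =
  'D_(X c z) (fun w => ps c w (Y c w)) z + wH c z (X c z) (ps c z (Y c z)).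
Proof. by rewrite tnablaE 3!psD psZ psG psY psH psU scaler0 !add0r. Qed.
End Fixed.

Lemma vf_extend (P : field E -> field E) (nab : field E -> field E -> field E) X Y :
  (forall Z, vector_field Z -> vector_field (P Z)) ->
  vector_field X -> vector_field Y -> vector_field (nab (P X) Y) ->
  vector_field (extend P nab X Y).
Proof.
move=> hP hX hY hN.
exact: (vf_add hE hN (hP _ (vf_bracket hE (vf_sub hE hX (hP _ hX)) hY))).
Qed.

Lemma vf_tnabla X Y : vector_field X -> vector_field Y -> vector_field (tnabla Ups X Y).
Proof.
move=> hX hY.
have pG Z := @vf_PG Z; have pN Z := @vf_PN Z.
have pH Z := @vf_PH Z; have pV Z := @vf_PV Z.
have pS Z := @vf_tS Z.
have pQ Z := @vf_tQ Z.
have vG := vf_extend pG hX (pG _ hY) (vf_nabG (pG _ hX) (pG _ hY)).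
have vN := vf_extend pN hX (pN _ hY) (vf_nabN hX hY).
have nH : vector_field (nabH (PH X) (PH Y)).
  by rewrite /nabH; apply: pQ; exact: (vf_bracket hE (pH _ hX) (pS _ (pH _ hY))).
have nV : vector_field (nabV (PV X) (PV Y)).
  by rewrite /nabV; apply: pS; exact: (vf_bracket hE (pV _ hX) (pQ _ (pV _ hY))).
have vH := @vf_extend (@PH R m k M1 M2 s) (@nabH R m k M1 M2 s) X (PH Y) pH hX (pH _ hY) nH.
have vV := @vf_extend (@PV R m k M1 M2 s) (@nabV R m k M1 M2 s) X (PV Y) pV hX (pV _ hY) nV.
exact: (vf_add hE (vf_add hE (vf_add hE vG vN) vH) vV).
Qed.

Lemma zalg2 (V : zmodType) (g n pn q ph v pv : V) :
  g + (n + pn) + (q + ph) + (v + pv) = g + n + q + v + pn + ph + pv.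
Proof. by rewrite !addrA (addrAC _ pn q) (addrAC _ ph v) (addrAC _ pn v). Qed.

(** By [extG] the first extension collapses to [nabG X Y]; the identities S P_H = S and Q P_V = Q
    remove the inner projectors, and the rest is rearrangement. *)
Lemma tnabla_explicitE X Y : vector_field X -> vector_field Y ->
  eqf (nab X Y) (tnabla_explicit Ups X Y).
Proof.
move=> hX hY c z cz.
have SPH : tS (PH Y) = tS Y.
  by apply/funext => c'; apply/funext => w; rewrite !tSz PHz thH.
have QPV : tQ (PV Y) = tQ Y.
  by apply/funext => c'; apply/funext => w; rewrite !tQz PVz psU.
have -> : nab X Y c z = extend (@PG R m k M1 M2 s) (@nabG R m k M1 M2 s) X (PG Y) c z +
    (nabN Ups (PN X) (PN Y) c z + PN (bracket (subf X (PN X)) (PN Y)) c z) +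
    (tQ (bracket (PH X) (tS (PH Y))) c z + PH (bracket (subf X (PH X)) (PH Y)) c z) +
    (tS (bracket (PV X) (tQ (PV Y))) c z + PV (bracket (subf X (PV X)) (PV Y)) c z) by [].
by rewrite (extG hX hY cz) -nabGE SPH QPV zalg2.
Qed.

(** * Linearity of the connection forms and the axioms of a linear connection *)

Lemma D2_dir n (G : VE -> 'rV[R]_n) c z (a : R) (u v w : VE) : cod c z ->
  smooth_on (cod c) G ->
  'D_w ('D_(a *: u + v) G) z = a *: 'D_w ('D_u G) z + 'D_w ('D_v G) z.
Proof.
move=> cz sG; have dw := smooth_diff (smooth_D w sG) cz.
(* Schwarz brings the inner direction outside, where linearity is a pointwise property of a
   differential. *)
have S (x : VE) : 'D_w ('D_x G) z = 'D_x ('D_w G) z.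
  exact: (Schwarz (hW := findim_rV n) x w (@oE c) cz sG).
have E1 := derive_dirD (a *: u) v dw; have E2 := derive_dirZ a u dw.
have E3 := f_equal2 +%R (eq_trans E2 (f_equal (fun x => a *: x) (esym (S u)))) (esym (S v)).
exact: (eq_trans (S (a *: u + v)) (eq_trans E1 E3)).
Qed.

Lemma wH_algl n (a tu tv : R) (g d e : 'rV[R]_n) :
  (a * tu + tv) *: g - 2^-1 *: (a *: d + e) =
  a *: (tu *: g - 2^-1 *: d) + (tv *: g - 2^-1 *: e).
Proof. by apply/rowP => i; rewrite !mxE; ring. Qed.
Lemma wH_algr n (a t : R) (g h d e : 'rV[R]_n) :
  t *: (a *: g + h) - 2^-1 *: (a *: d + e) =
  a *: (t *: g - 2^-1 *: d) + (t *: h - 2^-1 *: e).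
Proof. by apply/rowP => i; rewrite !mxE; ring. Qed.
Lemma wN_algl n (a tu tv : R) (g d e p q : 'rV[R]_n) :
  - ((a * tu + tv) *: g) - (a *: d + e) + (a *: p + q) =
  a *: (- (tu *: g) - d + p) + (- (tv *: g) - e + q).
Proof. by apply/rowP => i; rewrite !mxE; ring. Qed.
Lemma wN_algr n (a t : R) (g h d e p q : 'rV[R]_n) :
  - (t *: (a *: g + h)) - (a *: d + e) + (a *: p + q) =
  a *: (- (t *: g) - d + p) + (- (t *: h) - e + q).
Proof. by apply/rowP => i; rewrite !mxE; ring. Qed.

Lemma UpsV_linl (c : chart M2) (q : 'rV[R]_k) (a : R) (u v w : 'rV[R]_k) :
  UpsV Ups c q (a *: u + v) w = a *: UpsV Ups c q u w + UpsV Ups c q v w.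
Proof.
apply/rowP => l; rewrite !mxE mulr_sumr -big_split /=; apply: eq_bigr => i _.
rewrite mulr_sumr -big_split /=; apply: eq_bigr => j _.
by rewrite !mxE; ring.
Qed.
Lemma UpsV_linr (c : chart M2) (q : 'rV[R]_k) (a : R) (u v w : 'rV[R]_k) :
  UpsV Ups c q w (a *: u + v) = a *: UpsV Ups c q w u + UpsV Ups c q w v.
Proof.
apply/rowP => l; rewrite !mxE mulr_sumr -big_split /=; apply: eq_bigr => i _.
rewrite mulr_sumr -big_split /=; apply: eq_bigr => j _.
by rewrite !mxE; ring.
Qed.

Lemma euvP (a : R) (u v : 'rV[R]_m) : euv (a *: u + v) = a *: euv u + euv v :> VE.
Proof. exact: (linearP (@euvL R m k)). Qed.
Lemma eyvP (a : R) (u v : 'rV[R]_k) : eyv (a *: u + v) = a *: eyv u + eyv v :> VE.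
Proof. exact: (linearP (@eyvL R m k)). Qed.
Lemma thP z (a : R) (u v : VE) : th z (a *: u + v) = a *: th z u + th z v.
Proof. by rewrite thD thZ. Qed.
Lemma etP c z (a : R) (u v : VE) : et c z (a *: u + v) = a *: et c z u + et c z v.
Proof. by rewrite etD etZ. Qed.
Lemma psP c z (a : R) (u v : VE) : ps c z (a *: u + v) = a *: ps c z u + ps c z v.
Proof. by rewrite psD psZ. Qed.
Lemma ctP (a : R) (u v : VE) : ct (a *: u + v) = a * ct u + ct v.
Proof. by []. Qed.
Lemma GamP c z (a : R) (u v : 'rV[R]_m) : Gam c z (a *: u + v) = a *: Gam c z u + Gam c z v.
Proof. exact: linearP. Qed.
Local Opaque euv eyv Hv tGamma bracket.

Lemma D_dirP n (f : VE -> 'rV[R]_n) z (a : R) (u v : VE) : differentiable f z ->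
  'D_(a *: u + v) f z = a *: 'D_u f z + 'D_v f z.
Proof. by move=> df; rewrite (derive_dirD _ _ df) (derive_dirZ _ _ df). Qed.

Lemma wH_linl c z (a : R) (u v : VE) (w : 'rV[R]_m) : cod c z ->
  wH c z (a *: u + v) w = a *: wH c z u w + wH c z v w.
Proof.
move=> cz.
have e := D2_dir a (euv (th z u)) (euv (th z v)) (euv w) cz (smF c).
have E : euv (th z (a *: u + v)) = a *: euv (th z u) + euv (th z v) :> VE.
  by rewrite thP euvP.
have E2 := eq_trans (@f_equal VE 'rV[R]_m (fun y : VE => 'D_(euv w) ('D_y (cF s c)) z) _ _ E) e.
apply: (eq_trans (f_equal (fun d => ct (a *: u + v : VE) *: Gam c z w - 2^-1 *: d) E2)).
rewrite ctP.
exact: (wH_algl a (ct u) (ct v) (Gam c z w)).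
Qed.
Lemma wH_linr c z (a : R) v (w w' : 'rV[R]_m) : cod c z ->
  wH c z v (a *: w + w') = a *: wH c z v w + wH c z v w'.
Proof.
move=> cz.
have d := smooth_diff (smooth_D (euv (th z v)) (smF c)) cz.
have e := D_dirP a (euv w) (euv w') d.
have E2 := eq_trans (@f_equal VE 'rV[R]_m (fun y : VE => 'D_y ('D_(euv (th z v)) (cF s c)) z) _ _
  (euvP a w w')) e.
apply: (eq_trans (f_equal2 (fun g d => ct v *: g - 2^-1 *: d) (GamP c z a w w') E2)).
exact: wH_algr.
Qed.
Lemma wN_linl c z (a : R) (u v : VE) (w : 'rV[R]_k) : cod c z ->
  wN c z (a *: u + v) w = a *: wN c z u w + wN c z v w.
Proof.
move=> cz.
have e := D2_dir a (euv (th z u)) (euv (th z v)) (eyv w) cz (smPsi c).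
have E : euv (th z (a *: u + v)) = a *: euv (th z u) + euv (th z v) :> VE.
  by rewrite thP euvP.
have E2 := eq_trans (@f_equal VE 'rV[R]_k (fun y : VE => 'D_(eyv w) ('D_y (cPsi s c)) z) _ _ E) e.
apply: (eq_trans (f_equal (fun d => - (ct (a *: u + v : VE) *: 'D_(eyv w) (cPsi s c) z)
  - d + UpsV Ups c.2 (cy z) (et c z (a *: u + v)) w) E2)).
rewrite ctP etP UpsV_linl.
exact: (wN_algl a (ct u) (ct v)).
Qed.
Lemma wN_linr c z (a : R) v (w w' : 'rV[R]_k) : cod c z ->
  wN c z v (a *: w + w') = a *: wN c z v w + wN c z v w'.
Proof.
move=> cz.
have d := smooth_diff (smooth_D (euv (th z v)) (smPsi c)) cz.
have e1 := D_dirP a (eyv w) (eyv w') (smooth_diff (smPsi c) cz).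
have e2 := D_dirP a (eyv w) (eyv w') d.
have E1 := eq_trans (@f_equal VE 'rV[R]_k (fun y : VE => 'D_y (cPsi s c) z) _ _ (eyvP a w w')) e1.
have E2 := eq_trans (@f_equal VE 'rV[R]_k (fun y : VE => 'D_y ('D_(euv (th z v)) (cPsi s c)) z) _ _
  (eyvP a w w')) e2.
have E3 := UpsV_linr c.2 (cy z) a w w' (et c z v).
apply: (eq_trans (f_equal2 (fun g d => - (ct v *: g) - d +
  UpsV Ups c.2 (cy z) (et c z v) (a *: w + w')) E1 E2)).
apply: (eq_trans (f_equal (fun x => _ + x) E3)).
exact: wN_algr.
Qed.
Lemma wH0 c z v : cod c z -> wH c z v 0 = 0.
Proof.
move=> cz; have := wH_linr (-1) v 0 0 cz.
by rewrite scaler0 addr0 scaleN1r addNr.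
Qed.
Lemma wN0 c z v : cod c z -> wN c z v 0 = 0.
Proof.
move=> cz; have := wN_linr (-1) v 0 0 cz.
by rewrite scaler0 addr0 scaleN1r addNr.
Qed.

Local Opaque tnabla wH wN th et ps.

Lemma tnabla_ext X X' Y Y' : vector_field X -> vector_field X' -> vector_field Y ->
  vector_field Y' -> eqf X X' -> eqf Y Y' -> eqf (nab X Y) (nab X' Y').
Proof.
move=> hX hX' hY hY' XX YY c z cz.
have XZ := XX _ _ cz; have YZ := YY _ _ cz; have N := eqf_near hE YY cz.
have nD n (f : VE -> VE -> 'rV[R]_n) v :
    'D_v (fun w => f w (Y c w)) z = 'D_v (fun w => f w (Y' c w)) z.
  by apply: near_eq_derive; apply: filterS N => w ->.
apply: (@frame_inj _ _ _ _ _ s c z).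
- apply: (eq_trans (ct_nabla hX hY cz)).
  apply: (eq_trans _ (esym (ct_nabla hX' hY' cz))).
  by rewrite XZ; apply: near_eq_derive; apply: filterS N => w ->.
- apply: (eq_trans (th_nabla hX hY cz)).
  apply: (eq_trans _ (esym (th_nabla hX' hY' cz))).
  by rewrite XZ YZ; apply: (f_equal (fun x => x + _)); exact: (nD _ th).
- apply: (eq_trans (et_nabla hX hY cz)).
  apply: (eq_trans _ (esym (et_nabla hX' hY' cz))).
  by rewrite XZ YZ; apply: (f_equal (fun x => x + _)); exact: (nD _ (et c)).
- apply: (eq_trans (ps_nabla hX hY cz)).
  apply: (eq_trans _ (esym (ps_nabla hX' hY' cz))).
  by rewrite XZ YZ; apply: (f_equal (fun x => x + _)); exact: (nD _ (ps c)).
Qed.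

Lemma linl_alg n (a : R) (d e p q : 'rV[R]_n) :
  a *: d + e + (a *: p + q) = a *: (d + p) + (e + q).
Proof. by rewrite scalerDr addrACA. Qed.

(** The dependence on [X] is through its value at [z], so [a] may be the value of a function there.
    Additivity is the case [a = 1], function-linearity the case of a zero [X']. *)
Lemma tnabla_linl c z (a : R) X X' X'' Y : vector_field X -> vector_field X' ->
  vector_field X'' -> vector_field Y -> cod c z ->
  X'' c z = a *: X c z + X' c z ->
  nab X'' Y c z = a *: nab X Y c z + nab X' Y c z.
Proof.
move=> hX hX' hX'' hY cz XE.
have dct := smooth_diff (sm_ct (vf_smooth c hY)) cz.
have dth := smooth_diff (sm_th (vf_smooth c hY)) cz.
have det := smooth_diff (sm_et (vf_smooth c hY)) cz.
have dps := smooth_diff (sm_ps (vf_smooth c hY)) cz.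
apply: (@frame_inj _ _ _ _ _ s c z).
- apply: (eq_trans (ct_nabla hX'' hY cz)).
  apply: (eq_trans _ (esym (f_equal2 (fun x y : R^o => a *: x + y)
    (ct_nabla hX hY cz) (ct_nabla hX' hY cz)))).
  rewrite XE; apply: (eq_trans (derive_dirD _ _ dct)).
  by apply: (f_equal (fun x => x + _)); exact: (derive_dirZ _ _ dct).
- apply: (eq_trans (th_nabla hX'' hY cz)).
  apply: (eq_trans _ (esym (thP z a _ _))).
  apply: (eq_trans _ (esym (f_equal2 (fun x y : 'rV[R]_m => a *: x + y)
    (th_nabla hX hY cz) (th_nabla hX' hY cz)))).
  rewrite XE; apply: (eq_trans (f_equal2 +%R (D_dirP a _ _ dth) (wH_linl a _ _ _ cz))).
  exact: linl_alg.
- apply: (eq_trans (et_nabla hX'' hY cz)).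
  apply: (eq_trans _ (esym (etP c z a _ _))).
  apply: (eq_trans _ (esym (f_equal2 (fun x y : 'rV[R]_k => a *: x + y)
    (et_nabla hX hY cz) (et_nabla hX' hY cz)))).
  rewrite XE; apply: (eq_trans (f_equal2 +%R (D_dirP a _ _ det) (wN_linl a _ _ _ cz))).
  exact: linl_alg.
- apply: (eq_trans (ps_nabla hX'' hY cz)).
  apply: (eq_trans _ (esym (psP c z a _ _))).
  apply: (eq_trans _ (esym (f_equal2 (fun x y : 'rV[R]_m => a *: x + y)
    (ps_nabla hX hY cz) (ps_nabla hX' hY cz)))).
  rewrite XE; apply: (eq_trans (f_equal2 +%R (D_dirP a _ _ dps) (wH_linl a _ _ _ cz))).
  exact: linl_alg.
Qed.

Lemma leib_alg n (a a' : R) (y d d' p p' : 'rV[R]_n) :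
  a' *: y + a *: d + d' + (a *: p + p') =
  a' *: y + (a *: (d + p) + (d' + p')).
Proof. by apply/rowP => i; rewrite !mxE; ring. Qed.

(** The relation is imposed on the whole chart because [Y''] is differentiated. The case [f = 1]
    gives additivity, the case of a zero [Y'] the Leibniz rule. *)
Lemma tnabla_linr c z (f : VE -> R^o) X Y Y' Y'' : vector_field X -> vector_field Y ->
  vector_field Y' -> vector_field Y'' -> cod c z -> smooth_on (cod c) f ->
  (forall w, cod c w -> Y'' c w = f w *: Y c w + Y' c w) ->
  nab X Y'' c z = 'D_(X c z) f z *: Y c z + (f z *: nab X Y c z + nab X Y' c z).
Proof.
move=> hX hY hY' hY'' cz sf YE.
have df := smooth_diff sf cz; have Yz := YE _ cz.
have N : \forall w \near z, Y'' c w = f w *: Y c w + Y' c w.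
  by apply: filterS (near_cod hE cz) => w /YE.
have dd n (g g' : VE -> 'rV[R]_n) (h : VE -> 'rV[R]_n) v :
    (\forall w \near z, h w = f w *: g w + g' w) ->
    differentiable g z -> differentiable g' z ->
    'D_v h z = 'D_v f z *: g z + f z *: 'D_v g z + 'D_v g' z.
  move=> Nh dg dg'.
  rewrite (near_eq_derive v Nh) (derive_addf v (differentiable_scale df dg) dg').
  by rewrite (derive_scale v df dg).
apply: (@frame_inj _ _ _ _ _ s c z).
- have dct := smooth_diff (sm_ct (vf_smooth c hY)) cz.
  have dct' := smooth_diff (sm_ct (vf_smooth c hY')) cz.
  have Nh : \forall w \near z, ct (Y'' c w) = f w *: (ct (Y c w) : R^o) + ct (Y' c w).
    by apply: filterS N => w ->; rewrite ctP.
  apply: (eq_trans (ct_nabla hX hY'' cz)).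
  apply: (eq_trans (near_eq_derive (X c z) Nh)).
  apply: (eq_trans (derive_addf (X c z) (differentiable_scale df dct) dct')).
  apply: (eq_trans (f_equal (fun x : R^o => x + _) (derive_scale (X c z) df dct))).
  apply: (eq_trans (esym (addrA _ _ _))).
  apply: (f_equal (fun x : R^o => _ + x)); apply: esym.
  exact: (f_equal2 (fun x y : R^o => f z *: x + y)
    (ct_nabla hX hY cz) (ct_nabla hX hY' cz)).
- have d := smooth_diff (sm_th (vf_smooth c hY)) cz.
  have d' := smooth_diff (sm_th (vf_smooth c hY')) cz.
  have Nh : \forall w \near z, th w (Y'' c w) = f w *: th w (Y c w) + th w (Y' c w).
    by apply: filterS N => w ->; exact: (thP w).
  apply: (eq_trans (th_nabla hX hY'' cz)).
  have e1 : th z (Y'' c z) = f z *: th z (Y c z) + th z (Y' c z) by rewrite Yz; exact: (thP z).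
  rewrite e1.
  apply: (eq_trans (f_equal2 +%R (dd _ _ _ _ (X c z) Nh d d') (wH_linr (f z) _ _ _ cz))).
  apply: (eq_trans (leib_alg _ _ _ _ _ _ _)).
  apply: esym; apply: (eq_trans ((thP z) _ _ _)); apply: (f_equal (fun x => _ + x)).
  apply: (eq_trans ((thP z) _ _ _)).
  exact: (f_equal2 (fun x y : 'rV[R]_m => f z *: x + y)
    (th_nabla hX hY cz) (th_nabla hX hY' cz)).
- have d := smooth_diff (sm_et (vf_smooth c hY)) cz.
  have d' := smooth_diff (sm_et (vf_smooth c hY')) cz.
  have Nh : \forall w \near z, et c w (Y'' c w) = f w *: et c w (Y c w) + et c w (Y' c w).
    by apply: filterS N => w ->; exact: (etP c w).
  apply: (eq_trans (et_nabla hX hY'' cz)).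
  have e1 : et c z (Y'' c z) = f z *: et c z (Y c z) + et c z (Y' c z) by rewrite Yz; exact: (etP c z).
  rewrite e1.
  apply: (eq_trans (f_equal2 +%R (dd _ _ _ _ (X c z) Nh d d') (wN_linr (f z) _ _ _ cz))).
  apply: (eq_trans (leib_alg _ _ _ _ _ _ _)).
  apply: esym; apply: (eq_trans ((etP c z) _ _ _)); apply: (f_equal (fun x => _ + x)).
  apply: (eq_trans ((etP c z) _ _ _)).
  exact: (f_equal2 (fun x y : 'rV[R]_k => f z *: x + y)
    (et_nabla hX hY cz) (et_nabla hX hY' cz)).
- have d := smooth_diff (sm_ps (vf_smooth c hY)) cz.
  have d' := smooth_diff (sm_ps (vf_smooth c hY')) cz.
  have Nh : \forall w \near z, ps c w (Y'' c w) = f w *: ps c w (Y c w) + ps c w (Y' c w).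
    by apply: filterS N => w ->; exact: (psP c w).
  apply: (eq_trans (ps_nabla hX hY'' cz)).
  have e1 : ps c z (Y'' c z) = f z *: ps c z (Y c z) + ps c z (Y' c z) by rewrite Yz; exact: (psP c z).
  rewrite e1.
  apply: (eq_trans (f_equal2 +%R (dd _ _ _ _ (X c z) Nh d d') (wH_linr (f z) _ _ _ cz))).
  apply: (eq_trans (leib_alg _ _ _ _ _ _ _)).
  apply: esym; apply: (eq_trans ((psP c z) _ _ _)); apply: (f_equal (fun x => _ + x)).
  apply: (eq_trans ((psP c z) _ _ _)).
  exact: (f_equal2 (fun x y : 'rV[R]_m => f z *: x + y)
    (ps_nabla hX hY cz) (ps_nabla hX hY' cz)).
Qed.

Local Opaque tnabla wH wN th et ps euv eyv Hv tGamma bracket.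

Lemma scale1_add (V : lmodType R) (x y : V) : 1 *: x + y = x + y.
Proof. by rewrite scale1r. Qed.
Lemma zero_lin (V : lmodType R) (a : R) : (0 : V) = a *: 0 + 0.
Proof. by rewrite scaler0 addr0. Qed.
Lemma eq0_opp (V : lmodType R) (x : V) : x = - 1 *: x + x -> x = 0.
Proof. by rewrite scaleN1r addNr. Qed.
Lemma eq0_leib (V : lmodType R) (x : V) : x = (0 : R) *: (0 : V) + (1 *: x + x) -> x = 0.
Proof.
rewrite scale0r add0r scale1r => x2.
by apply: (addrI x); rewrite addr0 -x2.
Qed.
Lemma leib_one (V : lmodType R) (x y w : V) : (0 : R) *: w + (1 *: x + y) = x + y.
Proof. by rewrite scale0r add0r scale1r. Qed.

Lemma tnabla0r c z X : vector_field X -> cod c z -> nab X (zerof E) c z = 0.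
Proof.
move=> hX cz; have h0 : vector_field (zerof E) by exact: vf_zero.
have e (w : VE) : cod c w -> zerof E c w = (1 : R^o) *: zerof E c w + zerof E c w.
  by move=> _; exact: (@zero_lin VE 1).
have L := tnabla_linr hX h0 h0 h0 cz (@smooth_cst R VE R^o (cod c) 1) e.
have z1 : 'D_(X c z) (fun=> 1 : R^o) z = 0 by exact: derive_cst.
by rewrite z1 in L; exact: (eq0_leib L).
Qed.

Lemma tnabla0l c z Y : vector_field Y -> cod c z -> nab (zerof E) Y c z = 0.
Proof.
move=> hY cz; have h0 : vector_field (zerof E) by exact: vf_zero.
have e : zerof E c z = (-1) *: zerof E c z + zerof E c z.
  exact: (@zero_lin VE (-1)).
exact: (eq0_opp (tnabla_linl h0 h0 h0 hY cz e)).
Qed.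

Lemma tnabla_connection : linear_connection nab.
Proof.
have h0 : vector_field (zerof E) by exact: vf_zero.
split.
- move=> X Y hX hY; exact (vf_tnabla hX hY).
- exact (tnabla_ext).
- move=> X X' Y hX hX' hY c z cz.
  have e : addf X X' c z = 1 *: X c z + X' c z by exact: (esym (scale1_add _ _)).
  have L := tnabla_linl hX hX' (vf_add hE hX hX') hY cz e.
  exact: (eq_trans L (scale1_add _ _)).
- move=> f X Y sf hX hY c z cz.
  have e : scalef f X c z = lrep c f z *: X c z + zerof E c z by exact: (esym (addr0 _)).
  have L := tnabla_linl hX h0 (vf_scale hE sf hX) hY cz e.
  apply: (eq_trans L); apply: (eq_trans (f_equal (fun x => _ + x) (tnabla0l hY cz))).
  exact: addr0.
- move=> X Y Y' hX hY hY' c z cz.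
  have sm := @smooth_cst R VE R^o (cod c) 1.
  have e (w : VE) : cod c w -> addf Y Y' c w = (1 : R^o) *: Y c w + Y' c w.
    by move=> _; exact: (esym (scale1_add _ _)).
  have L := tnabla_linr hX hY hY' (vf_add hE hY hY') cz sm e.
  have z1 : 'D_(X c z) (fun=> 1 : R^o) z = 0 by exact: derive_cst.
  by rewrite z1 in L; exact: (eq_trans L (leib_one _ _ _)).
- move=> f X Y sf hX hY c z cz.
  have e (w : VE) : cod c w -> scalef f Y c w = lrep c f w *: Y c w + zerof E c w.
    by move=> _; exact: (esym (addr0 _)).
  have L := tnabla_linr hX hY h0 (vf_scale hE sf hY) cz (sf c) e.
  apply: (eq_trans L); apply: (f_equal (fun x => _ + x)).
  apply: (eq_trans (f_equal (fun x => _ + x) (tnabla0r hX cz))).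
  exact: addr0.
Qed.

Lemma wHE c z v w : wH c z v w = ct v *: Gam c z w -
  2^-1 *: 'D_(euv w) ('D_(euv (th z v)) (cF s c)) z.
Proof. by []. Qed.
Lemma wNE c z v w : wN c z v w = - (ct v *: 'D_(eyv w) (cPsi s c) z) -
  'D_(eyv w) ('D_(euv (th z v)) (cPsi s c)) z + UpsV Ups c.2 (cy z) (et c z v) w.
Proof. by []. Qed.
Lemma UpsV0l (c : chart M2) q (w : 'rV[R]_k) : UpsV Ups c q 0 w = 0.
Proof.
apply/rowP => l; rewrite !mxE big1 // => i _; rewrite big1 // => j _.
by rewrite mxE mulr0 mul0r.
Qed.
Lemma zsub (V : zmodType) (x y : V) : x = y -> x - y = 0.
Proof. by move=> ->; rewrite subrr. Qed.
Lemma zadd (V : zmodType) (x y : V) : x = 0 -> y = 0 -> x + y = 0.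
Proof. by move=> -> ->; rewrite addr0. Qed.
Local Opaque euv eyv Hv tGamma bracket tnabla wH wN th et ps dth dfr.

(** * The parallelism and torsion conditions for [tnabla] *)

Lemma DD0 n (f : VE -> 'rV[R]_n) z w (y : VE) : y = 0 -> 'D_w ('D_y f) z = 0.
Proof. by move=> ->; apply: derive_fun0 => x; exact: derive0. Qed.

Lemma near_cst (W : normedModType R) (f : VE -> W) z v (a : W) :
  (\forall w \near z, f w = a) -> 'D_v f z = 0.
Proof.
move=> N; apply: (eq_trans (@near_eq_derive _ _ _ f (fun=> a) z v N)).
exact: derive_cst.
Qed.

Lemma wHV_alg n (a b : 'rV[R]_n) : b = 0 -> (0 : R) *: a - 2^-1 *: b = 0.
Proof. by move=> ->; rewrite scale0r scaler0 subr0. Qed.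
Lemma wHG_alg n (a b : 'rV[R]_n) : b = 0 -> (1 : R) *: a - 2^-1 *: b = a.
Proof. by move=> ->; rewrite scale1r scaler0 subr0. Qed.
Lemma wNV_alg n (a b u : 'rV[R]_n) : b = 0 -> - ((0 : R) *: a) - b + u = u.
Proof. by move=> ->; rewrite scale0r !oppr0 !add0r. Qed.
Lemma wNG_alg n (a b u : 'rV[R]_n) : b = 0 -> u = 0 -> - ((1 : R) *: a) - b + u = - a.
Proof. by move=> -> ->; rewrite scale1r subr0 addr0. Qed.

(** [wH] involves [v] through dt and theta only, so it vanishes along V_a and the x^alpha
    directions; of [wN] at most the [Ups] term survives there. *)
Lemma wHV c z v w : ct v = 0 -> th z v = 0 -> wH c z v w = 0.
Proof.
move=> c0 t0; rewrite wHE c0 t0; by apply: wHV_alg; apply: DD0; exact: euv0.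
Qed.
Lemma wHG c z w : wH c z (tG c z) w = Gam c z w.
Proof.
rewrite wHE ctG thG; apply: wHG_alg; apply: DD0; exact: euv0.
Qed.
Lemma wNV c z v w : ct v = 0 -> th z v = 0 ->
  wN c z v w = UpsV Ups c.2 (cy z) (et c z v) w.
Proof.
move=> c0 t0; rewrite wNE c0 t0; apply: wNV_alg; apply: DD0; exact: euv0.
Qed.
Lemma wNG c z w : wN c z (tG c z) w = - 'D_(eyv w) (cPsi s c) z.
Proof.
rewrite wNE ctG thG etG; apply: wNG_alg; last exact: UpsV0l.
by apply: DD0; exact: euv0.
Qed.

Lemma blockH0 c z v (f : VE -> 'rV[R]_m) : cod c z -> (forall w, f w = 0) ->
  'D_v f z + wH c z v (f z) = 0.
Proof.
move=> cz f0; apply: zadd; first exact: derive_fun0.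
by rewrite f0; exact: (wH0 v cz).
Qed.
Lemma blockN0 c z v (f : VE -> 'rV[R]_k) : cod c z -> (forall w, f w = 0) ->
  'D_v f z + wN c z v (f z) = 0.
Proof.
move=> cz f0; apply: zadd; first exact: derive_fun0.
by rewrite f0; exact: (wN0 v cz).
Qed.

Section Fixed.
Variables (c : chart E) (z : VE) (X Y : field E).
Hypotheses (cz : cod c z) (hX : vector_field X) (hY : vector_field Y).

Lemma th_nab0 : (forall w, th w (Y c w) = 0) -> th z (nab X Y c z) = 0.
Proof.
move=> f0; apply: (eq_trans (th_nabla hX hY cz)).
exact: (blockH0 _ cz f0).
Qed.
Lemma ps_nab0 : (forall w, ps c w (Y c w) = 0) -> ps c z (nab X Y c z) = 0.
Proof.
move=> f0; apply: (eq_trans (ps_nabla hX hY cz)).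
exact: (blockH0 _ cz f0).
Qed.
Lemma et_nab0 : (forall w, et c w (Y c w) = 0) -> et c z (nab X Y c z) = 0.
Proof.
move=> f0; apply: (eq_trans (et_nabla hX hY cz)).
exact: (blockN0 _ cz f0).
Qed.
Lemma ct_nab0 (a : R) : (forall w, ct (Y c w) = a) -> ct (nab X Y c z) = 0.
Proof.
move=> f0; apply: (eq_trans (ct_nabla hX hY cz)).
have -> : (fun w => ct (Y c w) : R^o) = fun=> a by apply/funext.
exact: derive_cst.
Qed.

End Fixed.

Lemma nab_Gamma c z X : cod c z -> vector_field X -> nab X tG c z = 0.
Proof.
move=> cz hX; have hG : vector_field tG := vf_tG.
apply: (@frame_inj _ _ _ _ _ s c z).
- by apply: (ct_nab0 cz hX hG (a := 1)) => w; exact: ctG.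
- rewrite th0; apply: (th_nab0 cz hX hG) => w; exact: thG.
- rewrite et0; apply: (et_nab0 cz hX hG) => w; exact: etG.
- rewrite ps0; apply: (ps_nab0 cz hX hG) => w; exact: psG.
Qed.

Lemma nab_dt c z X Y : cod c z -> vector_field X -> vector_field Y ->
  'D_(X c z) (fun w => ct (Y c w)) z - ct (nab X Y c z) = 0.
Proof.
move=> cz hX hY; apply: zsub; apply: esym.
exact: (ct_nabla hX hY cz).
Qed.

Lemma nab_S c z X Y : cod c z -> vector_field X -> vector_field Y ->
  nab X (tS Y) c z = tS (nab X Y) c z.
Proof.
move=> cz hX hY; have hS := vf_tS hY.
rewrite (tSz (nab X Y)).
apply: (@frame_inj _ _ _ _ _ s c z).
- rewrite ctU; apply: (ct_nab0 cz hX hS (a := 0)) => w; by rewrite tSz ctU.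
- rewrite thU; apply: (th_nab0 cz hX hS) => w; by rewrite tSz thU.
- rewrite etU; apply: (et_nab0 cz hX hS) => w; by rewrite tSz etU.
- rewrite psU; apply: (eq_trans (ps_nabla hX hS cz)).
  apply: (eq_trans _ (esym (th_nabla hX hY cz))).
  have f1 w : ps c w (tS Y c w) = th w (Y c w) by rewrite tSz psU.
  have f2 : (fun w => ps c w (tS Y c w)) = (fun w => th w (Y c w)) by apply/funext.
  by rewrite f1 f2.
Qed.

Lemma nab_Q c z X Y : cod c z -> vector_field X -> vector_field Y ->
  nab X (tQ Y) c z = tQ (nab X Y) c z.
Proof.
move=> cz hX hY; have hQ := vf_tQ hY.
rewrite (tQz (nab X Y)).
apply: (@frame_inj _ _ _ _ _ s c z).
- rewrite ctH; apply: (ct_nab0 cz hX hQ (a := 0)) => w; by rewrite tQz ctH.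
- rewrite thH; apply: (eq_trans (th_nabla hX hQ cz)).
  apply: (eq_trans _ (esym (ps_nabla hX hY cz))).
  have f1 w : th w (tQ Y c w) = ps c w (Y c w) by rewrite tQz thH.
  have f2 : (fun w => th w (tQ Y c w)) = (fun w => ps c w (Y c w)) by apply/funext.
  by rewrite f1 f2.
- rewrite etH; apply: (et_nab0 cz hX hQ) => w; by rewrite tQz etH.
- rewrite psH; apply: (ps_nab0 cz hX hQ) => w; by rewrite tQz psH.
Qed.

Lemma nab_N c z X Y : cod c z -> vector_field X -> vector_field Y ->
  nab X (PN Y) c z = PN (nab X Y) c z.
Proof.
move=> cz hX hY; have hN := vf_PN hY.
rewrite (PNz (nab X Y)).
apply: (@frame_inj _ _ _ _ _ s c z).
- rewrite ctY; apply: (ct_nab0 cz hX hN (a := 0)) => w; by rewrite PNz ctY.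
- rewrite thY; apply: (th_nab0 cz hX hN) => w; by rewrite PNz thY.
- rewrite etY; apply: (eq_trans (et_nabla hX hN cz)).
  apply: (eq_trans _ (esym (et_nabla hX hY cz))).
  have f1 w : et c w (PN Y c w) = et c w (Y c w) by rewrite PNz etY.
  have f2 : (fun w => et c w (PN Y c w)) = (fun w => et c w (Y c w)) by apply/funext.
  by rewrite f1 f2.
- rewrite psY; apply: (ps_nab0 cz hX hN) => w; by rewrite PNz psY.
Qed.

Lemma agree_near c A X (V : VE -> VE) p : chart_open c A -> A p -> agree_on c A X V ->
  \forall w \near coord c p, X c w = V w.
Proof.
move=> [oA AD] Ap XV; apply: filterS (mopen_near oA (AD _ Ap) Ap) => w [q [Aq _] <-].
exact: XV.
Qed.

Lemma nab_VV c z X Y (u w : 'rV[R]_m) : cod c z -> vector_field X -> vector_field Y ->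
  X c z = euv u -> (\forall x \near z, Y c x = euv w) -> nab X Y c z = 0.
Proof.
move=> cz hX hY Xz N; have Yz := nbhs_singleton N.
have cX : ct (X c z) = 0 by rewrite Xz ctU.
have tX : th z (X c z) = 0 by rewrite Xz thU.
apply: (@frame_inj _ _ _ _ _ s c z).
- apply: (eq_trans (ct_nabla hX hY cz)); rewrite ct0.
  by apply: (@near_cst _ _ _ _ 0); apply: filterS N => x ->; exact: ctU.
- apply: (eq_trans (th_nabla hX hY cz)); rewrite th0.
  apply: zadd; last exact: wHV.
  by apply: (@near_cst _ _ _ _ 0); apply: filterS N => x ->; exact: thU.
- apply: (eq_trans (et_nabla hX hY cz)); rewrite et0.
  apply: zadd; last by rewrite Yz etU; exact: (wN0 _ cz).
  by apply: (@near_cst _ _ _ _ 0); apply: filterS N => x ->; exact: etU.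
- apply: (eq_trans (ps_nabla hX hY cz)); rewrite ps0.
  apply: zadd; last exact: wHV.
  by apply: (@near_cst _ _ _ _ w); apply: filterS N => x ->; exact: psU.
Qed.

Lemma nab_YY c z X Y (u w : 'rV[R]_k) : cod c z -> vector_field X -> vector_field Y ->
  X c z = eyv u -> (\forall x \near z, Y c x = eyv w) ->
  nab X Y c z = eyv (UpsV Ups c.2 (cy z) u w).
Proof.
move=> cz hX hY Xz N; have Yz := nbhs_singleton N.
have cX : ct (X c z) = 0 by rewrite Xz ctY.
have tX : th z (X c z) = 0 by rewrite Xz thY.
apply: (@frame_inj _ _ _ _ _ s c z).
- apply: (eq_trans (ct_nabla hX hY cz)); rewrite ctY.
  by apply: (@near_cst _ _ _ _ 0); apply: filterS N => x ->; exact: ctY.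
- apply: (eq_trans (th_nabla hX hY cz)); rewrite thY.
  apply: zadd; last exact: wHV.
  by apply: (@near_cst _ _ _ _ 0); apply: filterS N => x ->; exact: thY.
- apply: (eq_trans (et_nabla hX hY cz)); rewrite etY.
  have D0 : 'D_(X c z) (fun x => et c x (Y c x)) z = 0.
    by apply: (@near_cst _ _ _ _ w); apply: filterS N => x ->; exact: etY.
  rewrite D0 (wNV _ _ cX tX) Xz Yz !etY; exact: add0r.
- apply: (eq_trans (ps_nabla hX hY cz)); rewrite psY.
  apply: zadd; last exact: wHV.
  by apply: (@near_cst _ _ _ _ 0); apply: filterS N => x ->; exact: psY.
Qed.

Lemma brG_alg n (g d x f p : 'rV[R]_n) (t : R) : p = x - t *: f + g ->
  d - 0 - (- (t *: f) - - ((1 : R) *: x)) = d + g - p.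
Proof. by move=> ->; apply/rowP => i; rewrite !mxE; ring. Qed.

Lemma psE c z v : ps c z v = cu v - ct v *: cF s c z + Gam c z (th z v).
Proof. by []. Qed.

Lemma th_brG c z X : cod c z -> vector_field X ->
  th z (bracket tG X c z) = 'D_(tG c z) (fun w => th w (X c w)) z +
    Gam c z (th z (X c z)) - ps c z (X c z).
Proof.
move=> cz hX; have sG := vf_smooth c (vf_tG).
apply: (eq_trans (th_br sG (vf_smooth c hX) cz)).
have z2 : 'D_(X c z) (fun w => th w (tG c w)) z = 0.
  by apply: derive_fun0 => w; exact: thG.
rewrite z2 !dthE ctG cuG; apply: brG_alg; exact: psE.
Qed.

Lemma th_nabG c z X : cod c z -> vector_field X ->
  th z (nab tG X c z) = 'D_(tG c z) (fun w => th w (X c w)) z + Gam c z (th z (X c z)).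
Proof.
move=> cz hX; apply: (eq_trans (th_nabla (vf_tG) hX cz)).
by rewrite wHG.
Qed.

Lemma tor_alg (V : zmodType) (a b : V) : a - (a - b) = b.
Proof. by rewrite opprB addrC subrK. Qed.

(** The first two terms of [th_brG] are those of [th_nabG], so the torsion retains only the psi term
    of the bracket. *)
Lemma th_torG c z X : cod c z -> vector_field X ->
  th z (torsion nab tG X c z) = ps c z (X c z).
Proof.
move=> cz hX.
have -> : torsion nab tG X c z = nab tG X c z - nab X tG c z - bracket tG X c z by [].
rewrite (nab_Gamma cz hX) 2!thB th0 (th_brG cz hX) (th_nabG cz hX) subr0.
exact: tor_alg.
Qed.

Lemma torPH_alg (V : zmodType) (n b pv ph w : V) : n - b = pv -> w - b = pv - ph ->
  n - 0 - w = ph.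
Proof.
move=> e1 e2; have -> : w = pv - ph + b by rewrite -e2 subrK.
by rewrite -e1 subr0 addrAC subrK tor_alg.
Qed.

(** Since Gamma and S are parallel, the torsion is S applied to the derivative of [X] along Gamma,
    minus [Gamma, S X]. The first term differs from S([Gamma, X]) by P_V X, and [lieS] says that
    [Gamma, S X] differs from it by P_V X - P_H X. *)
Lemma tor_PH c z X : cod c z -> vector_field X ->
  PH X c z = torsion nab tG (tS X) c z.
Proof.
move=> cz hX; have hS := vf_tS hX; have hG : vector_field tG := vf_tG.
have -> : torsion nab tG (tS X) c z =
  nab tG (tS X) c z - nab (tS X) tG c z - bracket tG (tS X) c z by [].
rewrite (nab_Gamma cz hS) (nab_S cz hG hX); apply: esym.
apply: (@torPH_alg _ _ (tS (bracket tG X) c z) (PV X c z)); last exact: (lieS hX cz).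
rewrite !tSz PVz (th_brG cz hX) (th_nabG cz hX).
have euvB (a b : 'rV[R]_m) : euv a - euv b = euv (a - b) :> VE.
  by apply: esym; exact: (linearB (@euvL R m k)).
by rewrite euvB tor_alg.
Qed.

Lemma tor_PV c z X : cod c z -> vector_field X ->
  PV X c z = tS (torsion nab tG X) c z.
Proof.
by move=> cz hX; rewrite (tSz (torsion nab tG X)) PVz (th_torG cz hX).
Qed.

Lemma th_sub3 z (a b d : VE) p q r : th z a = p -> th z b = q -> th z d = r ->
  th z (a - b - d) = p - q - r.
Proof. by move=> <- <- <-; rewrite 2!thB. Qed.
Lemma et_sub3 c z (a b d : VE) p q r : et c z a = p -> et c z b = q -> et c z d = r ->
  et c z (a - b - d) = p - q - r.
Proof. by move=> <- <- <-; rewrite 2!etB. Qed.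
Lemma ps_sub3 c z (a b d : VE) p q r : ps c z a = p -> ps c z b = q -> ps c z d = r ->
  ps c z (a - b - d) = p - q - r.
Proof. by move=> <- <- <-; rewrite 2!psB. Qed.

Lemma torN_alg n (d g w : 'rV[R]_n) : w = g -> 
  d + w - (0 + 0) - (d - 0 - (0 - g)) = 0.
Proof. by move=> ->; apply/rowP => i; rewrite !mxE; ring. Qed.
Lemma torN_alg2 n (t : R) (a b : 'rV[R]_n) :
  - (t *: a) - b + 0 = - (t *: a) - (1 : R) *: b + (1 : R) *: (t *: 0).
Proof. by rewrite scale1r !scaler0. Qed.
Lemma torNth_alg n (d : 'rV[R]_n) (x : 'rV[R]_n) :
  d + 0 - (x + 0) - (d - x - (0 - 0)) = 0.
Proof. by apply/rowP => i; rewrite !mxE; ring. Qed.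

(** Since eta vanishes on [X - PN X], the [Ups] term of [wN] drops out, and the other terms cancel
    against the exterior derivative of eta in the bracket. In the psi component both sides agree by
    the definition of [PV]. *)
Lemma tor_N c z X Y : cod c z -> vector_field X -> vector_field Y ->
  torsion nab (subf X (PN X)) (PN Y) c z = PV (torsion nab (subf X (PN X)) (PN Y)) c z.
Proof.
move=> cz hX hY; have hN := vf_PN hY.
have hX' := vf_sub hE hX (vf_PN hX).
have eX w : et c w (subf X (PN X) c w) = 0 by rewrite /subf etB PNz etY subrr.
(* The first field is generalized to one with vanishing eta, the second to one along the x^alpha
   directions; these are the properties that the calculation uses. *)
move: (subf X (PN X)) hX' eX => X' hX' eX.
have NE w : PN Y c w = eyv (et c w (Y c w)) by rewrite PNz.
move: (PN Y) hN NE => N hN NE.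
have sX := vf_smooth c hX'; have sN := vf_smooth c hN.
have cN : ct (N c z) = 0 by rewrite NE ctY.
have tN : th z (N c z) = 0 by rewrite NE thY.
rewrite (PVz (torsion _ _ _)).
have tE : torsion nab X' N c z = nab X' N c z - nab N X' c z - bracket X' N c z by [].
apply: (@frame_inj _ _ _ _ _ s c z).
- rewrite ctU tE [LHS]ctB [X in X - _]ctB; apply: zsub.
  rewrite (ct_br sX sN cz).
  exact: (f_equal2 (fun x y : R => x - y) (ct_nabla hX' hN cz)
    (ct_nabla hN hX' cz)).
- apply: (eq_trans _ (esym (thU z _))); rewrite tE.
  have A1 := th_nabla hX' hN cz.
  have A2 := th_nabla hN hX' cz.
  have A3 := th_br sX sN cz.
  have B1 : wH c z (X' c z) (th z (N c z)) = 0 by rewrite tN; exact: (wH0 _ cz).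
  have B2 : wH c z (N c z) (th z (X' c z)) = 0 by exact: wHV.
  have C1 : dth (X' c z) (N c z) = 0 by exact: dth_0.
  have C2 : dth (N c z) (X' c z) = 0 by rewrite dthE NE cuY scaler0 oppr0.
  rewrite B1 in A1; rewrite B2 in A2; rewrite C1 C2 in A3.
  apply: (eq_trans (th_sub3 A1 A2 A3)).
  exact: torNth_alg.
- apply: (eq_trans _ (esym (etU c z _))); rewrite tE.
  have A1 := et_nabla hX' hN cz.
  have A2 := et_nabla hN hX' cz.
  have A3 := et_br sX sN cz.
  have D0 : 'D_(N c z) (fun w => et c w (X' c w)) z = 0 by exact: derive_fun0.
  have B2 : wN c z (N c z) (et c z (X' c z)) = 0.
    by rewrite eX; exact: (wN0 _ cz).
  have C1 : dfr 1 (cPsi s c) z (X' c z) (N c z) = 0 by exact: (dfr_00 _ _ _ cN tN).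
  rewrite D0 B2 in A2; rewrite D0 C1 in A3.
  apply: (eq_trans (et_sub3 A1 A2 A3)).
  apply: torN_alg.
  have P0 : 'D_(euv (cu (N c z))) (cPsi s c) z = 0 by rewrite NE cuY euv0; exact: derive0.
  rewrite wNE dfrE P0 eX UpsV0l (NE z) etY.
  exact: torN_alg2.
- by rewrite psU.
Qed.

(** * Curvature *)

Lemma ct_sub3 (a b d : VE) (p q r : R^o) : ct a = p -> ct b = q -> ct d = r ->
  ct (a - b - d) = p - q - r.
Proof. by move=> <- <- <-. Qed.
Lemma bracketE X Y c z : bracket X Y c z = 'D_(X c z) (Y c) z - 'D_(Y c z) (X c) z.
Proof. by []. Qed.
Local Opaque euv eyv Hv tGamma bracket tnabla wH wN th et ps dth dfr Gam.

Lemma flat_alg (V : zmodType) (a b d : V) : a = b -> a - (b + d) - - d = 0.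
Proof. by move=> ->; rewrite opprK opprD addrA subrr add0r addNr. Qed.

Section Flat.
Variables (c : chart E) (z e : VE) (Ga : VE -> VE).
Hypotheses (cz : cod c z) (sGa : smooth_on (cod c) Ga).

Let dGa : differentiable Ga z. Proof. exact: smooth_diff sGa cz. Qed.
Let did : differentiable (fun w : VE => w) z.
Proof. exact: (smooth_diff (D_id_smooth (cod c)) cz). Qed.
Let D_id (v : VE) : 'D_v (fun w : VE => w) z = v. Proof. exact: derive_id. Qed.

(** For the constant direction [e] the bracket of [Ga] with [e] is [- 'D_e Ga], so the expression is
    the curvature of plain differentiation along [Ga] and [e]. It vanishes by Schwarz. *)
Lemma flat_curv (W : normedModType R) (hW : findim W) (f : VE -> W) :
  smooth_on (cod c) f ->
  'D_(Ga z) ('D_e f) z - 'D_e (fun w => 'D_(Ga w) f w) z - 'D_(- 'D_e Ga z) f z = 0.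
Proof.
move=> sf; have df := smooth_diff sf cz.
have E1 := derive_dir (hW := findim_VE) (b := fun w : VE => w) e (@oE c) cz sf did dGa.
rewrite D_id in E1.
have E2 := derive_dirN ('D_e Ga z) df.
have E3 := Schwarz (hW := hW) e (Ga z) (@oE c) cz sf.
apply: (eq_trans (f_equal2 (fun x y : W => 'D_(Ga z) ('D_e f) z - x - y) E1 E2)).
exact: (flat_alg _ E3).
Qed.

Section Twist.
Variables (n : nat) (iota : 'rV[R]_n -> VE) (f G : VE -> 'rV[R]_n) (kap : R).
Hypothesis D_iota : forall (g : VE -> 'rV[R]_n) v, differentiable g z ->
  'D_v (fun w => iota (g w)) z = iota ('D_v g z).
Hypothesis d_iota : forall g : VE -> 'rV[R]_n, smooth_on (cod c) g ->
  smooth_on (cod c) (fun w => iota (g w)).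
Hypotheses (sf : smooth_on (cod c) f) (sG : smooth_on (cod c) G).

Lemma twist_curv : 'D_e (fun w => 'D_(iota (f w)) G w) z =
  'D_(iota (f z)) ('D_e G) z + 'D_(iota ('D_e f z)) G z.
Proof.
have df := smooth_diff sf cz.
have E1 := derive_dir (hW := findim_VE) (b := fun w : VE => w) e (@oE c) cz sG did
  (smooth_diff (d_iota sf) cz).
rewrite D_id (D_iota _ df) in E1.
apply: (eq_trans E1); apply: (f_equal (fun x => x + _)).
exact: (Schwarz (hW := findim_rV n) (iota (f z)) e (@oE c) cz sG).
Qed.

Lemma leib0 (a b : 'rV[R]_n) : (0 : R) *: a + kap *: b = kap *: b.
Proof. by rewrite scale0r add0r. Qed.
Lemma curv_alg (a b d p q : 'rV[R]_n) : a - b - d = 0 ->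
  a + kap *: p - (b + kap *: (q + p) + 0) - (d - kap *: q) = 0.
Proof.
by move=> /rowP h; apply/rowP => i; move: (h i); rewrite !mxE => hi; rewrite -[RHS]hi; ring.
Qed.

(** The connection form is the [kap] term along [Ga], zero along [e] (the summand 0) and the last
    [kap] term along the bracket. Of the two terms produced by [twist_curv], one cancels against the
    form applied to ['D_e f], the other against the form of the bracket; the rest is [flat_curv]. *)
Lemma curv_zero :
  'D_(Ga z) ('D_e f) z + kap *: 'D_(iota ('D_e f z)) G z
  - ('D_e (fun w => 'D_(Ga w) f w + kap *: 'D_(iota (f w)) G w) z + 0)
  - ('D_(- 'D_e Ga z) f z - kap *: 'D_(iota (f z)) ('D_e G) z) = 0.
Proof.
have s1 : smooth_on (cod c) (fun w => 'D_(Ga w) f w) by exact: (smooth_dirU (@oE c) sf sGa).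
have s2 : smooth_on (cod c) (fun w => 'D_(iota (f w)) G w).
  exact: (smooth_dirU (@oE c) sG (d_iota sf)).
have d1 := smooth_diff s1 cz; have d2 := smooth_diff s2 cz.
have dk : differentiable (fun _ : VE => kap : R^o) z by exact: differentiable_cst.
have k0 : 'D_e (fun _ : VE => kap : R^o) z = 0 by exact: derive_cst.
have E1 := derive_scale e dk d2.
rewrite k0 in E1.
have E2 : 'D_e (fun w => 'D_(Ga w) f w + kap *: 'D_(iota (f w)) G w) z =
    'D_e (fun w => 'D_(Ga w) f w) z +
    kap *: ('D_(iota (f z)) ('D_e G) z + 'D_(iota ('D_e f z)) G z).
  apply: (eq_trans (derive_addf e d1 (differentiable_scale dk d2))).
  apply: (f_equal (fun x => _ + x)); apply: (eq_trans E1).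
  exact: (eq_trans (leib0 _ _) (f_equal (fun x => kap *: x) twist_curv)).
rewrite E2; exact: (curv_alg _ _ (flat_curv (findim_rV n) sf)).
Qed.
End Twist.
End Flat.

Section Main.
Variables (c : chart E) (z : VE) (del : 'rV[R]_m) (X Z : field E).
Hypotheses (cz : cod c z) (hX : vector_field X) (hZ : vector_field Z).
Hypothesis XN : \forall w \near z, X c w = euv del.

Let e : VE := euv del.
Let hG : vector_field tG. Proof. exact: vf_tG. Qed.
Let sG : smooth_on (cod c) (tG c). Proof. exact: vf_smooth hG. Qed.
Let Xz : X c z = e. Proof. exact: (nbhs_singleton XN). Qed.
Let ctX : \forall w \near z, ct (X c w) = 0. Proof. by apply: filterS XN => w ->; exact: ctU. Qed.
Let thX : \forall w \near z, th w (X c w) = 0. Proof. by apply: filterS XN => w ->; exact: thU. Qed.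
Let etX : \forall w \near z, et c w (X c w) = 0. Proof. by apply: filterS XN => w ->; exact: etU. Qed.
Let B := bracket tG X.
Let hB : vector_field B. Proof. exact: vf_bracket. Qed.

Lemma brGV : B c z = - 'D_e (tG c) z.
Proof.
rewrite /B bracketE Xz.
apply: (eq_trans (f_equal (fun x => x - _) (near_cst (tG c z) XN))).
exact: sub0r.
Qed.

Lemma ct_brGV : ct (B c z) = 0.
Proof.
rewrite /B (ct_br sG (vf_smooth c hX) cz); apply: zsub.
apply: (eq_trans (near_cst _ ctX)); apply: esym.
have -> : (fun w => ct (tG c w) : R^o) = fun=> 1 by apply/funext => w; exact: ctG.
exact: derive_cst.
Qed.

Lemma th_brGV : th z (B c z) = - del.
Proof.
rewrite /B (th_brG cz hX) (near_cst _ thX) Xz thU psU.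
by rewrite Gam0 addr0 sub0r.
Qed.

Lemma et_brGV_alg n (a : 'rV[R]_n) : 0 - 0 - (0 - (- a + (1 : R) *: a)) = 0.
Proof. by rewrite scale1r addNr !subr0. Qed.
Lemma dfrG_alg n (a b : 'rV[R]_n) : - ((1 : R) *: a) + (1 : R) *: ((1 : R) *: b) = - a + (1 : R) *: b.
Proof. by rewrite !scale1r. Qed.

Lemma et_brGV : et c z (B c z) = 0.
Proof.
have A := et_br sG (vf_smooth c hX) cz.
have cX : ct (X c z) = 0 by rewrite Xz; exact: ctU.
have tX : th z (X c z) = 0 by rewrite Xz; exact: thU.
have D1 := near_cst (tG c z) etX.
have D2' : 'D_(X c z) (fun w => et c w (tG c w)) z = 0.
  by apply: derive_fun0 => w; exact: etG.
have C1 : dfr 1 (cPsi s c) z (tG c z) (X c z) = 0 by exact: (dfr_00 _ _ _ cX tX).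
have C2 : dfr 1 (cPsi s c) z (X c z) (tG c z) =
    - 'D_e (cPsi s c) z + (1 : R) *: 'D_e (cPsi s c) z.
  apply: (eq_trans (dfr_th0 1 (cPsi s c) (X c z) (thG c z))).
  by rewrite ctG Xz cuU; exact: dfrG_alg.
rewrite D1 D2' C1 C2 in A.
by rewrite /B; apply: (eq_trans A); exact: et_brGV_alg.
Qed.

Lemma wHB_alg n (a b d : 'rV[R]_n) : b = - d ->
  (0 : R) *: a - 2^-1 *: b = - (- 2^-1 *: d).
Proof. by move=> ->; rewrite scale0r sub0r scalerN scaleNr. Qed.
Lemma wNB_alg n (a b d u : 'rV[R]_n) : b = - d -> u = 0 ->
  - ((0 : R) *: a) - b + u = - (- 1 *: d).
Proof. by move=> -> ->; rewrite scale0r oppr0 sub0r addr0 opprK scaleN1r opprK. Qed.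

Lemma D2N n (G : VE -> 'rV[R]_n) (w : VE) : smooth_on (cod c) G ->
  'D_w ('D_(euv (- del)) G) z = - 'D_w ('D_e G) z.
Proof.
move=> sG'.
have E : euv (- del) = - e by exact: (linearN (@euvL R m k)).
have N : \forall y \near z, 'D_(euv (- del)) G y = - 'D_e G y.
  apply: filterS (near_cod hE cz) => y cy; rewrite E.
  exact: (derive_dirN _ (smooth_diff sG' cy)).
apply: (eq_trans (near_eq_derive w N)).
by apply: deriveN; apply: diff_derivable; exact: (smooth_diff (smooth_D e sG') cz).
Qed.

Lemma wHB w : wH c z (B c z) w = - (- 2^-1 *: 'D_(euv w) ('D_e (cF s c)) z).
Proof.
rewrite wHE ct_brGV th_brGV; apply: wHB_alg.
exact: (D2N (euv w) (smF c)).
Qed.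

Lemma wNB w : wN c z (B c z) w = - (- 1 *: 'D_(eyv w) ('D_e (cPsi s c)) z).
Proof.
rewrite wNE ct_brGV th_brGV et_brGV; apply: wNB_alg; last exact: UpsV0l.
exact: (D2N (eyv w) (smPsi c)).
Qed.

Lemma near_wH (f : VE -> 'rV[R]_m) : \forall w \near z,
  'D_(X c w) f w + wH c w (X c w) (f w) = 'D_e f w.
Proof.
apply: filterS2 XN (near_cod hE cz) => w Xw cw; rewrite Xw.
have c0 : ct (euv del : VE) = 0 by exact: ctU.
have t0 : th w (euv del) = 0 by exact: thU.
apply: (eq_trans (f_equal (fun x => _ + x) (wHV c (f w) c0 t0))); exact: addr0.
Qed.
Lemma near_wN (f : VE -> 'rV[R]_k) : \forall w \near z,
  'D_(X c w) f w + wN c w (X c w) (f w) = 'D_e f w.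
Proof.
apply: filterS2 XN (near_cod hE cz) => w Xw cw; rewrite Xw.
have c0 : ct (euv del : VE) = 0 by exact: ctU.
have t0 : th w (euv del) = 0 by exact: thU.
have u0 : UpsV Ups c.2 (cy w) (et c w (euv del)) (f w) = 0 by rewrite etU; exact: UpsV0l.
apply: (eq_trans (f_equal (fun x => _ + x) (eq_trans (wNV c (f w) c0 t0) u0))).
exact: addr0.
Qed.

Let vn := vf_tnabla.
Let hXZ : vector_field (nab X Z). Proof. exact (vn hX hZ). Qed.
Let hGZ : vector_field (nab tG Z). Proof. exact (vn hG hZ). Qed.

(* (om, iota, kap, G) is (wH, euv, -1/2, F) for the components theta and psi, and
   (wN, eyv, -1, Psi) for eta. *)
Section Block.
Variables (n : nat) (comp : VE -> VE -> 'rV[R]_n) (om : VE -> VE -> 'rV[R]_n -> 'rV[R]_n).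
Variables (iota : 'rV[R]_n -> VE) (kap : R) (G : VE -> 'rV[R]_n).
Hypothesis comp_nab : forall V W w, vector_field V -> vector_field W -> cod c w ->
  comp w (nab V W c w) = 'D_(V c w) (fun y => comp y (W c y)) w
    + om w (V c w) (comp w (W c w)).
Hypothesis omG : forall w (y : 'rV[R]_n), cod c w -> om w (tG c w) y = kap *: 'D_(iota y) G w.
Hypothesis omX : forall f : VE -> 'rV[R]_n, \forall w \near z,
  'D_(X c w) f w + om w (X c w) (f w) = 'D_e f w.
Hypothesis omX0 : forall y : 'rV[R]_n, om z (X c z) y = 0.
Hypothesis omB : forall y : 'rV[R]_n, om z (B c z) y = - (kap *: 'D_(iota y) ('D_e G) z).
Hypothesis sm_comp : smooth_on (cod c) (fun y => comp y (Z c y)).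
Hypothesis sG' : smooth_on (cod c) G.
Hypothesis comp_sub3 : forall (a b d : VE) p q r, comp z a = p -> comp z b = q ->
  comp z d = r -> comp z (a - b - d) = p - q - r.
Hypothesis D_iota : forall (g : VE -> 'rV[R]_n) v, differentiable g z ->
  'D_v (fun w => iota (g w)) z = iota ('D_v g z).
Hypothesis d_iota : forall g : VE -> 'rV[R]_n, smooth_on (cod c) g ->
  smooth_on (cod c) (fun w => iota (g w)).
Let f := fun y : VE => comp y (Z c y).

Lemma curv_block : comp z (curvature nab tG X Z c z) = 0.
Proof.
have N1 : \forall w \near z, comp w (nab X Z c w) = 'D_e f w.
  apply: filterS2 (omX f) (near_cod hE cz) => w ow cw.
  by apply: (eq_trans (comp_nab hX hZ cw)); exact: ow.
have A1 : comp z (nab tG (nab X Z) c z) =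
    'D_(tG c z) ('D_e f) z + kap *: 'D_(iota ('D_e f z)) G z.
  apply: (eq_trans (comp_nab hG hXZ cz)).
  apply: (f_equal2 +%R); first exact: (near_eq_derive (tG c z) N1).
  apply: (eq_trans (f_equal (om z (tG c z)) (nbhs_singleton N1))); exact: omG.
have N2 : \forall w \near z, comp w (nab tG Z c w) =
    'D_(tG c w) f w + kap *: 'D_(iota (f w)) G w.
  apply: filterS (near_cod hE cz) => w cw.
  apply: (eq_trans (comp_nab hG hZ cw)); apply: (f_equal (fun x => _ + x)); exact: omG.
have A2 : comp z (nab X (nab tG Z) c z) =
    'D_e (fun w => 'D_(tG c w) f w + kap *: 'D_(iota (f w)) G w) z + 0.
  apply: (eq_trans (comp_nab hX hGZ cz)).
  apply: (f_equal2 +%R); last exact: omX0.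
  apply: (eq_trans (near_eq_derive (X c z) N2)).
  by rewrite Xz.
have A3 : comp z (nab B Z c z) =
    'D_(- 'D_e (tG c) z) f z - kap *: 'D_(iota (f z)) ('D_e G) z.
  apply: (eq_trans (comp_nab hB hZ cz)); rewrite omB.
  by apply: (f_equal (fun x => x - _)); rewrite brGV.
have -> : curvature nab tG X Z c z =
    nab tG (nab X Z) c z - nab X (nab tG Z) c z - nab B Z c z by [].
apply: (eq_trans (comp_sub3 A1 A2 A3)).
exact: (curv_zero e cz sG kap D_iota d_iota sm_comp sG').
Qed.
End Block.

Lemma near_eqD (W : normedModType R) (g h : VE -> W) (v w : VE) :
  (\forall y \near z, g y = h y) -> v = w -> 'D_v g z = 'D_w h z.
Proof. by move=> N ->; exact: near_eq_derive. Qed.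

(** dt carries no connection form, so this component of the curvature is the expression of
    [flat_curv]. *)
Lemma curv_ct : ct (curvature nab tG X Z c z) = 0.
Proof.
have sf : smooth_on (cod c) (fun y => ct (Z c y) : R^o) := sm_ct (vf_smooth c hZ).
set f := (fun y => ct (Z c y) : R^o) in sf.
have N1 : \forall w \near z, (fun w => ct (nab X Z c w) : R^o) w = 'D_e f w.
  apply: filterS2 XN (near_cod hE cz) => w Xw cw.
  apply: (eq_trans (ct_nabla hX hZ cw)).
  exact: (f_equal (fun v => 'D_v f w) Xw).
have N2 : \forall w \near z, (fun w => ct (nab tG Z c w) : R^o) w = 'D_(tG c w) f w.
  apply: filterS (near_cod hE cz) => w cw; exact: (ct_nabla hG hZ cw).
have A1 := eq_trans (ct_nabla hG hXZ cz) (near_eqD N1 erefl).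
have A2 := eq_trans (ct_nabla hX hGZ cz) (near_eqD N2 Xz).
have A3 := eq_trans (ct_nabla hB hZ cz)
  (f_equal (fun v => 'D_v f z) brGV).
have F := @flat_curv c z e (tG c) cz sG _ findim_R f sf.
have -> : curvature nab tG X Z c z =
    nab tG (nab X Z) c z - nab X (nab tG Z) c z - nab B Z c z by [].
exact (eq_trans (ct_sub3 A1 A2 A3) F).
Qed.

Lemma curv_GV : curvature nab tG X Z c z = 0.
Proof.
have cX : ct (X c z) = 0 by rewrite Xz; exact: ctU.
have tX : th z (X c z) = 0 by rewrite Xz; exact: thU.
have eX : et c z (X c z) = 0 by rewrite Xz; exact: etU.
have oG w (y : 'rV[R]_m) : cod c w -> wH c w (tG c w) y = - 2^-1 *: 'D_(euv y) (cF s c) w.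
  by move=> cw; apply: (eq_trans (wHG _ _ _)); exact: (GamD _ cw).
apply: (@frame_inj _ _ _ _ _ s c z).
- apply: (eq_trans curv_ct); exact: (esym ct0).
- rewrite th0.
  apply: (@curv_block m th (wH c) (@euv R m k) (- 2^-1) (cF s c)).
  + by move=> V W w hV hW cw; exact: (th_nabla hV hW cw).
  + exact: oG.
  + exact: near_wH.
  + by move=> y; exact: wHV.
  + exact: wHB.
  + exact: (sm_th (vf_smooth c hZ)).
  + exact: (smF c).
  + by move=> a b d p q r; exact: th_sub3.
  + by move=> g v dg; exact: D_euv.
  + by move=> g sg; exact: (smooth_euv (@oE c) sg).
- rewrite et0.
  apply: (@curv_block k (et c) (wN c) (@eyv R m k) (- 1) (cPsi s c)).
  + by move=> V W w hV hW cw; exact: (et_nabla hV hW cw).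
  + move=> w y cw; apply: (eq_trans (wNG _ _ _)); exact: (esym (scaleN1r _)).
  + exact: near_wN.
  + move=> y; apply: (eq_trans (wNV c y cX tX)).
    by rewrite eX; exact: UpsV0l.
  + exact: wNB.
  + exact: (sm_et (vf_smooth c hZ)).
  + exact: (smPsi c).
  + by move=> a b d p q r; exact: et_sub3.
  + by move=> g v dg; exact: D_eyv.
  + by move=> g sg; exact: (smooth_eyv (@oE c) sg).
- rewrite ps0.
  apply: (@curv_block m (ps c) (wH c) (@euv R m k) (- 2^-1) (cF s c)).
  + by move=> V W w hV hW cw; exact: (ps_nabla hV hW cw).
  + exact: oG.
  + exact: near_wH.
  + by move=> y; exact: wHV.
  + exact: wHB.
  + exact: (sm_ps (vf_smooth c hZ)).
  + exact: (smF c).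
  + by move=> a b d p q r; exact: ps_sub3.
  + by move=> g v dg; exact: D_euv.
  + by move=> g sg; exact: (smooth_euv (@oE c) sg).
Qed.
End Main.

Lemma YfrE (c : chart E) z (i j : 'I_k) : eyv (UpsV Ups c.2 (cy z) (delta_mx 0 i) (delta_mx 0 j)) =
  \sum_(l < k) Ups c.2 i j l (cy z) *: Yfr l z :> VE.
Proof.
rewrite eyv_sum; apply: eq_bigr => l _; apply: (f_equal (fun a : R => a *: e_y l)).
rewrite mxE (bigD1 i) //= (bigD1 j) //= !mxE !eqxx !mulr1.
rewrite big1 ?addr0 => [|j' /negPf nj]; last by rewrite !mxE nj !andbF !mulr0.
rewrite big1 ?addr0 // => i' /negPf ni; rewrite big1 // => j' _.
by rewrite !mxE ni andbF mulr0 mul0r.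
Qed.
Local Opaque tnabla tGamma bracket euv eyv.

Lemma tnabla_adapted : adapted Ups nab.
Proof.
split.
- move=> X hX c z cz; exact (nab_Gamma cz hX).
- move=> X Y hX hY c z cz; exact (nab_dt cz hX hY).
- move=> X Y hX hY c z cz; exact (zsub (nab_S cz hX hY)).
- move=> X Y hX hY c z cz; exact (zsub (nab_Q cz hX hY)).
- move=> c A a b X Y cA hX hY XV YV p Ap.
  have cz : cod c (coord c p) by exact: (cod_dom (proj2 cA _ Ap)).
  exact (nab_VV cz hX hY (XV _ Ap) (agree_near cA Ap YV)).
- move=> X hX c z cz; exact (tor_PH cz hX).
- move=> X hX c z cz; exact (tor_PV cz hX).
- move=> c A a X Z cA hX hZ XV p Ap.
  have cz : cod c (coord c p) by exact: (cod_dom (proj2 cA _ Ap)).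
  exact (curv_GV cz hX hZ (agree_near cA Ap XV)).
- move=> X Y hX hY c z cz; exact (zsub (nab_N cz hX hY)).
- move=> c A i j X Y cA hX hY XV YV p Ap.
  have cz : cod c (coord c p) by exact: (cod_dom (proj2 cA _ Ap)).
  have e := nab_YY cz hX hY (XV _ Ap) (agree_near cA Ap YV).
  exact (eq_trans e (YfrE _ _ _ _)).
- move=> X Y hX hY T c z cz; exact (zsub (tor_N cz hX hY)).
Qed.

Local Opaque tnabla tGamma bracket euv eyv Hv th et ps Gam.

(** * Uniqueness *)

Section Difference.
Variable D : field E -> field E -> field E.
Hypotheses (hD : linear_connection D) (hA : adapted Ups D).
Let hN : linear_connection nab := tnabla_connection.
Let aN : adapted Ups nab := tnabla_adapted.
Let hG : vector_field tG. Proof. exact: vf_tG. Qed.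

Section Point.
Variables (c : chart E) (p : pt E).
Hypothesis cp : dom c p.
Let z := coord c p.
Let cz : cod c z. Proof. exact: cod_dom. Qed.
Variable A : VE -> VE -> VE.
Hypothesis Al : forall (a : R) (u v w : VE), A (a *: u + v) w = a *: A u w + A v w.
Hypothesis Ar : forall (a : R) (u v w : VE), A w (a *: u + v) = a *: A w u + A w v.
Hypothesis AE : forall X Y, vector_field X -> vector_field Y ->
  D X Y c z = nab X Y c z + A (X c z) (Y c z).

(** The conditions on frame fields are stated over an open set; one set [B] serves all vectors, so
    that two extended fields can be inserted together. *)
Lemma point_fields : exists B, [/\ chart_open c B, B p & forall v,
  exists X, [/\ vector_field X, agree_on c B X (fun=> v) & X c z = v]].
Proof.
have [f [B hf]] := bE cp; exists B.
split; [exact: bump_open hf|exact: bump_in hf|move=> v].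
have ag q : B q -> bfield c f (fun=> v) c (coord c q) = v.
  by move=> Bq; exact: (bfield_one hE hf (fun=> v) Bq).
exists (bfield c f (fun=> v)); split.
- by apply: (vf_bfield hE hf); exact: smooth_cst.
- exact: ag.
- exact: (ag p (bump_in hf)).
Qed.

Lemma point_value v : exists2 X, vector_field X & X c z = v.
Proof.
by have [B [_ _ /(_ v) [X [hX _ Xz]]]] := point_fields; exists X.
Qed.

Lemma AG v : A v (tG c z) = 0.
Proof.
have [X hX Xz] := point_value v.
have e := AE hX hG; have e1 := nabla_Gamma hA hX cz; have e2 := nabla_Gamma aN hX cz.
rewrite e1 e2 Xz in e; apply: (addrI (zerof E c z)); apply: esym.
by apply: (eq_trans (addr0 _)).
Qed.

(** If the tensor is parallel for both connections, differentiation along a field commutes with it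
    in both, hence so does the difference [A]. *)
Lemma A_tensor (B : field E -> field E) (be : VE -> VE) :
  (forall X, B X c z = be (X c z)) -> (forall u v, be (u + v) = be u + be v) ->
  (forall Y, vector_field Y -> vector_field (B Y)) ->
  (forall X Y, vector_field X -> vector_field Y -> eqf (cov_tensor D B X Y) (zerof E)) ->
  (forall X Y, vector_field X -> vector_field Y -> eqf (cov_tensor nab B X Y) (zerof E)) ->
  forall v w, A v (be w) = be (A v w).
Proof.
move=> BE beD vB cD cN v w.
have [X hX Xz] := point_value v; have [Y hY Yz] := point_value w.
have e1 : D X (B Y) c z = be (D X Y c z).
  by apply: (eq_trans (subr0_eq (cD _ _ hX hY _ _ cz))); exact: BE.
have e2 : nab X (B Y) c z = be (nab X Y c z).
  by apply: (eq_trans (subr0_eq (cN _ _ hX hY _ _ cz))); exact: BE.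
have e3 := AE hX (vB _ hY); rewrite e1 e2 (AE hX hY) beD BE Xz Yz in e3.
by apply: esym; exact: (addrI _ e3).
Qed.

Lemma AS v w : A v (euv (th z w)) = euv (th z (A v w)).
Proof.
apply: (@A_tensor (@tS R m k M1 M2 s) (fun w => euv (th z w))).
- by move=> X; exact: tSz.
- by move=> u u'; rewrite thD euvD.
- by move=> Y hY; exact: (vf_tS hY).
- exact (nabla_S hA).
- exact (nabla_S aN).
Qed.
Lemma AQ v w : A v (Hv c z (ps c z w)) = Hv c z (ps c z (A v w)).
Proof.
apply: (@A_tensor (@tQ R m k M1 M2 s) (fun w => Hv c z (ps c z w))).
- by move=> X; exact: tQz.
- by move=> u u'; rewrite psD HvD.
- by move=> Y hY; exact: (vf_tQ hY).
- exact (nabla_Q hA).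
- exact (nabla_Q aN).
Qed.
Lemma AN v w : A v (eyv (et c z w)) = eyv (et c z (A v w)).
Proof.
apply: (@A_tensor (@PN R m k M1 M2 s) (fun w => eyv (et c z w))).
- by move=> X; exact: PNz.
- by move=> u u'; rewrite etD eyvD.
- by move=> Y hY; exact: (vf_PN hY).
- exact (nabla_N hA).
- exact (nabla_N aN).
Qed.
(** S maps H_a to V_a and Q maps V_a back, so [A v] preserves the span of the V_a and that of the
    H_a and acts on both by the same matrix. *)
Lemma AV v b : A v (euv b) = euv (th z (A v (Hv c z b))).
Proof. by rewrite -AS thH. Qed.
Lemma AH v b : A v (Hv c z b) = Hv c z (ps c z (A v (euv b))).
Proof. by rewrite -AQ psU. Qed.
Lemma AY v b : A v (eyv b) = eyv (et c z (A v (eyv b))).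
Proof. by rewrite -AN etY. Qed.

Lemma A0l (w : VE) : A 0 w = 0.
Proof. exact: (lin0 (f := fun v => A v w) (fun a u v => Al a u v w)). Qed.
Lemma A0r (w : VE) : A w 0 = 0.
Proof. exact: (lin0 (f := fun v => A w v) (fun a u v => Ar a u v w)). Qed.
Lemma ADl (u v w : VE) : A (u + v) w = A u w + A v w.
Proof. by have := Al 1 u v w; rewrite !scale1r. Qed.
Lemma ADr (u v w : VE) : A w (u + v) = A w u + A w v.
Proof. by have := Ar 1 u v w; rewrite !scale1r. Qed.
Lemma AZl (a : R) (u w : VE) : A (a *: u) w = a *: A u w.
Proof. by have := Al a u 0 w; rewrite addr0 A0l addr0. Qed.
Lemma AZr (a : R) (u w : VE) : A w (a *: u) = a *: A w u.
Proof. by have := Ar a u 0 w; rewrite addr0 A0r addr0. Qed.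

Lemma AN0_alg (V : lmodType R) (a : R) : a *: (0 : V) + 0 + 0 + 0 = 0.
Proof. by rewrite scaler0 !addr0. Qed.

(** Gamma is killed by [AG], and the H_a follow from the V_a by [AH], so two blocks remain to be
    tested. *)
Lemma A_zero v : (forall b : 'rV[R]_m, A v (euv b) = 0) ->
  (forall b : 'rV[R]_k, A v (eyv b) = 0) -> forall w : VE, A v w = 0.
Proof.
move=> hU hY w; rewrite (frame_dec c z w) !ADr AZr AG hU hY AH hU ps0 Hv0.
exact: AN0_alg.
Qed.

Lemma tor_diff_alg (V : zmodType) (n n' b a a' : V) :
  n + a - (n' + a') - b = n - n' - b + (a - a').
Proof. by rewrite opprD [X in X - b]addrACA; exact: addrAC. Qed.

Lemma tor_diff X Y : vector_field X -> vector_field Y ->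
  torsion D X Y c z = torsion nab X Y c z +
    (A (X c z) (Y c z) - A (Y c z) (X c z)).
Proof.
move=> hX hY.
apply: (eq_trans (f_equal2 (fun x y => x - y - bracket X Y c z) (AE hX hY) (AE hY hX))).
exact: tor_diff_alg.
Qed.

(** Both torsions T(Gamma, S X) equal P_H X, so [A] antisymmetrized vanishes on this pair; by [AG]
    one of its two terms is already 0. *)
Lemma AGU b : A (tG c z) (euv b) = 0.
Proof.
have [X hX Xz] := point_value (Hv c z b); have hS := vf_tS hX.
have Sz : tS X c z = euv b by rewrite tSz Xz thH.
have e := tor_diff hG hS.
have e1 := torsion_PH hA hX cz; have e2 := torsion_PH aN hX cz.
rewrite -e1 -e2 Sz AG subr0 in e.
by apply: (addrI (PH X c z)); rewrite -e; exact: (esym (addr0 _)).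
Qed.

Lemma AVV (a b : 'rV[R]_m) : A (euv a) (euv b) = 0.
Proof.
move: a; apply: lin0_delta => [r u v|i]; first by rewrite euvP Al.
move: b; apply: lin0_delta => [r u v|j]; first by rewrite euvP Ar.
have [B [oB Bp hB]] := point_fields.
have [X [hX aX Xz]] := hB (euv (delta_mx 0 i)).
have [Y [hY aY Yz]] := hB (euv (delta_mx 0 j)).
have e := AE hX hY.
have e1 : D X Y c z = 0 := nabla_VV hA oB hX hY aX aY Bp.
have e2 : nab X Y c z = 0 := nabla_VV aN oB hX hY aX aY Bp.
rewrite e1 e2 Xz Yz in e; apply: esym; apply: (eq_trans e); exact: add0r.
Qed.

Lemma AYY (a b : 'rV[R]_k) : A (eyv a) (eyv b) = 0.
Proof.
move: a; apply: lin0_delta => [r u v|i]; first by rewrite eyvP Al.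
move: b; apply: lin0_delta => [r u v|j]; first by rewrite eyvP Ar.
have [B [oB Bp hB]] := point_fields.
have [X [hX aX Xz]] := hB (eyv (delta_mx 0 i)).
have [Y [hY aY Yz]] := hB (eyv (delta_mx 0 j)).
have e := AE hX hY.
have e1 := nabla_YY hA oB hX hY aX aY Bp.
have e2 := nabla_YY aN oB hX hY aX aY Bp.
have e3 : D X Y c z = nab X Y c z := eq_trans e1 (esym e2).
rewrite e3 Xz Yz in e; apply: (addrI (nab X Y c z)); rewrite -e; exact: (esym (addr0 _)).
Qed.

Lemma tor_im (T : VE) : T - euv (ps c z T) = 0 -> et c z T = 0 /\ th z T = 0.
Proof. by move=> /subr0_eq ->; rewrite etU thU. Qed.

(** For such a pair both torsions lie in the image of P_V, where eta and theta vanish, and their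
    difference is [A] antisymmetrized. *)
Lemma A_torN v b : et c z v = 0 ->
  et c z (A v (eyv b) - A (eyv b) v) = 0 /\ th z (A v (eyv b) - A (eyv b) v) = 0.
Proof.
move=> ev; have [X hX Xz] := point_value v; have [Y hY Yz] := point_value (eyv b).
have hX' := vf_sub hE hX (vf_PN hX); have hY' := vf_PN hY.
have X'z : subf X (PN X) c z = v.
  by rewrite /subf PNz Xz ev eyv0 subr0.
have Y'z : PN Y c z = eyv b by rewrite PNz Yz etY.
have e := tor_diff hX' hY'; rewrite X'z Y'z in e.
have e1 := torsion_N hA hX hY cz; have e2 := torsion_N aN hX hY cz.
have f1 : torsion D (subf X (PN X)) (PN Y) c z -
  euv (ps c z (torsion D (subf X (PN X)) (PN Y) c z)) = 0.
  by apply: (eq_trans _ e1); rewrite /subf PVz.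
have f2 : torsion nab (subf X (PN X)) (PN Y) c z -
  euv (ps c z (torsion nab (subf X (PN X)) (PN Y) c z)) = 0.
  by apply: (eq_trans _ e2); rewrite /subf PVz.
have [g1 g2] := tor_im f1; have [g3 g4] := tor_im f2.
rewrite e etD g3 add0r in g1; rewrite e thD g4 add0r in g2.
by split.
Qed.

(** By [AY] the vector [A v (eyv b)] is determined by its eta component, which [A_torN] equates with
    that of [A (eyv b) v]. The latter is 0 for [v] = Gamma, V_a, H_a because [A (eyv b)] kills Gamma
    and preserves the other two blocks. *)
Lemma A_eyv v b : et c z v = 0 -> et c z (A (eyv b) v) = 0 -> A v (eyv b) = 0.
Proof.
move=> ev eA; have [e _] := A_torN b ev.
rewrite etB eA subr0 in e; rewrite AY e.
exact: eyv0.
Qed.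

Lemma AGY b : A (tG c z) (eyv b) = 0.
Proof. by apply: A_eyv; [exact: etG|rewrite AG et0]. Qed.
Lemma AVY a b : A (euv a) (eyv b) = 0.
Proof. by apply: A_eyv; [exact: etU|rewrite AV etU]. Qed.
Lemma AHY a b : A (Hv c z a) (eyv b) = 0.
Proof. by apply: A_eyv; [exact: etH|rewrite AH etH]. Qed.
(** The theta part of [A_torN] at H_a shows that [A (eyv b)] sends H_a to a vector without theta
    component; [AV] transfers this to V_a. *)
Lemma AYU b a : A (eyv b) (euv a) = 0.
Proof.
have [_ e] := A_torN b (etH c z a).
rewrite AHY thB th0 sub0r in e; move/eqP: e; rewrite oppr_eq0 => /eqP e.
by rewrite AV e euv0.
Qed.

Lemma A_Gamma w : A (tG c z) w = 0.
Proof. by apply: A_zero; [exact: AGU|exact: AGY]. Qed.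
Lemma A_V a w : A (euv a) w = 0.
Proof. by apply: A_zero => b; [exact: AVV|exact: AVY]. Qed.
Lemma A_Y a w : A (eyv a) w = 0.
Proof. by apply: A_zero => b; [exact: AYU|exact: AYY]. Qed.

End Point.

Lemma conn_eqG c p Y : dom c p -> vector_field Y ->
  D tG Y c (coord c p) = nab tG Y c (coord c p).
Proof.
move=> cp hY; have [A [Al Ar AE]] := diff_tensor findim_VE hE bE hD hN cp.
apply: (eq_trans (AE _ _ hG hY)).
apply: (eq_trans (f_equal (fun x => _ + x) (A_Gamma cp Ar AE _))); exact: addr0.
Qed.

Lemma conn_eqV c p X Y a : dom c p -> vector_field X -> vector_field Y ->
  X c (coord c p) = euv a -> D X Y c (coord c p) = nab X Y c (coord c p).
Proof.
move=> cp hX hY Xz; have [A [Al Ar AE]] := diff_tensor findim_VE hE bE hD hN cp.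
apply: (eq_trans (AE _ _ hX hY)); rewrite Xz.
apply: (eq_trans (f_equal (fun x => _ + x) (A_V cp Al Ar AE _ _))); exact: addr0.
Qed.

Lemma curv_alg3 (V : zmodType) (a b d d' : V) : a - b - d = 0 -> a - b - d' = 0 -> d = d'.
Proof. by move=> /subr0_eq <- /subr0_eq <-. Qed.

Lemma A_H_alg (V : lmodType R) (x y : V) : (0 : R) *: x + 0 - y + 0 = 0 -> y = 0.
Proof. by rewrite scale0r !add0r addr0 => /eqP; rewrite oppr_eq0 => /eqP. Qed.

Lemma uniqueness X Y : vector_field X -> vector_field Y -> eqf (D X Y) (nab X Y).
Proof.
move=> hX hY c _ [p cp <-]; set z := coord c p.
have cz : cod c z by exact: cod_dom.
have [A [Al Ar AE]] := diff_tensor findim_VE hE bE hD hN cp.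
have AH0 a w : A (Hv c z a) w = 0.
  move: a; apply: lin0_delta => [r u v|i]; first by rewrite HvD HvZ Al.
  have [B [oB Bp hB]] := point_fields cp.
  have [V [hV aV Vz]] := hB (euv (delta_mx 0 i)).
  have [Z hZ Zz] := point_value cp w.
  have VN := agree_near oB Bp aV.
  have hDN : vector_field (D V Z) := conn_field hD hV hZ.
  have hNN : vector_field (nab V Z) := conn_field hN hV hZ.
  have hDG : vector_field (D tG Z) := conn_field hD hG hZ.
  have hNG : vector_field (nab tG Z) := conn_field hN hG hZ.
  have hB' : vector_field (bracket tG V) by exact: (vf_bracket hE hG hV).
  (* The inner derivatives are differentiated again, so agreement is needed in a neighbourhood, on
     which [V] is still vertical. *)
  have N1 : \forall y \near coord c p, D V Z c y = nab V Z c y.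
    have N := near_cod hE cz; apply: filterS2 VN N => y Vy [q cq qy].
    by rewrite -qy in Vy *; exact: (conn_eqV cq hV hZ Vy).
  have N2 : \forall y \near coord c p, D tG Z c y = nab tG Z c y.
    by apply: filterS (near_cod hE cz) => y [q cq <-]; exact: (conn_eqG cq hZ).
  have E1 : D tG (D V Z) c z = nab tG (nab V Z) c z.
    apply: (eq_trans (conn_eqG cp hDN)).
    exact: (conn_near findim_VE hE bE hN cp hG hDN hNN N1).
  have E2 : D V (D tG Z) c z = nab V (nab tG Z) c z.
    apply: (eq_trans (conn_eqV cp hV hDG Vz)).
    exact: (conn_near findim_VE hE bE hN cp hV hDG hNG N2).
  have C1 : curvature D tG V Z c z = 0 := curvature_GV hA oB hV hZ aV Bp.
  have C2 : curvature nab tG V Z c z = 0 := curvature_GV aN oB hV hZ aV Bp.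
  have C1' : nab tG (nab V Z) c z - nab V (nab tG Z) c z - D (bracket tG V) Z c z = 0.
    by rewrite -E1 -E2; exact: C1.
  have E3 := curv_alg3 C1' C2.
  have AB : A (bracket tG V c z) w = 0.
    have e := AE _ _ hB' hZ; rewrite Zz E3 in e.
    by apply: (addrI (nab (bracket tG V) Z c z)); rewrite -e; exact: (esym (addr0 _)).
  rewrite (frame_dec c z (bracket tG V c z)) in AB.
  rewrite (ct_brGV cz hV VN) (th_brGV cz hV VN) (et_brGV cz hV VN) in AB.
  rewrite HvN in AB; move: AB.
  rewrite !(ADl Al) (A_V cp Al Ar AE) (A_Y cp Al Ar AE) (AZl Al).
  rewrite -scaleN1r (AZl Al) scaleN1r.
  exact: A_H_alg.
apply: (eq_trans (AE _ _ hX hY)).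
have -> : A (X c z) (Y c z) = 0.
  rewrite (frame_dec c z (X c z)) !(ADl Al) (AZl Al) AH0.
  rewrite (A_V cp Al Ar AE) (A_Y cp Al Ar AE) (A_Gamma cp Ar AE).
  exact: AN0_alg.
exact: addr0.
Qed.
End Difference.

End CharacterizedConnection.

Theorem theorem4p1 (R : realType) (m k : nat)
    (M1 : charted 'rV[R]_m) (M2 : charted 'rV[R]_k)
    (hM1 : smooth_manifold M1) (hM2 : smooth_manifold M2)
    (s : csys M1 M2) (hs : constrained_system s)
    (D2 : field M2 -> field M2 -> field M2)
    (hD2 : linear_connection D2)
    (Ups : chart M2 -> 'I_k -> 'I_k -> 'I_k -> 'rV[R]_k -> R)
    (hUps : has_coefficients D2 Ups) :
  [/\ forall X Y : field (Etilde s), vector_field X -> vector_field Y ->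
        eqf (tnabla Ups X Y) (tnabla_explicit Ups X Y),
      linear_connection (@tnabla R m k M1 M2 s Ups),
      adapted Ups (@tnabla R m k M1 M2 s Ups)
    & forall D : field (Etilde s) -> field (Etilde s) -> field (Etilde s),
        linear_connection D -> adapted Ups D ->
        forall X Y : field (Etilde s), vector_field X -> vector_field Y ->
          eqf (D X Y) (tnabla Ups X Y)].
Proof.
have h1 := smooth_manifold_pre hM1; have h2 := smooth_manifold_pre hM2.
have b1 := manifold_bumps hM1; have b2 := manifold_bumps hM2.
split.
- exact (tnabla_explicitE h1 h2 hs Ups).
- exact (tnabla_connection h1 h2 hs b1 b2 hD2 hUps).
- exact (tnabla_adapted h1 h2 hs b1 b2 hD2 hUps).
- exact (uniqueness h1 h2 hs b1 b2 hD2 hUps).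
Qed.
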